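(* Let $d \ge 1$, let $1 \le p < \infty$ and let $p'$ satisfy $\frac{1}{p} + \frac{1}{p'} = 1$. Assume $f \in L^p(\mathbb{R}^d)$, $\psi \in L^{p'}(\mathbb{R}^d)$, $\widehat{\psi} \in C^\infty(\mathbb{R}^d \setminus \{0\})$, and $$\langle f, \psi_{s,t} \rangle = 0 \qquad \text{for all } s>0,\ t \in \mathbb{R}^d .$$ If $\widehat{\psi}$ is nontrivial in every direction, then $f = 0$ almost everywhere.
   Context: Functions are complex-valued on $\mathbb{R}^d$. For $s>0$ and $t \in \mathbb{R}^d$, $\psi_{s,t}(x) = s^{-d/2}\, \psi\big(\frac{x-t}{s}\big)$, and $\langle f, \psi_{s,t}\rangle = \int_{\mathbb{R}^d} f(x)\, \overline{\psi_{s,t}(x)}\, dx$ (the continuous wavelet transform of $f$ with respect to $\psi$ at $(s,t)$). The Fourier transform is normalized by $\widehat{\psi}(\omega) = \int_{\mathbb{R}^d} \psi(x) e^{-2\pi i \omega\cdot x}\, dx$, and is extended to tempered distributions as usual. The hypothesis $\widehat{\psi} \in C^\infty(\mathbb{R}^d\setminus\{0\})$ means that there is a function $\nu \in C^\infty(\mathbb{R}^d\setminus\{0\})$ that represents the tempered distribution $\widehat{\psi}$ away from the origin: $\widehat{\psi}[\eta] = \int_{\mathbb{R}^d} \nu(\omega)\eta(\omega)\, d\omega$ for all test functions $\eta \in C_c^\infty(\mathbb{R}^d\setminus\{0\})$; the function $\nu$ is also denoted $\widehat{\psi}$. A function $\lambda$ is nontrivial in direction $\xi$, where $\xi$ is a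 unit vector in $\mathbb{R}^d$, if the set $\{ r>0 : \lambda(r\xi) \neq 0\}$ has positive measure (for $\lambda$ continuous away from the origin this means $\lambda(r\xi)\ne 0$ for some $r>0$). Thus ''$\widehat{\psi}$ is nontrivial in every direction'' means that $\nu$ is nontrivial in direction $\xi$ for every unit vector $\xi$. *)

(* Defs.v *)
From HB Require Import structures.
From mathcomp Require Import all_boot all_order all_algebra.
From mathcomp Require Import all_classical all_reals all_analysis.
From mathcomp Require Import complex.
Set Implicit Arguments.
Unset Strict Implicit.
Unset Printing Implicit Defensive.
Import Order.TTheory GRing.Theory Num.Theory.
Import numFieldNormedType.Exports.
Local Open Scope classical_set_scope.
Local Open Scope ring_scope.
Local Open Scope complex_scope.

Fact rV_display : measure_display.
Proof. exact: default_measure_display. Qed.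

(* The sigma-algebra on R^d generated by the coordinate functions; as R is
   second countable, this is the Borel sigma-algebra of R^d. *)
Section measurable_rV.
Context {R : realType} {d : nat}.

Let coords : 'I_d -> 'rV[R]_d -> R := fun i x => x ord0 i.

Let rV_set0 : g_sigma_preimage coords set0.
Proof. exact: sigma_algebra0. Qed.

Let rV_setC A : g_sigma_preimage coords A -> g_sigma_preimage coords (~` A).
Proof. exact: sigma_algebraC. Qed.

Let rV_bigcup (F : (set 'rV[R]_d)^nat) :
  (forall i, g_sigma_preimage coords (F i)) ->
  g_sigma_preimage coords (\bigcup_i F i).
Proof. exact: sigma_algebra_bigcup. Qed.

HB.instance Definition _ := @isMeasurable.Build rV_display
  'rV[R]_d (g_sigma_preimage coords) rV_set0 rV_setC rV_bigcup.

End measurable_rV.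

Lemma measurable_coord (R : realType) d (i : 'I_d) :
  measurable_fun [set: 'rV[R]_d] (fun x => x ord0 i).
Proof.
move=> _ Y mY; rewrite setTI; apply: sub_sigma_algebra => /=.
rewrite -bigcup_seq/=; exists i => /=; first by rewrite mem_index_enum.
by exists Y => //; rewrite setTI.
Qed.

Lemma measurable_fun_rV (R : realType) d (d1 : measure_display)
    (T : measurableType d1) (f : T -> 'rV[R]_d) :
  (forall i, measurable_fun [set: T] (fun x => f x ord0 i)) ->
  measurable_fun [set: T] f.
Proof.
move=> mf; apply: (measurability (\big[setU/set0]_(i < d)
  preimage_set_system setT (fun x : 'rV[R]_d => x ord0 i) measurable)) => //.
move=> _ [A + <-]; rewrite -bigcup_seq/= => -[i _ [B mB <-]].
by rewrite setTI -comp_preimage; exact: mf.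
Qed.

Section lebesgue_rV_step.
Context {R : realType} {n : nat}.

Let cons_rV (p : measurableTypeR R * 'rV[R]_n) : 'rV[R]_n.+1 :=
  row_mx (const_mx p.1 : 'rV_1) p.2.
Let uncons_rV (x : 'rV[R]_n.+1) : measurableTypeR R * 'rV[R]_n :=
  (x ord0 ord0, \row_j x ord0 (lift ord0 j)).

Let cons_rV0 p : cons_rV p ord0 ord0 = p.1.
Proof.
have -> : ord0 = lshift n (ord0 : 'I_1) :> 'I_(1 + n) by apply/val_inj.
by rewrite [LHS](@row_mxEl _ 1 1 n) mxE.
Qed.

Let cons_rV_lift p j : cons_rV p ord0 (lift ord0 j) = p.2 ord0 j.
Proof.
have -> : lift ord0 j = rshift 1 j :> 'I_(1 + n) by apply/val_inj.
by rewrite [LHS](@row_mxEr _ 1 1 n).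
Qed.

Let cons_rVK : cancel cons_rV uncons_rV.
Proof.
move=> [a v]; rewrite /uncons_rV cons_rV0; congr pair.
by apply/rowP => j; rewrite mxE cons_rV_lift.
Qed.

Let uncons_rVK : cancel uncons_rV cons_rV.
Proof.
move=> x; apply/rowP => i; case: (unliftP ord0 i) => [j|] ->.
- by rewrite cons_rV_lift mxE.
- by rewrite cons_rV0.
Qed.

Let mcons : measurable_fun [set: measurableTypeR R * 'rV[R]_n] cons_rV.
Proof.
apply: measurable_fun_rV => i; case: (unliftP ord0 i) => [j|] ->.
- under eq_fun do rewrite cons_rV_lift.
  apply: (measurableT_comp (@measurable_coord R n j)).
  exact: measurable_snd.
- under eq_fun do rewrite cons_rV0.
  exact: measurable_fst.
Qed.

Let muncons : measurable_fun [set: 'rV[R]_n.+1] uncons_rV.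
Proof.
apply: measurable_fun_pair => /=; first exact: measurable_coord.
apply: measurable_fun_rV => j.
by under eq_fun do rewrite mxE; exact: measurable_coord.
Qed.

Variable mu : {sigma_finite_measure set 'rV[R]_n -> \bar R}.

Definition lebesgue_rV_step : set 'rV[R]_n.+1 -> \bar R :=
  pushforward (lebesgue_measure \x mu)%E cons_rV.

Let pre A : measurable A -> measurable (cons_rV @^-1` A).
Proof. by move=> mA; rewrite -[X in measurable X]setTI; exact: mcons. Qed.

Let lebesgue_rV_step0 : lebesgue_rV_step set0 = 0%E.
Proof. by rewrite /lebesgue_rV_step /pushforward preimage_set0 measure0. Qed.

Let lebesgue_rV_step_ge0 A : (0 <= lebesgue_rV_step A)%E.
Proof. exact: measure_ge0. Qed.

Let lebesgue_rV_step_sigma_additive : semi_sigma_additive lebesgue_rV_step.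
Proof.
move=> F mF tF mUF; rewrite /lebesgue_rV_step /pushforward preimage_bigcup.
apply: measure_semi_sigma_additive.
- by move=> k; exact: pre.
- apply/trivIsetP => /= i j _ _ ij; rewrite -preimage_setI.
  by move/trivIsetP : tF => /(_ _ _ _ _ ij) ->//; rewrite preimage_set0.
- by rewrite -preimage_bigcup; exact: pre.
Qed.

HB.instance Definition _ := isMeasure.Build _ _ _ lebesgue_rV_step
  lebesgue_rV_step0 lebesgue_rV_step_ge0 lebesgue_rV_step_sigma_additive.

Let lebesgue_rV_step_sigma_finite : sigma_finite setT lebesgue_rV_step.
Proof.
have /sigma_finiteP[F [FT ndF Foo]] :=
  sigma_finiteT (@lebesgue_measure R : {sigma_finite_measure set _ -> \bar R}).
have /sigma_finiteP[G [GT ndG Goo]] := sigma_finiteT mu.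
exists (fun k => uncons_rV @^-1` (F k `*` G k)).
  rewrite -preimage_bigcup (_ : \bigcup_k (F k `*` G k) = setT).
    by rewrite preimage_setT.
  rewrite -setXTT FT GT predeqE => -[x y]; split.
    by move=> [k _ []/= ? ?]; split; exists k.
  move=> [/= [k _ Fnx] [l _ Gky]]; exists (maxn k l) => //; split.
  - by move: x Fnx; exact/subsetPset/ndF/leq_maxl.
  - by move: y Gky; exact/subsetPset/ndG/leq_maxr.
move=> k; have [mF Fk] := Foo k; have [mG Gk] := Goo k; split.
  by rewrite -[X in measurable X]setTI; apply: muncons => //; exact: measurableX.
rewrite /lebesgue_rV_step /pushforward -comp_preimage.
have -> : uncons_rV \o cons_rV = id by apply/funext => p; exact: cons_rVK.
by rewrite preimage_id product_measure1E// lte_mul_pinfty// ge0_fin_numE.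
Qed.

HB.instance Definition _ := @Measure_isSigmaFinite.Build _ _ _
  lebesgue_rV_step lebesgue_rV_step_sigma_finite.

Lemma lebesgue_rV_step_box (A : 'I_n.+1 -> set R) :
  (forall i, measurable (A i)) ->
  measurable [set x : 'rV[R]_n | forall i, A (lift ord0 i) (x ord0 i)] ->
  lebesgue_rV_step [set x | forall i, A i (x ord0 i)] =
  (lebesgue_measure (A ord0) *
   mu [set x | forall i, A (lift ord0 i) (x ord0 i)])%E.
Proof.
move=> mA mB.
have /= <- := product_measure1E (@lebesgue_measure R) mu (mA ord0) mB.
rewrite /lebesgue_rV_step /pushforward; congr (product_measure1 _ _ _).
apply/seteqP; split => p /=.
- move=> Ap; split => /=; first by have := Ap ord0; rewrite cons_rV0.
  by move=> i; have := Ap (lift ord0 i); rewrite cons_rV_lift.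
- move=> [A0 A1] i; case: (unliftP ord0 i) => [j|] ->.
  + by rewrite cons_rV_lift; exact: A1.
  + by rewrite cons_rV0.
Qed.

End lebesgue_rV_step.

(* Lebesgue measure on R^d, as a d-fold product of the one-dimensional one;
   lebesgue_rV_box below is its characteristic property. *)
Fixpoint lebesgue_rV (R : realType) (d : nat) :
    {sigma_finite_measure set 'rV[R]_d -> \bar R} :=
  if d is n.+1 then lebesgue_rV_step (lebesgue_rV R n) else \d_(0 : 'rV[R]_0).

Lemma measurable_box (R : realType) d (A : 'I_d -> set R) :
  (forall i, measurable (A i)) ->
  measurable [set x : 'rV[R]_d | forall i, A i (x ord0 i)].
Proof.
move=> mA; pose B i := [set x : 'rV[R]_d | A i (x ord0 i)].
have -> : [set x : 'rV[R]_d | forall i, A i (x ord0 i)] = \bigcap_i B i.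
  by apply/seteqP; split => x /= Ax i => [_|]; exact: Ax.
apply: fin_bigcap_measurable => // i _.
by rewrite /B -[X in measurable X]setTI; exact: measurable_coord.
Qed.

Lemma lebesgue_rV_box (R : realType) d (A : 'I_d -> set R) :
  (forall i, measurable (A i)) ->
  lebesgue_rV R d [set x | forall i, A i (x ord0 i)] =
  (\prod_(i < d) lebesgue_measure (A i))%E.
Proof.
elim: d A => [|d IH] A mA.
  by rewrite big_ord0 /= diracE mem_set//= => -[].
have mB := @measurable_box R d (fun i => A (lift ord0 i)) (fun i => mA _).
rewrite big_ord_recl -IH; last by move=> i; exact: mA.
exact: lebesgue_rV_step_box.
Qed.

Section wavelet.
Context {R : realType} {d : nat}.
Local Notation mu := (lebesgue_rV R d).
Implicit Types (f g psi nu eta : 'rV[R]_d -> R[i]) (U : set 'rV[R]_d).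

Definition cintegral f : R[i] :=
  (\int[mu]_x complex.Re (f x)) +i* (\int[mu]_x complex.Im (f x)).

(* p may be +oo, in which case the norm is the essential supremum. *)
Definition Lp_fun (p : \bar R) f : Prop :=
  [/\ measurable_fun [set: 'rV[R]_d] (fun x => complex.Re (f x)),
      measurable_fun [set: 'rV[R]_d] (fun x => complex.Im (f x)) &
      ('N[mu]_p[EFin \o @Normc.normc R \o f] < +oo)%E].

(* psi_{s,t}(x) = s^{-d/2} psi((x - t) / s) *)
Definition dilate_translate psi (s : R) (t : 'rV[R]_d) : 'rV[R]_d -> R[i] :=
  fun x => (s `^ (- (d%:R / 2)))%:C * psi (s^-1 *: (x - t)).

Definition pairing f g : R[i] := cintegral (fun x => f x * (g x)^*).

Definition dot (x y : 'rV[R]_d) : R := \sum_(i < d) x ord0 i * y ord0 i.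

Definition fourier f (w : 'rV[R]_d) : R[i] :=
  let e x := 2 * pi * dot w x in
  cintegral (fun x => f x * (cos (e x) -i* sin (e x))).

(* For s = [:: i_1; ...; i_k], the partial derivative d_{i_1} ... d_{i_k} g. *)
Definition iter_partial (s : seq 'I_d) (g : 'rV[R]_d -> R) : 'rV[R]_d -> R :=
  foldr (fun i h x => 'D_(delta_mx ord0 i) h x) g s.

(* C^oo on U, for U open: partial derivatives of all orders exist and are
   continuous on U. The values of g outside of U play no role. *)
Definition smooth_on U (g : 'rV[R]_d -> R) : Prop :=
  forall (s : seq 'I_d) (x : 'rV[R]_d), U x ->
    {for x, continuous (iter_partial s g)} /\
    forall i, derivable (iter_partial s g) x (delta_mx ord0 i).

Definition csmooth_on U f : Prop :=
  smooth_on U (fun x => complex.Re (f x)) /\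
  smooth_on U (fun x => complex.Im (f x)).

Definition supp f : set 'rV[R]_d := closure [set x | f x != 0].

Definition test_function U eta : Prop :=
  [/\ csmooth_on [set: 'rV[R]_d] eta, compact (supp eta) & supp eta `<=` U].

(* Distributions are modelled as bare functionals on functions: only their
   values at test functions, or at Fourier transforms of test functions (which
   are Schwartz functions), are ever used. *)
Definition distribution_of psi : ('rV[R]_d -> R[i]) -> R[i] :=
  fun eta => cintegral (fun x => psi x * eta x).

(* Fourier transform of a tempered distribution, by duality. *)
Definition fourier_distribution (T : ('rV[R]_d -> R[i]) -> R[i]) :
  ('rV[R]_d -> R[i]) -> R[i] := fun eta => T (fourier eta).

Definition represents_on U (T : ('rV[R]_d -> R[i]) -> R[i]) nu : Prop :=
  forall eta, test_function U eta -> T eta = distribution_of nu eta.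

(* The library norm on 'rV[R]_d is the sup norm; unit vectors are meant for the
   Euclidean norm. *)
Definition unit_vector (xi : 'rV[R]_d) : Prop := dot xi xi = 1.

Definition nontrivial_in_direction nu (xi : 'rV[R]_d) : Prop :=
  (0 < lebesgue_measure [set r : R | (0 < r)%R /\ nu (r *: xi) != 0%R])%E.

End wavelet.

(* Main.v *)
(* Write T(g) for the integral of f times the Fourier transform of g.  For a
   test function h supported away from 0, the Fourier transform of
   h * conj (nu (s .)) at x is, up to a constant, the integral over t of
   (Fourier h)(t) * conj (psi ((x - t) / s)); so the vanishing of the wavelet
   coefficients gives T(h * conj (nu (s .))) = 0.  Since nu is nontrivial in
   every direction, the sets {nu (s .) <> 0} cover every annulus, and by
   compactness every test function g supported in an annulus is a finite sum of
   functions h_i * conj (nu (s_i .)), where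
   h_i = g * nu (s_i .) / sum_j |nu (s_j .)|^2.  Hence T vanishes on test
   functions supported away from 0.

   Let chi be a plateau function, equal to 1 near 0, and let e_y be a character.
   T(e_y chi(a .)) does not depend on a > 0, and as p < oo it tends to 0 as
   a -> oo; so it is 0.  By Fourier inversion every test function is a
   superposition of such functions, and T vanishes on all test functions.
   Therefore the integrable function f * Fourier (chi (a .)) has zero Fourier
   transform, and f = 0 almost everywhere on the set where Fourier (chi (a .))
   does not vanish, which contains a ball of radius proportional to a.

   Uniqueness of the Fourier transform in L^1 is proved as follows: the bounded
   m such that multiplication by m preserves the functions with zero Fourier
   transform are closed under products and bounded limits and contain the sines.
   As (1 - t^n)^(n 2^n) tends to 1 or 0 according to whether t < 1/2 or t >= 1/2,
   they contain the indicators of half-spaces, hence of all Borel sets. *)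

From HB Require Import structures.
From mathcomp Require Import all_boot all_order all_algebra.
From mathcomp Require Import all_classical all_reals all_analysis.
From mathcomp Require Import measurable_realfun ess_sup_inf complex ring lra.
Require Import Defs.
Set Implicit Arguments.
Unset Strict Implicit.
Unset Printing Implicit Defensive.
Import Order.TTheory GRing.Theory Num.Theory.
Import numFieldNormedType.Exports.
Local Open Scope classical_set_scope.
Local Open Scope ring_scope.
Local Open Scope complex_scope.

(** * Lebesgue measure and integrals on R^d *)

(** The finiteness of [p] enters when a character is spread out. The Fourier transform of
    [e_y chi (a .)] keeps its L^1 norm while its supremum is of order a^(-d); splitting the pairing
    with [f] according to |f| <= l bounds it by l A + l^(1-p) a^(-d) B. One fixes l small, then
    takes a large. For p = oo a nonzero constant, whose Fourier transform is concentrated at the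
    origin, can be orthogonal to all wavelets.

    Fourier inversion is deduced from L^1 uniqueness, without Gaussians. Write S g for the inverse
    transform of the transform of g. For test functions g and v, both (S g) v and g (S v) have as
    transform the convolution of the transforms of g and v, so they coincide. Taking for v a plateau
    reflected about a point w gives (S g)(w) = c g(w) with a single constant c.

    The estimates rest on the weight prod_i (1 + x_i^2)^(-1). It is integrable, and its square
    leaves room for one factor |x|, which makes transforms Lipschitz continuous. *)

Section affine1.
Context {R : realType}.
Local Notation leb := (@lebesgue_measure R).

Lemma measurable_affine1 (a b : R) :
  measurable_fun [set: R] (fun x : R => a * x + b).
Proof. by apply: measurable_funD => //; apply: measurable_funM. Qed.

Lemma lebesgue_measure_affine_itvoo (a b u v : R) : a != 0 ->
  leb [set x | a * x + b \in `]u, v[] = (`|a|^-1%:E * leb `]u, v[%classic)%E.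
Proof.
move=> a0; rewrite lebesgue_measure_itv/=.
have [a1|a1|a1] := ltgtP a 0; last by rewrite a1 eqxx in a0.
- have -> : [set x | a * x + b \in `]u, v[] = `](v - b) / a, (u - b) / a[%classic.
    apply/seteqP; split => x /=; rewrite !in_itv/=.
      by rewrite ltr_ndivrMr// ltr_ndivlMr// => /andP[? ?]; apply/andP; split; lra.
    by rewrite ltr_ndivrMr// ltr_ndivlMr// => /andP[? ?]; apply/andP; split; lra.
  rewrite lebesgue_measure_itv/= !lte_fin ltr_ndivrMr// divfK//.
  rewrite ltrD2r; case: ifPn => _; last by rewrite mule0.
  by rewrite -!EFinD -EFinM ltr0_norm//; congr EFin; field.
- have -> : [set x | a * x + b \in `]u, v[] = `](u - b) / a, (v - b) / a[%classic.
    apply/seteqP; split => x /=; rewrite !in_itv/=.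
      by rewrite ltr_pdivrMr// ltr_pdivlMr// => /andP[? ?]; apply/andP; split; lra.
    by rewrite ltr_pdivrMr// ltr_pdivlMr// => /andP[? ?]; apply/andP; split; lra.
  rewrite lebesgue_measure_itv/= !lte_fin ltr_pdivrMr// divfK ?gt_eqF//.
  rewrite ltrD2r; case: ifPn => _; last by rewrite mule0.
  by rewrite -!EFinD -EFinM gtr0_norm//; congr EFin; field.
Qed.

(** Both sides are measures in [A]: a pushforward and a multiple of Lebesgue measure. They agree on
    open intervals, a generating class closed under intersection, and the intervals []-n, n[]
    exhaust the line with finite measure. *)
Lemma lebesgue_measure_affine (a b : R) (A : set R) : a != 0 -> measurable A ->
  leb [set x | A (a * x + b)] = (`|a|^-1%:E * leb A)%E.
Proof.
move=> a0 mA.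
pose phi := (fun x : measurableTypeR R => (a * x + b : measurableTypeR R)).
have mphi : measurable_fun setT phi by exact: measurable_affine1.
pose phim : {mfun (measurableTypeR R) >-> (measurableTypeR R)} :=
  HB.pack phi (isMeasurableFun.Build _ _ _ _ phi mphi).
have a0' : 0 <= `|a|^-1 by rewrite invr_ge0.
have -> : leb [set x | A (a * x + b)] = pushforward leb phim A by [].
have -> : (`|a|^-1%:E * leb A)%E = mscale (NngNum a0') leb A by [].
apply: (@measure_unique _ R (measurableTypeR R) (@RGenOpens.G R)
  (fun n => `](- n%:R), n%:R[%classic) _ _ _ _
  (pushforward leb phim) (mscale (NngNum a0') leb)) => //.
- exact: RGenOpens.measurableE.
- move=> _ _ [x [y ->]] [x' [y' ->]]; exists (Num.max x x'), (Num.min y y').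
  apply/seteqP; split => z /=; rewrite !in_itv/= gt_max lt_min.
    by move=> [/andP[-> ->] /andP[-> ->]].
  by move=> /andP[/andP[-> ->] /andP[-> ->]].
- by move=> i; exists (- i%:R), i%:R.
- apply/seteqP; split => // x _.
  exists (Num.truncn `|x|).+1 => //=.
  by rewrite in_itv/= -ltr_norml truncnS_gt.
- move=> _ [x [y ->]]; exact: lebesgue_measure_affine_itvoo.
- move=> k.
  rewrite [ltLHS](lebesgue_measure_affine_itvoo b (- k%:R) k%:R a0).
  rewrite lebesgue_measure_itv/=.
  by case: ifPn => _; rewrite ?mule0// -EFinD -EFinM ltry.
Qed.

End affine1.

Section rV_measure.
Context {R : realType} {d : nat}.
Local Notation mu := (lebesgue_rV R d).

Lemma measurable_affine (a : R) (b : 'rV[R]_d) :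
  measurable_fun [set: 'rV[R]_d] (fun x => a *: x + b).
Proof.
apply: measurable_fun_rV => i; under eq_fun do rewrite !mxE.
by apply: measurable_funD => //; apply: measurable_funM => //; exact: measurable_coord.
Qed.

(** Boxes with arbitrary measurable sides are closed under intersection, generate the sigma-algebra,
    and are exactly the sets that [lebesgue_rV_box] measures. This is what uniqueness of measures
    requires. *)
Definition rV_boxes : set (set 'rV[R]_d) :=
  [set B | exists A : 'I_d -> set R, (forall i, measurable (A i)) /\
        B = [set x : 'rV[R]_d | forall i, A i (x ord0 i)]].

Lemma rV_boxes_gen : @measurable _ 'rV[R]_d = <<s rV_boxes >>.
Proof.
apply/seteqP; split.
- apply: smallest_sub; first exact: smallest_sigma_algebra.
  move=> A/=; rewrite -bigcup_seq/= => -[i _ [B mB <-]].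
  apply: sub_sigma_algebra; exists (fun j => if j == i then B else setT).
  split; first by move=> j; case: ifP.
  apply/seteqP; split => x /=; last by move=> /(_ i); rewrite eqxx.
  by move=> [_ Bx] j; case: eqP => // ->.
- apply: smallest_sub; first exact: sigma_algebra_measurable.
  by move=> _ [A [mA ->]]; exact: measurable_box.
Qed.

Lemma prode_scale (n : nat) (c : R) (F : 'I_n -> \bar R) :
  (\prod_(i < n) (c%:E * F i) = (c ^+ n)%:E * \prod_(i < n) F i)%E.
Proof. by rewrite big_split/= prodEFin prodr_const card_ord. Qed.

(** Uniqueness of measures again, now on [rV_boxes]: each of the [d] sides contributes one factor
    1/|a|. *)
Lemma lebesgue_rV_affine (a : R) (b : 'rV[R]_d) (A : set 'rV[R]_d) :
  a != 0 -> measurable A ->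
  mu [set x | A (a *: x + b)] = ((`|a|^-1 ^+ d)%:E * mu A)%E.
Proof.
move=> a0 mA.
pose phi := (fun x : 'rV[R]_d => a *: x + b).
have mphi : measurable_fun setT phi by exact: measurable_affine.
pose phim : {mfun 'rV[R]_d >-> 'rV[R]_d} :=
  HB.pack phi (isMeasurableFun.Build _ _ _ _ phi mphi).
have a0' : 0 <= `|a|^-1 ^+ d by rewrite exprn_ge0// invr_ge0.
have -> : mu [set x | A (a *: x + b)] = pushforward mu phim A by [].
have -> : ((`|a|^-1 ^+ d)%:E * mu A)%E = mscale (NngNum a0') mu A by [].
have boxE (B : 'I_d -> set R) : (forall i, measurable (B i)) ->
  (mu [set x : 'rV[R]_d | forall i, B i ((a *: x + b)%R ord0 i)] =
  (`|a|^-1 ^+ d)%:E * \prod_(i < d) lebesgue_measure (B i))%E.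
  move=> mB; rewrite -prode_scale.
  under [RHS]eq_bigr => i _ do rewrite -(lebesgue_measure_affine (b ord0 i))//.
  rewrite -lebesgue_rV_box; last first.
    move=> i; rewrite -[X in measurable X]setTI.
    by apply: measurable_affine1 => //; exact: mB.
  by congr (mu _); apply/seteqP; split => x /= + i => /(_ i); rewrite !mxE.
apply: (@measure_unique _ R 'rV[R]_d rV_boxes
  (fun n => [set x : 'rV[R]_d | forall i, `](- n%:R), n%:R[%classic (x ord0 i)]) _ _ _ _
  (pushforward mu phim) (mscale (NngNum a0') mu)) => //.
- exact: rV_boxes_gen.
- move=> _ _ [B [mB ->]] [C [mC ->]]; exists (fun i => B i `&` C i).
  split; first by move=> i; exact: measurableI.
  apply/seteqP; split => x /=; first by move=> [h1 h2] i.
  by move=> h; split => i; have [] := h i.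
- by move=> i; exists (fun=> `](- i%:R), i%:R[%classic).
- apply/seteqP; split => // x _.
  exists (\max_(i < d) (Num.truncn `|x ord0 i|).+1)%N => //= i.
  rewrite in_itv/= -ltr_norml; apply: lt_le_trans (truncnS_gt _) _.
  by rewrite ler_nat; exact: leq_bigmax.
- move=> _ [B [mB ->]]; rewrite /pushforward/= /mscale/= lebesgue_rV_box//.
  exact: boxE.
- move=> k; rewrite [ltLHS](boxE (fun=> `](- k%:R), k%:R[%classic))//.
  rewrite (_ : (\prod_(i < d) _)%E =
    \prod_(i < d) (if (- k%:R < k%:R :> R)%R then (k%:R + k%:R :> R) else 0%R)%:E)%E.
    by rewrite prodEFin -EFinM ltry.
  apply: eq_bigr => i _; rewrite lebesgue_measure_itv/= lte_fin.
  by case: ifP => // _; rewrite opprK.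
Qed.

End rV_measure.

Section rV_topology.
Context {R : realType} {d : nat}.

Lemma rV_coord_le_norm (x : 'rV[R]_d) i : `|x ord0 i| <= `|x|.
Proof.
rewrite [leRHS]mx_normrE.
exact: (@le_bigmax _ _ _ 0 (fun ij : 'I_1 * 'I_d => `|x ij.1 ij.2|) (ord0, i)).
Qed.

Lemma rV_norm_lt (x : 'rV[R]_d) (e : R) : 0 < e ->
  (forall i, `|x ord0 i| < e) -> `|x| < e.
Proof.
move=> e0 xe; rewrite [ltLHS]mx_normrE; apply/bigmax_ltP; split => //= -[i j] _ /=.
by rewrite ord1.
Qed.

(** The sigma-algebra is generated by coordinates, so its relation to the topology has to be proved.
    An open set is the union of the cubes that it contains, with rational centres and radii 1/(n+1),
    and there are countably many of them. *)
Lemma open_measurable_rV (U : set 'rV[R]_d) : open U -> measurable U.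
Proof.
move=> oU.
pose B (qn : 'rV[rat]_d * nat) : set 'rV[R]_d :=
  [set x | forall i, x ord0 i \in `](ratr (qn.1 ord0 i) - qn.2.+1%:R^-1),
                                   (ratr (qn.1 ord0 i) + qn.2.+1%:R^-1)[].
have mB qn : measurable (B qn).
  exact: (@measurable_box R d (fun i => `](ratr (qn.1 ord0 i) - qn.2.+1%:R^-1),
                                   (ratr (qn.1 ord0 i) + qn.2.+1%:R^-1)[%classic)).
have -> : U = \bigcup_qn (if `[< B qn `<=` U >] then B qn else set0).
  apply/seteqP; split => x; last first.
    by move=> [qn _]; case: ifPn => // /asboolP; apply.
  move=> Ux; have /nbhs_ballP[e /= e0 eU] := open_nbhs_nbhs (conj oU Ux).
  (* [x] and every point of the cube lie within 1/(n+1) of its rational centre, hence within [e] of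
     each other. *)
  have [n ne] : exists n : nat, n.+1%:R^-1 < e / 2.
    exists (Num.truncn (e / 2)^-1); rewrite invf_plt ?posrE ?divr_gt0//.
    exact: truncnS_gt.
  have n0 : 0 < (n.+1%:R^-1 : R) by rewrite invr_gt0.
  have hq i : {q : rat | ratr q \in `](x ord0 i - n.+1%:R^-1), (x ord0 i + n.+1%:R^-1)[}.
    apply/cid; have [|q qin] := @rat_in_itvoo R (x ord0 i - n.+1%:R^-1) (x ord0 i + n.+1%:R^-1).
      by rewrite ltrBlDr -addrA ltrDl addr_gt0.
    by exists q.
  exists (\row_i sval (hq i), n) => //.
  have Bx : B (\row_i sval (hq i), n) x.
    move=> i /=; rewrite mxE; case: (hq i) => q /=; rewrite !in_itv/=.
    move: (ratr q) (x ord0 i) (_^-1) => u v r /andP[? ?].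
    by apply/andP; split; lra.
  case: ifPn => // /asboolPn; apply: contra_notP => _ y By; apply: eU.
  rewrite mx_norm_ball /ball_/=; apply: rV_norm_lt => // i; rewrite !mxE.
  move: (By i) (Bx i) ne => /=; rewrite !in_itv/= ltr_distlC mxE.
  move: (ratr (sval (hq i))) => u.
  move: (x ord0 i) (y ord0 i) (_^-1) => v w r.
  by move=> /andP[? ?] /andP[? ?] ?; apply/andP; split; lra.
apply: countable_bigcupT_measurable => [|qn]; first exact: countableP.
by case: ifPn.
Qed.

Lemma continuous_measurable_rV (g : 'rV[R]_d -> R) :
  continuous g -> measurable_fun [set: 'rV[R]_d] g.
Proof.
move=> cg; apply: (measurability _ (RGenOpens.measurableE R)) => //.
move=> _ [_ [a [b ->]] <-]; rewrite setTI.
by apply: open_measurable_rV; apply: open_comp.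
Qed.

End rV_topology.

Section rV_integral.
Context {R : realType} {d : nat}.
Local Notation mu := (lebesgue_rV R d).

Lemma ge0_integral_affine (a : R) (b : 'rV[R]_d) (F : 'rV[R]_d -> \bar R) :
  a != 0 -> measurable_fun setT F -> (forall x, (0 <= F x)%E) ->
  (\int[mu]_x F (a *: x + b)%R = (`|a|^-1 ^+ d)%:E * \int[mu]_x F x)%E.
Proof.
move=> a0 mF F0.
pose phi := (fun x : 'rV[R]_d => a *: x + b).
have mphi : measurable_fun setT phi by exact: measurable_affine.
pose phim : {mfun 'rV[R]_d >-> 'rV[R]_d} :=
  HB.pack phi (isMeasurableFun.Build _ _ _ _ phi mphi).
have a0' : 0 <= `|a|^-1 ^+ d by rewrite exprn_ge0// invr_ge0.
have -> : (\int[mu]_x F (a *: x + b)%R = \int[pushforward mu phim]_x F x)%E.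
  by rewrite ge0_integral_pushforward// preimage_setT.
rewrite (eq_measure_integral (mscale (NngNum a0') mu)).
  by rewrite ge0_integral_mscale.
by move=> A mA _; exact: lebesgue_rV_affine.
Qed.

Lemma integrable_affine (a : R) (b : 'rV[R]_d) (F : 'rV[R]_d -> R) :
  a != 0 -> mu.-integrable setT (EFin \o F) ->
  mu.-integrable setT (EFin \o (fun x => F (a *: x + b))).
Proof.
move=> a0 /integrableP[mF Foo]; apply/integrableP; split.
  by apply: (measurableT_comp mF); exact: measurable_affine.
rewrite (ge0_integral_affine b (F := fun x => `|(F x)%:E|%E))//; last exact: measurableT_comp.
by rewrite lte_mul_pinfty.
Qed.

Lemma Rintegral_affine (a : R) (b : 'rV[R]_d) (F : 'rV[R]_d -> R) :
  a != 0 -> mu.-integrable setT (EFin \o F) ->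
  \int[mu]_x F (a *: x + b) = `|a|^-1 ^+ d * \int[mu]_x F x.
Proof.
move=> a0 iF; have mF := measurable_int _ iF.
have cF (G : 'rV[R]_d -> \bar R) : measurable_fun setT G -> (forall x, (0 <= G x)%E) ->
    (\int[mu]_x (G \o (fun x => a *: x + b)%R) x = (`|a|^-1 ^+ d)%:E * \int[mu]_x G x)%E.
  exact: ge0_integral_affine.
rewrite /Rintegral [in RHS]integralE [in LHS]integralE.
set I1 := (X in fine (X - _)); set I2 := (X in fine (_ - X)).
have -> : I1 = ((`|a|^-1 ^+ d)%:E * \int[mu]_x (EFin \o F)^\+ x)%E.
  rewrite -cF//; last exact: measurable_funepos.
  by apply: eq_integral => x _; rewrite /= !funeposE.
have -> : I2 = ((`|a|^-1 ^+ d)%:E * \int[mu]_x (EFin \o F)^\- x)%E.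
  rewrite -cF//; last exact: measurable_funeneg.
  by apply: eq_integral => x _; rewrite /= !funenegE.
rewrite -muleBr//; last exact: integrable_add_def.
rewrite fineM// fin_numD fin_numN.
by rewrite integrable_pos_fin_num// integrable_neg_fin_num.
Qed.

End rV_integral.

(** * Complex-valued integrals *)

Section complex_lemmas.
Context {R : realType}.
Implicit Types x y : R[i].

Lemma Re_mul x y :
  complex.Re (x * y) = complex.Re x * complex.Re y - complex.Im x * complex.Im y.
Proof. by case: x y => [a b] [c d]. Qed.

Lemma Im_mul x y :
  complex.Im (x * y) = complex.Re x * complex.Im y + complex.Im x * complex.Re y.
Proof. by case: x y => [a b] [c d]. Qed.

Lemma Re_add x y : complex.Re (x + y) = complex.Re x + complex.Re y.
Proof. by case: x y => [a b] [c d]. Qed.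

Lemma Im_add x y : complex.Im (x + y) = complex.Im x + complex.Im y.
Proof. by case: x y => [a b] [c d]. Qed.

Lemma Re_conj x : complex.Re (Num.conj x) = complex.Re x.
Proof. by case: x. Qed.

Lemma Im_conj x : complex.Im (Num.conj x) = - complex.Im x.
Proof. by case: x. Qed.

Lemma complex_eqP x y :
  complex.Re x = complex.Re y -> complex.Im x = complex.Im y -> x = y.
Proof. by case: x y => [a b] [c d] /= -> ->. Qed.

Lemma normc_conj x : Normc.normc (Num.conj x) = Normc.normc x.
Proof. by case: x => a b; rewrite /= sqrrN. Qed.

Lemma normc_ge0 x : 0 <= Normc.normc x.
Proof. by case: x => a b; exact: sqrtr_ge0. Qed.

Lemma Re_le_normc x : `|complex.Re x| <= Normc.normc x.
Proof.
by case: x => a b /=; rewrite -sqrtr_sqr ler_wsqrtr// lerDl sqr_ge0.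
Qed.

Lemma Im_le_normc x : `|complex.Im x| <= Normc.normc x.
Proof.
by case: x => a b /=; rewrite -sqrtr_sqr ler_wsqrtr// lerDr sqr_ge0.
Qed.

Lemma normc_le x : Normc.normc x <= `|complex.Re x| + `|complex.Im x|.
Proof.
case: x => a b /=; rewrite -[leRHS]ger0_norm ?addr_ge0// -sqrtr_sqr ler_wsqrtr//.
rewrite sqrrD !real_normK ?num_real// addrAC lerDl.
by rewrite mulrn_wge0// mulr_ge0.
Qed.

Lemma normc_RtoC (r : R) : Normc.normc r%:C = `|r|.
Proof. by rewrite /= expr0n/= addr0 sqrtr_sqr. Qed.

Definition cis (t : R) : R[i] := cos t +i* sin t.

Lemma cis0 : cis 0 = 1.
Proof. by rewrite /cis cos0 sin0. Qed.

Lemma cisD s t : cis (s + t) = cis s * cis t.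
Proof. by apply: complex_eqP; rewrite /= ?cosD ?sinD//; ring. Qed.

Lemma conj_cis t : Num.conj (cis t) = cis (- t).
Proof. by apply: complex_eqP; rewrite ?Re_conj ?Im_conj/= ?cosN ?sinN. Qed.

Lemma normc_cis t : Normc.normc (cis t) = 1.
Proof. by rewrite /= cos2Dsin2 sqrtr1. Qed.

Lemma cisE t : cos t -i* sin t = cis (- t).
Proof. by rewrite /cis cosN sinN. Qed.

End complex_lemmas.

Section cmeasurable.
Context {R : realType} {d1 : measure_display} {T : measurableType d1}.
Implicit Types f g : T -> R[i].

Definition cmeasurable f : Prop :=
  measurable_fun [set: T] (fun x => complex.Re (f x)) /\
  measurable_fun [set: T] (fun x => complex.Im (f x)).

Lemma cmeasurable_cst (c : R[i]) : cmeasurable (fun=> c).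
Proof. by split. Qed.

Lemma cmeasurableD f g :
  cmeasurable f -> cmeasurable g -> cmeasurable (fun x => f x + g x).
Proof.
move=> [f1 f2] [g1 g2]; split.
  by under eq_fun do rewrite Re_add; exact: measurable_funD.
by under eq_fun do rewrite Im_add; exact: measurable_funD.
Qed.

Lemma cmeasurableM f g :
  cmeasurable f -> cmeasurable g -> cmeasurable (fun x => f x * g x).
Proof.
move=> [f1 f2] [g1 g2]; split.
  by under eq_fun do rewrite Re_mul; apply: measurable_funB; exact: measurable_funM.
by under eq_fun do rewrite Im_mul; apply: measurable_funD; exact: measurable_funM.
Qed.

Lemma cmeasurable_conj f : cmeasurable f -> cmeasurable (fun x => Num.conj (f x)).
Proof.
move=> [f1 f2]; split; first by under eq_fun do rewrite Re_conj.
by under eq_fun do rewrite Im_conj; exact: measurableT_comp.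
Qed.

Lemma cmeasurable_normc f :
  cmeasurable f -> measurable_fun [set: T] (fun x => Normc.normc (f x)).
Proof.
move=> [f1 f2].
rewrite (_ : (fun x => _) = (fun x => Num.sqrt (complex.Re (f x) ^+ 2 + complex.Im (f x) ^+ 2))).
  apply: (measurableT_comp (f := @Num.sqrt R)).
    by apply: continuous_measurable_fun; exact: sqrt_continuous.
  by apply: measurable_funD; exact: measurable_funX.
by apply/funext => x; case: (f x).
Qed.

Lemma cmeasurable_cis (f : T -> R) :
  measurable_fun [set: T] f -> cmeasurable (fun x => cis (f x)).
Proof.
move=> mf; split => /=.
  apply: (measurableT_comp (f := @cos R)) => //.
  by apply: continuous_measurable_fun; exact: continuous_cos.
apply: (measurableT_comp (f := @sin R)) => //.
by apply: continuous_measurable_fun; exact: continuous_sin.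
Qed.

Lemma cmeasurable_RtoC (f : T -> R) :
  measurable_fun [set: T] f -> cmeasurable (fun x => (f x)%:C).
Proof. by split. Qed.

End cmeasurable.

Lemma cmeasurable_comp (R : realType) d1 (T1 : measurableType d1)
    d2 (T2 : measurableType d2) (phi : T1 -> T2) (f : T2 -> R[i]) :
  cmeasurable f -> measurable_fun setT phi -> cmeasurable (fun x => f (phi x)).
Proof.
move=> [f1 f2] mphi; split; first exact: (measurableT_comp f1).
exact: (measurableT_comp f2).
Qed.

Section cintegrable.
Context {R : realType} {d1 : measure_display} {T : measurableType d1}.
Variable m : {measure set T -> \bar R}.
Implicit Types f g : T -> R[i].

Definition cintegrable f : Prop :=
  cmeasurable f /\ (\int[m]_x (Normc.normc (f x))%:E < +oo)%E.

Lemma cintegrable_Re f : cintegrable f ->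
  m.-integrable setT (EFin \o (fun x => complex.Re (f x))).
Proof.
move=> [mf foo]; apply/integrableP; split.
  by apply/measurable_EFinP; case: mf.
apply: le_lt_trans foo; apply: ge0_le_integral => //.
- by do 2 apply/measurableT_comp => //; case: mf.
- by apply/measurable_EFinP; exact: cmeasurable_normc.
- by move=> x _; rewrite lee_fin; exact: Re_le_normc.
Qed.

Lemma cintegrable_Im f : cintegrable f ->
  m.-integrable setT (EFin \o (fun x => complex.Im (f x))).
Proof.
move=> [mf foo]; apply/integrableP; split.
  by apply/measurable_EFinP; case: mf.
apply: le_lt_trans foo; apply: ge0_le_integral => //.
- by do 2 apply/measurableT_comp => //; case: mf.
- by apply/measurable_EFinP; exact: cmeasurable_normc.
- by move=> x _; rewrite lee_fin; exact: Im_le_normc.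
Qed.

Lemma cintegrable_normc f : cintegrable f ->
  m.-integrable setT (EFin \o (fun x => Normc.normc (f x))).
Proof.
move=> [mf foo]; apply/integrableP; split.
  by apply/measurable_EFinP; exact: cmeasurable_normc.
by under eq_integral do rewrite /= ger0_norm ?normc_ge0//.
Qed.

Lemma le_cintegrable f (g : T -> R) : cmeasurable f ->
  (forall x, Normc.normc (f x) <= g x) ->
  m.-integrable setT (EFin \o g) -> cintegrable f.
Proof.
move=> mf fg /integrableP[mg goo]; split => //.
apply: le_lt_trans goo; apply: ge0_le_integral => //.
- by move=> x _; rewrite lee_fin normc_ge0.
- by apply/measurable_EFinP; exact: cmeasurable_normc.
- exact: measurableT_comp.
- by move=> x _; rewrite lee_fin; apply: le_trans (fg x) _; exact: ler_norm.
Qed.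

Lemma cintegrableD f g :
  cintegrable f -> cintegrable g -> cintegrable (fun x => f x + g x).
Proof.
move=> fi gi; apply: (le_cintegrable _ _ (integrableD measurableT
  (cintegrable_normc fi) (cintegrable_normc gi))).
  by apply: cmeasurableD; [case: fi|case: gi].
by move=> x; exact: le_normcD.
Qed.

Lemma cintegrableM f g (M : R) : cintegrable f -> cmeasurable g ->
  (forall x, Normc.normc (g x) <= M) -> cintegrable (fun x => f x * g x).
Proof.
move=> fi mg gM; apply: (le_cintegrable _ _ (integrableZl measurableT M
  (cintegrable_normc fi))).
  by apply: cmeasurableM => //; case: fi.
move=> x; rewrite Normc.normcM mulrC ler_wpM2r ?normc_ge0//.
Qed.

Lemma cintegrable_conj f : cintegrable f -> cintegrable (fun x => Num.conj (f x)).
Proof.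
move=> [mf fi]; split; first exact: cmeasurable_conj.
by under eq_integral do rewrite normc_conj.
Qed.

End cintegrable.

Section cintegral_lemmas.
Context {R : realType} {d : nat}.
Local Notation mu := (lebesgue_rV R d).
Implicit Types f g : 'rV[R]_d -> R[i].

Lemma eq_cintegral f g : (forall x, f x = g x) -> cintegral f = cintegral g.
Proof. by move=> fg; have -> : f = g by apply/funext. Qed.

Lemma cintegral0 : cintegral (fun _ : 'rV[R]_d => 0 : R[i]) = 0.
Proof. by apply: complex_eqP; rewrite /= /Rintegral integral0. Qed.

Lemma cintegralD f g : cintegrable mu f -> cintegrable mu g ->
  cintegral (fun x => f x + g x) = cintegral f + cintegral g.
Proof.
move=> fi gi; apply: complex_eqP; rewrite /= ?(Re_add, Im_add)/=.
  under [LHS]eq_Rintegral do rewrite Re_add.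
  by rewrite RintegralD//; exact: cintegrable_Re.
under [LHS]eq_Rintegral do rewrite Im_add.
by rewrite RintegralD//; exact: cintegrable_Im.
Qed.

Lemma cintegralZ (c : R[i]) f : cintegrable mu f ->
  cintegral (fun x => c * f x) = c * cintegral f.
Proof.
move=> fi; have fr := cintegrable_Re fi; have fI := cintegrable_Im fi.
have iZ (r : R) h : mu.-integrable setT (EFin \o h) ->
    mu.-integrable setT (EFin \o (fun x => r * h x)).
  move=> ih; have := integrableZl measurableT r ih.
  by apply: eq_integrable => // x _.
apply: complex_eqP; rewrite /= ?(Re_mul, Im_mul)/=.
  under [LHS]eq_Rintegral do rewrite Re_mul.
  by rewrite RintegralB ?RintegralZl//; exact: iZ.
under [LHS]eq_Rintegral do rewrite Im_mul.
by rewrite RintegralD ?RintegralZl//; exact: iZ.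
Qed.

Lemma cintegral_conj f :
  cintegrable mu f -> cintegral (fun x => Num.conj (f x)) = Num.conj (cintegral f).
Proof.
move=> fi; apply: complex_eqP; rewrite ?Re_conj ?Im_conj/=.
  by under [LHS]eq_Rintegral do rewrite Re_conj.
under [LHS]eq_Rintegral do rewrite Im_conj -mulN1r.
by rewrite RintegralZl ?mulN1r//; exact: cintegrable_Im.
Qed.

(* The constant 2 is not optimal; it comes from bounding the real and the
   imaginary part separately. *)
Lemma normc_cintegral f : cintegrable mu f ->
  Normc.normc (cintegral f) <= 2 * \int[mu]_x Normc.normc (f x).
Proof.
move=> fi; apply: le_trans (normc_le _) _ => /=.
rewrite mulr2n mulrDl mul1r; apply: lerD.
  apply: le_trans (le_normr_Rintegral _ (cintegrable_Re fi)) _ => //.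
  apply: le_Rintegral => //; [|exact: cintegrable_normc|].
    exact: (integrable_abse (cintegrable_Re fi)).
  by move=> x _; exact: Re_le_normc.
apply: le_trans (le_normr_Rintegral _ (cintegrable_Im fi)) _ => //.
apply: le_Rintegral => //; [|exact: cintegrable_normc|].
  exact: (integrable_abse (cintegrable_Im fi)).
by move=> x _; exact: Im_le_normc.
Qed.

Lemma cintegrable_affine (a : R) (b : 'rV[R]_d) f : a != 0 ->
  cintegrable mu f -> cintegrable mu (fun x => f (a *: x + b)).
Proof.
move=> a0 [mf fi]; split.
  by apply: (cmeasurable_comp mf); exact: measurable_affine.
rewrite (ge0_integral_affine b (F := fun x => (Normc.normc (f x))%:E))//.
- by rewrite lte_mul_pinfty.
- by apply/measurable_EFinP; exact: cmeasurable_normc.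
- by move=> x; rewrite lee_fin normc_ge0.
Qed.

Lemma cintegral_affine (a : R) (b : 'rV[R]_d) f : a != 0 -> cintegrable mu f ->
  cintegral (fun x => f (a *: x + b)) = (`|a|^-1 ^+ d)%:C * cintegral f.
Proof.
move=> a0 fi; apply: complex_eqP; rewrite ?(Re_mul, Im_mul)/= !mul0r.
  rewrite subr0 -(Rintegral_affine b a0)//; exact: cintegrable_Re.
by rewrite addr0 -(Rintegral_affine b a0)//; exact: cintegrable_Im.
Qed.

End cintegral_lemmas.

(** The inner integrals here are [fine] values. They agree with the extended ones of [Fubini] only
    where the section is integrable, that is, almost everywhere. *)
Lemma Rintegral_Fubini (R : realType) d1 d2 (T1 : measurableType d1)
    (T2 : measurableType d2) (m1 : {sigma_finite_measure set T1 -> \bar R})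
    (m2 : {sigma_finite_measure set T2 -> \bar R}) (H : T1 * T2 -> R) :
  (m1 \x m2)%E.-integrable setT (EFin \o H) ->
  \int[m1]_x \int[m2]_y H (x, y) = \int[m2]_y \int[m1]_x H (x, y).
Proof.
move=> iH; rewrite /Rintegral.
have := Fubini iH; rewrite /= => E.
transitivity (fine (\int[m1]_x \int[m2]_y (H (x, y))%:E)%E).
  congr fine; apply: ae_eq_integral => //.
  - apply/measurable_EFinP; apply: measurableT_comp => //.
    exact: (measurable_fubini_F iH).
  - exact: (measurable_fubini_F iH).
  - have := ae_integrable1 iH; apply: filterS => x ix _.
    by rewrite /= fineK//; exact: integrable_fin_num.
rewrite E; congr fine; apply: ae_eq_integral => //.
- exact: (measurable_fubini_G iH).
- apply/measurable_EFinP; apply: measurableT_comp => //.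
  exact: (measurable_fubini_G iH).
- have := ae_integrable2 iH; apply: filterS => x ix _.
  by rewrite /= fineK//; exact: integrable_fin_num.
Qed.

Lemma cintegral_Fubini (R : realType) (d d' : nat)
    (H : 'rV[R]_d -> 'rV[R]_d' -> R[i]) :
  cmeasurable (fun z : 'rV[R]_d * 'rV[R]_d' => H z.1 z.2) ->
  (\int[lebesgue_rV R d]_x \int[lebesgue_rV R d']_y (Normc.normc (H x y))%:E < +oo)%E ->
  cintegral (fun x => cintegral (H x)) = cintegral (fun y => cintegral (fun x => H x y)).
Proof.
move=> mH Hoo.
have nH : cintegrable (lebesgue_rV R d \x lebesgue_rV R d')%E
    (fun z : 'rV[R]_d * 'rV[R]_d' => H z.1 z.2).
  split => //; rewrite fubini_tonelli1//=.
    by apply/measurable_EFinP; exact: (cmeasurable_normc mH).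
  by move=> x; rewrite lee_fin normc_ge0.
apply: complex_eqP => /=.
  exact: (Rintegral_Fubini (cintegrable_Re nH)).
exact: (Rintegral_Fubini (cintegrable_Im nH)).
Qed.

(** * Pairings of L^p functions *)

Section weight.
Context {R : realType}.

Lemma integral_oneDsqrV_lty :
  (\int[@lebesgue_measure R]_x (oneDsqr x)^-1%:E < +oo)%E.
Proof.
rewrite (@ge0_symfun_integralT R (fun x => (oneDsqr x)^-1)).
- have -> : [set x : R | 0 <= x] = `[0, +oo[%classic.
    by apply/seteqP; split => x; rewrite /= in_itv/= andbT.
  by rewrite integral0y_oneDsqr -EFinM ltry.
- by move=> x; rewrite invr_ge0.
- exact: continuous_oneDsqrV.
- by move=> x; rewrite /= /oneDsqr sqrrN.
Qed.

(** A common majorant for test functions and their transforms. The product form reduces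
    integrability to dimension one and matches the Fourier side, where 1 + w_i^2 comes from a
    differential operator in the i-th variable ([bessel_op]). *)
Definition weight {d : nat} (x : 'rV[R]_d) : R := \prod_(i < d) (oneDsqr (x ord0 i))^-1.

Lemma weight_gt0 d (x : 'rV[R]_d) : 0 < weight x.
Proof. by apply: prodr_gt0 => i _; rewrite invr_gt0. Qed.

Lemma weight_ge0 d (x : 'rV[R]_d) : 0 <= weight x.
Proof. exact: ltW (weight_gt0 x). Qed.

Lemma weight_le1 d (x : 'rV[R]_d) : weight x <= 1.
Proof.
apply: prodr_ile1 => i _; apply/andP; split; [by rewrite invr_ge0|exact: oneDsqrV_le1].
Qed.

Lemma measurable_weight d : measurable_fun [set: 'rV[R]_d] weight.
Proof.
rewrite /weight; under eq_fun do rewrite /=.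
apply: measurable_prod => i _.
apply: (measurableT_comp (f := fun t : R => (oneDsqr t)^-1)).
  by apply: continuous_measurable_fun; exact: continuous_oneDsqrV.
exact: measurable_coord.
Qed.

Lemma integral_weight_lty d : (\int[lebesgue_rV R d]_x (weight x)%:E < +oo)%E.
Proof.
elim: d => [|n IH].
  rewrite (@le_lt_trans _ _ (\int[lebesgue_rV R 0]_x 1%:E)%E)//.
    apply: ge0_le_integral => //.
    - by move=> x _; rewrite lee_fin weight_ge0.
    - by apply/measurable_EFinP; exact: measurable_weight.
    - by move=> x _; rewrite lee_fin weight_le1.
  by rewrite integral_cst// mul1e /= diracE ltry.
pose cons (p : measurableTypeR R * 'rV[R]_n) : 'rV[R]_n.+1 :=
  row_mx (const_mx p.1 : 'rV_1) p.2.
have cons0 p : cons p ord0 ord0 = p.1.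
  have -> : ord0 = lshift n (ord0 : 'I_1) :> 'I_(1 + n) by apply/val_inj.
  by rewrite [LHS](@row_mxEl _ 1 1 n) mxE.
have consS p j : cons p ord0 (lift ord0 j) = p.2 ord0 j.
  have -> : lift ord0 j = rshift 1 j :> 'I_(1 + n) by apply/val_inj.
  by rewrite [LHS](@row_mxEr _ 1 1 n).
have mcons : measurable_fun setT cons.
  apply: measurable_fun_rV => i; case: (unliftP ord0 i) => [j|] ->.
    under eq_fun do rewrite consS.
    by apply: (measurableT_comp (@measurable_coord R n j)); exact: measurable_snd.
  by under eq_fun do rewrite cons0; exact: measurable_fst.
have -> : (\int[lebesgue_rV R n.+1]_x (weight x)%:E =
  \int[(@lebesgue_measure R \x lebesgue_rV R n)%E]_p (weight (cons p))%:E)%E.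
  (* By conversion: [lebesgue_rV] in dimension [n.+1] is the pushforward of a product along the map
     [cons]. *)
  rewrite -[LHS]/(\int[pushforward (@lebesgue_measure R \x lebesgue_rV R n)%E cons]_x (weight x)%:E)%E.
  rewrite ge0_integral_pushforward//.
  - by apply/measurable_EFinP; exact: measurable_weight.
  - by move=> x _; rewrite lee_fin weight_ge0.
have weightS p : weight (cons p) = (oneDsqr p.1)^-1 * weight p.2.
  by rewrite /weight big_ord_recl cons0; congr (_ * _); apply: eq_bigr => i _; rewrite consS.
rewrite fubini_tonelli1//; last 2 first.
  by apply/measurable_EFinP; apply: (measurableT_comp (@measurable_weight n.+1)).
  by move=> x; rewrite lee_fin weight_ge0.
rewrite /fubini_F.
have fI : (\int[lebesgue_rV R n]_x (weight x)%:E)%E \is a fin_num.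
  by rewrite ge0_fin_numE// integral_ge0// => x _; rewrite lee_fin weight_ge0.
have inner t : (\int[lebesgue_rV R n]_y (weight (cons (t, y)))%:E =
    (oneDsqr t)^-1%:E * \int[lebesgue_rV R n]_y (weight y)%:E)%E.
  under eq_integral do rewrite weightS EFinM /=.
  rewrite ge0_integralZl//=.
  - by apply/measurable_EFinP; exact: measurable_weight.
  - by move=> x _; rewrite lee_fin weight_ge0.
under eq_integral do rewrite inner.
rewrite ge0_integralZr//.
- rewrite muleC lte_mul_pinfty//; last exact: integral_oneDsqrV_lty.
  by apply: integral_ge0 => x _; rewrite lee_fin weight_ge0.
- apply/measurable_EFinP.
  by apply: continuous_measurable_fun; exact: continuous_oneDsqrV.
- by apply: integral_ge0 => x _; rewrite lee_fin weight_ge0.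
Qed.

Lemma integrable_weight d : (lebesgue_rV R d).-integrable setT (EFin \o weight).
Proof.
apply/integrableP; split; first by apply/measurable_EFinP; exact: measurable_weight.
under eq_integral do rewrite /= ger0_norm ?weight_ge0//.
exact: integral_weight_lty.
Qed.

End weight.

Section Lp_pairing.
Context {R : realType} {d : nat}.
Local Notation mu := (lebesgue_rV R d).
Local Notation normc := (@Normc.normc R).

Lemma Lp_fun_cmeasurable (p : \bar R) (f : 'rV[R]_d -> R[i]) :
  Lp_fun p f -> cmeasurable f.
Proof. by move=> []. Qed.

Lemma Lp_fun_integral_powR (p : R) (f : 'rV[R]_d -> R[i]) : 1 <= p ->
  Lp_fun p%:E f -> (\int[mu]_x (normc (f x) `^ p)%:E < +oo)%E.
Proof.
move=> p1 [_ _ fp].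
have p0 : p != 0 by rewrite gt_eqF// (lt_le_trans ltr01).
have := poweR_Lnorm mu (EFin \o normc \o f) p0.
under eq_integral do rewrite /= ger0_norm ?normc_ge0//.
move=> <-; exact: poweR_lty.
Qed.

Lemma measurable_normc_powR (p : R) (f : 'rV[R]_d -> R[i]) : cmeasurable f ->
  measurable_fun [set: 'rV[R]_d] (fun x => normc (f x) `^ p).
Proof.
move=> mf; apply: (@measurableT_comp _ _ _ _ _ _ (@powR R ^~ p)) => //.
exact: cmeasurable_normc.
Qed.

(* Split according to whether [|f| <= l]; this replaces Hoelder's inequality
   for bounded integrable [g]. *)
Lemma Lp_pairing_bound (p : R) (f g : 'rV[R]_d -> R[i]) (B l : R) : 1 <= p ->
  0 < l -> 0 <= B -> cmeasurable f -> cmeasurable g ->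
  (forall x, normc (g x) <= B) ->
  (\int[mu]_x (normc (f x) * normc (g x))%:E <=
   l%:E * \int[mu]_x (normc (g x))%:E +
   (l `^ (1 - p) * B)%:E * \int[mu]_x (normc (f x) `^ p)%:E)%E.
Proof.
move=> p1 l0 B0 mf mg gB.
have c0 : 0 <= l `^ (1 - p) * B by rewrite mulr_ge0// powR_ge0.
have mfp := measurable_normc_powR p mf.
rewrite -ge0_integralZl//; last 3 first.
- by apply/measurable_EFinP; exact: cmeasurable_normc.
- by move=> x _; rewrite lee_fin normc_ge0.
- by rewrite lee_fin ltW.
rewrite -ge0_integralZl//; last 2 first.
- by apply/measurable_EFinP.
- by move=> x _; rewrite lee_fin powR_ge0.
rewrite -ge0_integralD//; last 4 first.
- by move=> x _; rewrite -EFinM lee_fin mulr_ge0 ?normc_ge0// ltW.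
- by apply/measurable_EFinP; apply: measurable_funM => //; exact: cmeasurable_normc.
- by move=> x _; rewrite -EFinM lee_fin mulr_ge0 ?powR_ge0.
- by apply/measurable_EFinP; apply: measurable_funM.
apply: ge0_le_integral => //.
- by move=> x _; rewrite lee_fin mulr_ge0 ?normc_ge0.
- by apply/measurable_EFinP; apply: measurable_funM; exact: cmeasurable_normc.
- by apply/measurable_EFinP; apply: measurable_funD; apply: measurable_funM => //;
    exact: cmeasurable_normc.
move=> x _; rewrite -!EFinM -EFinD lee_fin.
have nf0 := normc_ge0 (f x); have ng0 := normc_ge0 (g x).
have [fl|lf] := leP (normc (f x)) l.
  by rewrite ler_wpDr ?ler_wpM2r// mulr_ge0// powR_ge0.
rewrite ler_wpDl ?mulr_ge0// ?(ltW l0)//.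
have fpos : 0 < normc (f x) by exact: lt_trans lf.
rewrite mulrAC; apply: ler_pM => //.
(* Here |f| > l and 1 - p <= 0, so |f|^(1-p) <= l^(1-p). *)
have E : normc (f x) = normc (f x) `^ (1 - p) * normc (f x) `^ p.
  by rewrite -powRD ?subrK ?powRr1// gt_eqF// implybT.
rewrite [leLHS]E ler_wpM2r ?powR_ge0//.
rewrite -[1 - p]opprB !powRN lef_pV2 ?posrE ?powR_gt0//.
by apply: ge0_ler_powR; rewrite ?nnegrE ?subr_ge0// ltW.
Qed.

Lemma Lp_pairing_lty (p : R) (f g : 'rV[R]_d -> R[i]) (B : R) : 1 <= p ->
  Lp_fun p%:E f -> cintegrable mu g -> (forall x, normc (g x) <= B) ->
  cintegrable mu (fun x => f x * g x).
Proof.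
move=> p1 fp [mg gi] gB; have mf := Lp_fun_cmeasurable fp.
have B0 : 0 <= B by exact: le_trans (normc_ge0 _) (gB 0).
split; first exact: cmeasurableM.
under eq_integral do rewrite Normc.normcM.
apply: le_lt_trans (Lp_pairing_bound p1 ltr01 B0 mf mg gB) _.
rewrite lte_add_pinfty// lte_mul_pinfty ?lee_fin ?mulr_ge0 ?powR_ge0//.
exact: Lp_fun_integral_powR.
Qed.

(* Young's inequality instead of Hoelder's: the bound only has to be uniform
   in [b], which follows from translation invariance. *)
Lemma Lp_pairing_affine (p : R) (p' : \bar R) (f g : 'rV[R]_d -> R[i]) (a : R) :
  1 <= p -> (p%:E^-1 + p'^-1 = 1)%E -> Lp_fun p%:E f -> Lp_fun p' g -> a != 0 ->
  exists C : R, forall b : 'rV[R]_d,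
    (\int[mu]_x (normc (f x) * normc (g (a *: x + b)%R))%:E <= C%:E)%E.
Proof.
move=> p1 pp' fp gp a0.
have mf := Lp_fun_cmeasurable fp; have mg := Lp_fun_cmeasurable gp.
have p0 : 0 < p by exact: lt_le_trans p1.
have fpoo := Lp_fun_integral_powR p1 fp.
have mgb (b : 'rV[R]_d) : cmeasurable (fun x : 'rV[R]_d => g (a *: x + b)).
  by apply: (cmeasurable_comp mg); exact: measurable_affine.
have mfg (b : 'rV[R]_d) : measurable_fun [set: 'rV[R]_d] (fun x => (normc (f x) * normc (g (a *: x + b)))%:E).
  by apply/measurable_EFinP; apply: measurable_funM; exact: cmeasurable_normc.
case: p' pp' gp => [q| |]; last 2 first.
- rewrite invey adde0 inver gt_eqF// => -[] p1' [_ _ gpoo].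
  have {p1'} pE : p = 1 by rewrite -[p]invrK p1' invr1.
  have [M gM] : exists M : R, {ae mu, forall x, normc (g x) <= M}.
    move: gpoo; rewrite unlock; case: ifPn => [_ gpoo|mu0 _].
      have gs := ess_sup_ge mu (abse \o (EFin \o normc \o g)).
      case: (ess_sup _ _) gpoo gs => [M _ gs|//|_ gs].
        exists M; apply: filterS gs => x /=; rewrite lee_fin.
        by apply: le_trans; exact: ler_norm.
      by exists 0; apply: filterS gs => x.
    (* The default branch of the norm for the exponent [+oo]: the whole space is null, so any bound
       holds almost everywhere. *)
    exists 0; exists setT; split => //.
    by apply/eqP; rewrite eq_le measure_ge0 andbT leNgt.
  have M0 : 0 <= Num.max M 0 by rewrite le_max lexx orbT.
  exists (Num.max M 0 * fine (\int[mu]_x (normc (f x) `^ p)%:E)%E) => b.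
  have gbM : {ae mu, forall x, normc (g (a *: x + b)) <= M}.
    case: gM => A [mA A0 /= sA]; exists [set x | A (a *: x + b)]; split.
    - by rewrite -[X in measurable X]setTI; exact: (measurable_affine a b).
    - by rewrite lebesgue_rV_affine// A0 mule0.
    - by move=> x /= hx; exact: (sA (a *: x + b)).
  rewrite EFinM fineK; last first.
    by rewrite ge0_fin_numE// integral_ge0// => x _; rewrite lee_fin powR_ge0.
  rewrite -ge0_integralZl//; last 2 first.
  - by apply/measurable_EFinP; exact: measurable_normc_powR.
  - by move=> x _; rewrite lee_fin powR_ge0.
  apply: ae_ge0_le_integral => //.
  - by move=> x _; rewrite lee_fin mulr_ge0 ?normc_ge0.
  - by move=> x _; rewrite -EFinM lee_fin mulr_ge0 ?powR_ge0.
  - by apply/measurable_EFinP; apply: measurable_funM => //; exact: measurable_normc_powR.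
  - apply: filterS gbM => x gxM _; rewrite -EFinM lee_fin pE powRr1 ?normc_ge0//.
    by rewrite mulrC ler_wpM2r ?normc_ge0// le_max gxM.
(* The inverse of [-oo] is [-oo] and, below, the inverse of 0 is [+oo]; so neither is conjugate to
   [p]. *)
- by rewrite inver gt_eqF// inveNy addeNy.
- rewrite inver gt_eqF// inver; case: ifPn => [_|q0]; first by rewrite addey.
  rewrite -EFinD => -[] pq gq.
  have qV0 : 0 <= q^-1.
    by rewrite -(@lerD2l _ p^-1) pq addr0 invf_le1.
  have qpos : 0 < q by rewrite lt_def q0 -invr_ge0.
  have gqoo : (\int[mu]_x (normc (g x) `^ q)%:E < +oo)%E.
    case: gq => _ _ gq; have := poweR_Lnorm mu (EFin \o normc \o g) q0.
    under eq_integral do rewrite /= ger0_norm ?normc_ge0//.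
    by move=> <-; exact: poweR_lty.
  have mfp := measurable_normc_powR p mf.
  have mgq := measurable_normc_powR q mg.
  have gbq (b : 'rV[R]_d) : (\int[mu]_x (normc (g (a *: x + b)%R) `^ q)%:E =
      (`|a|^-1 ^+ d)%:E * \int[mu]_x (normc (g x) `^ q)%:E)%E.
    apply: (ge0_integral_affine b (F := fun x => (normc (g x) `^ q)%:E)) => //.
    - by apply/measurable_EFinP.
    - by move=> x; rewrite lee_fin powR_ge0.
  have pV0 : 0 <= p^-1 by rewrite invr_ge0 ltW.
  pose C := (p^-1%:E * \int[mu]_x (normc (f x) `^ p)%:E +
    q^-1%:E * ((`|a|^-1 ^+ d)%:E * \int[mu]_x (normc (g x) `^ q)%:E))%E.
  have Coo : (C < +oo)%E.
    apply: lte_add_pinfty; first by apply: lte_mul_pinfty; [rewrite lee_fin|by []|exact: fpoo].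
    by do 2 apply: lte_mul_pinfty => //; rewrite lee_fin exprn_ge0// invr_ge0.
  have C0 : (0 <= C)%E.
    rewrite /C adde_ge0// mule_ge0 ?lee_fin//.
      by apply: integral_ge0 => x _; rewrite lee_fin powR_ge0.
    rewrite mule_ge0 ?lee_fin ?exprn_ge0 ?invr_ge0//.
    by apply: integral_ge0 => x _; rewrite lee_fin powR_ge0.
  exists (fine C) => b; rewrite fineK ?ge0_fin_numE//.
  have mgbq := measurable_normc_powR q (mgb b).
  rewrite /C -(gbq b) -!ge0_integralZl//; last 4 first.
  - by apply/measurable_EFinP.
  - by move=> x _; rewrite lee_fin powR_ge0.
  - by apply/measurable_EFinP.
  - by move=> x _; rewrite lee_fin powR_ge0.
  rewrite -ge0_integralD//; last 4 first.
  - by move=> x _; rewrite -EFinM lee_fin mulr_ge0 ?powR_ge0.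
  - by apply/measurable_EFinP; apply: measurable_funM.
  - by move=> x _; rewrite -EFinM lee_fin mulr_ge0 ?powR_ge0.
  - by apply/measurable_EFinP; apply: measurable_funM.
  apply: ge0_le_integral => //.
  - by move=> x _; rewrite lee_fin mulr_ge0 ?normc_ge0.
  - by apply/measurable_EFinP; apply: measurable_funD; apply: measurable_funM.
  - move=> x _; rewrite -!EFinM -EFinD lee_fin ![_^-1 * _]mulrC.
    by rewrite conjugate_powR ?normc_ge0.
Qed.

End Lp_pairing.

Lemma is_derive_mull (R : realType) (s x : R) :
  is_derive x (1 : R) (fun t : R => s * t) s.
Proof.
have := @is_deriveZ R _ _ (@idfun R) s x 1 1 (is_derive_id x (1 : R)).
by rewrite [s *: (1 : R)]mulr1.
Qed.

Lemma near_eq_continuous_at (T S : topologicalType) (f g : T -> S) (x : T) :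
  {near x, f =1 g} -> {for x, continuous f} -> {for x, continuous g}.
Proof.
move=> fg cf; rewrite /prop_for /continuous_at -(nbhs_singleton fg).
by apply: cvg_trans cf; exact: near_eq_cvg.
Qed.

(** * Smooth functions *)

Section line_derivative.
Context {R : realType} {V : normedModType R}.
Implicit Types (g : V -> R) (x v : V).

(** Restricting to a line reduces directional derivatives to derivatives in one variable, for which
    the chain rule is at hand. *)
Lemma is_derive_line g x v c :
  is_derive x v g c <-> is_derive (0 : R) (1 : R) (fun t : R => g (t *: v + x)) c.
Proof.
have E : (fun h : R => h^-1 *: ((g \o shift x) (h *: v) - g x)) =
    (fun h : R => h^-1 *: (((fun t : R => g (t *: v + x)) \o shift 0) (h *: 1) -
      (fun t : R => g (t *: v + x)) 0)).
  by apply/funext => h /=; rewrite addr0 scale0r add0r [_%:A]mulr1.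
split => -[gd ge]; split; rewrite /derivable /derive.
- by rewrite -E.
- by rewrite -E.
- by rewrite E.
- by rewrite E.
Qed.

Lemma is_derive_comp1 g x v (phi : R -> R) dphi c :
  is_derive (g x) (1 : R) phi dphi -> is_derive x v g c ->
  is_derive x v (phi \o g) (dphi * c).
Proof.
move=> hphi /is_derive_line hg; apply/is_derive_line.
apply: (@is_derive1_comp _ phi (fun t : R => g (t *: v + x))).
by rewrite scale0r add0r.
Qed.

Lemma is_derive_affine g x v (s : R) b c :
  is_derive (s *: x + b) v g c -> is_derive x v (fun y => g (s *: y + b)) (s * c).
Proof.
move=> /is_derive_line hg; apply/is_derive_line.
have -> : (fun t : R => g (s *: (t *: v + x) + b)) =
    (fun t : R => g (t *: v + (s *: x + b))) \o (fun t : R => s * t).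
  by apply/funext => t /=; rewrite scalerDr !scalerA addrA.
have := @is_derive1_comp R (fun t : R => g (t *: v + (s *: x + b)))
  (fun t => s * t) 0 c s.
rewrite mulr0 mulrC; apply; exact: is_derive_mull.
Qed.

End line_derivative.

Section ck.
Context {R : realType} {d : nat}.
Local Notation V := 'rV[R]_d.
Local Notation e := (fun i : 'I_d => delta_mx ord0 i : V).
Implicit Types (U : set V) (f g q : V -> R).

(* C^n on U, by recursion on n: unlike [smooth_on] this is suited to proofs by
   induction of closure properties. *)
Fixpoint ck (n : nat) U g : Prop :=
  (forall x, U x -> {for x, continuous g}) /\
  if n is m.+1 then
    (forall i x, U x -> derivable g x (e i)) /\
    (forall i, ck m U (fun x => 'D_(e i) g x))
  else True.

Lemma ck_continuous n U g : ck n U g -> forall x, U x -> {for x, continuous g}.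
Proof. by case: n => [|n] []. Qed.

(** [foldr] differentiates first in the last index of the sequence. Removing one derivative from
    [ck] therefore corresponds to [rcons], and one direction is an induction from the end. *)
Lemma smooth_on_ckP U g : smooth_on U g <-> forall n, ck n U g.
Proof.
split.
- move=> + n; elim: n g => [|n IH] g sg.
    by split => // x Ux; have [] := sg [::] x Ux.
  split; first by move=> x Ux; have [] := sg [::] x Ux.
  split; first by move=> i x Ux; have [_] := sg [::] x Ux; apply.
  move=> i; apply: IH => s x Ux.
  by have := sg (rcons s i) x Ux; rewrite /iter_partial foldr_rcons.
- move=> h s; elim/last_ind: s g h => [|s i IH] g h x Ux.
    by have [/= cg [dg _]] := h 1%N; split => [|i]; [exact: cg|exact: dg].
  rewrite /iter_partial foldr_rcons; apply: IH => // n.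
  by have [_ [_]] := h n.+1; apply.
Qed.

Lemma eq_ck n U f g : open U -> (forall x, U x -> f x = g x) ->
  ck n U f -> ck n U g.
Proof.
move=> oU; have nU x : U x -> \forall y \near x, U y by move=> Ux; apply: open_nbhs_nbhs; split.
elim: n f g => [|n IH] f g fg; rewrite /=.
  move=> [cf _]; split => // x Ux.
  have nfg : {near x, f =1 g} by apply: filterS (nU _ Ux).
  exact: near_eq_continuous_at (cf x Ux).
move=> [cf [df Df]]; split; [|split].
- move=> x Ux.
  have nfg : {near x, f =1 g} by apply: filterS (nU _ Ux).
  exact: near_eq_continuous_at (cf x Ux).
- move=> i x Ux; apply: near_eq_derivable (df i x Ux).
  by apply: filterS (nU _ Ux).
- move=> i; apply: IH (Df i) => x Ux; apply: near_eq_derive.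
  by apply: filterS (nU _ Ux).
Qed.

(** The introduction rule behind all closure properties. The candidates [g'] agree with the partial
    derivatives on [U] only; as [U] is open, [eq_ck] makes the values elsewhere irrelevant. *)
Lemma ck_step n U g (g' : 'I_d -> V -> R) : open U ->
  (forall x, U x -> {for x, continuous g}) ->
  (forall i x, U x -> is_derive x (e i) g (g' i x)) ->
  (forall i, ck n U (g' i)) -> ck n.+1 U g.
Proof.
move=> oU cg dg cg'; split => //; split.
  by move=> i x Ux; case: (dg i x Ux).
by move=> i; apply: eq_ck (cg' i) => // x Ux; case: (dg i x Ux).
Qed.

Lemma ck_le n U g : ck n.+1 U g -> ck n U g.
Proof.
elim: n g => [|n IH] g [cg [dg Dg]]; first by split.
by split => //; split => // i; exact: IH.
Qed.

Lemma ck_is_derive n U g : ck n.+1 U g ->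
  forall i x, U x -> is_derive x (e i) g ('D_(e i) g x).
Proof. by move=> [_ [dg _]] i x Ux; apply: derivableP; exact: dg. Qed.

Lemma ckS n U g : ck n.+1 U g -> forall i, ck n U (fun x => 'D_(e i) g x).
Proof. by move=> [_ []]. Qed.

Lemma ck_cst n U (c : R) : open U -> ck n U (fun=> c).
Proof.
move=> oU; elim: n c => [|n IH] c; first by split => // x _; exact: cst_continuous.
by apply: (@ck_step _ _ _ (fun _ _ => 0)) => // x _; exact: cst_continuous.
Qed.

Lemma ckD n U f g : open U -> ck n U f -> ck n U g -> ck n U (fun x => f x + g x).
Proof.
move=> oU; elim: n f g => [|n IH] f g cf cg.
  split => // x Ux; apply: continuousD.
    exact: (ck_continuous cf).
  exact: (ck_continuous cg).
apply: (@ck_step _ _ _ (fun i x => 'D_(e i) f x + 'D_(e i) g x)) => //.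
- move=> x Ux; apply: continuousD; first exact: (ck_continuous cf).
  exact: (ck_continuous cg).
- by move=> i x Ux; apply: is_deriveD; exact: (@ck_is_derive n U).
- by move=> i; apply: IH; exact: ckS.
Qed.

Lemma ckM n U f g : open U -> ck n U f -> ck n U g -> ck n U (fun x => f x * g x).
Proof.
move=> oU; elim: n f g => [|n IH] f g cf cg.
  split => // x Ux; apply: continuousM.
    exact: (ck_continuous cf).
  exact: (ck_continuous cg).
apply: (@ck_step _ _ _ (fun i x => f x * 'D_(e i) g x + g x * 'D_(e i) f x)) => //.
- move=> x Ux; apply: continuousM; first exact: (ck_continuous cf).
  exact: (ck_continuous cg).
- by move=> i x Ux; apply: is_deriveM; exact: (@ck_is_derive n U).
- by move=> i; apply: ckD => //; apply: IH; by [exact: ck_le|exact: ckS].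
Qed.

Lemma ckV n U f : open U -> (forall x, U x -> f x != 0) -> ck n U f ->
  ck n U (fun x => (f x)^-1).
Proof.
move=> oU f0; elim: n f f0 => [|n IH] f f0 cf.
  by split => // x Ux; apply: continuousV; [exact: f0|exact: (ck_continuous cf)].
apply: (@ck_step _ _ _ (fun i x => (-1) * ((f x)^-1 * (f x)^-1 * 'D_(e i) f x))) => //.
- by move=> x Ux; apply: continuousV; [exact: f0|exact: (ck_continuous cf)].
- move=> i x Ux; have df := ck_is_derive cf i Ux.
  split; first by apply: derivableV; [exact: f0|case: df].
  rewrite deriveV; [|exact: f0|by case: df].
  by rewrite /GRing.scale/= mulN1r expr2 invfM mulNr.
- move=> i; apply: ckM => //; first exact: ck_cst.
  apply: ckM => //; last exact: ckS.
  by apply: ckM => //; apply: IH => //; exact: ck_le.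
Qed.

(* [phi] is a family of functions of one variable that is stable under
   differentiation. *)
Lemma ck_comp (I : Type) (phi : I -> R -> R) (D : I -> I) n U q : open U ->
  (forall k t, is_derive (t : R) (1 : R) (phi k) (phi (D k) t)) ->
  ck n U q -> forall k, ck n U (fun x => phi k (q x)).
Proof.
move=> oU dphi; have cphi k : continuous (phi k).
  move=> t; apply/differentiable_continuous/derivable1_diffP.
  by case: (dphi k t).
elim: n q => [|n IH] q cq k.
  by split => // x Ux; apply: continuous_comp; [exact: (ck_continuous cq)|exact: cphi].
apply: (@ck_step _ _ _ (fun i x => phi (D k) (q x) * 'D_(e i) q x)) => //.
- by move=> x Ux; apply: continuous_comp; [exact: (ck_continuous cq)|exact: cphi].
- by move=> i x Ux; exact: is_derive_comp1 (dphi k (q x)) (ck_is_derive cq i Ux).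
- by move=> i; apply: ckM => //; [apply: IH; exact: ck_le|exact: ckS].
Qed.

Lemma continuous_affine (s : R) (b : V) : continuous (fun x : V => s *: x + b).
Proof.
move=> x; apply: (@continuousD _ _ _ (fun x : V => s *: x)).
  exact: scaler_continuous.
exact: cst_continuous.
Qed.

Lemma ck_affine n U f (s : R) (b : V) : open U -> ck n U f ->
  ck n [set x | U (s *: x + b)] (fun x => f (s *: x + b)).
Proof.
move=> oU; have oV : open [set x | U (s *: x + b)].
  by apply: (open_comp (f := fun x : V => s *: x + b)) => // x _;
    exact: continuous_affine.
elim: n f => [|n IH] f cf.
  split => // x /= Ux; apply: (@continuous_comp _ _ _ (fun y : V => s *: y + b)).
    exact: continuous_affine.
  exact: (ck_continuous cf).
apply: (@ck_step _ _ _ (fun i x => s * 'D_(e i) f (s *: x + b))) => //.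
- move=> x /= Ux; apply: (@continuous_comp _ _ _ (fun y : V => s *: y + b)).
    exact: continuous_affine.
  exact: (ck_continuous cf).
- by move=> i x /= Ux; apply: is_derive_affine; exact: (ck_is_derive cf).
- by move=> i; apply: ckM => //; [exact: ck_cst|exact: (IH (fun x => 'D_(e i) f x) (ckS cf i))].
Qed.

Lemma ck_coord n U (j : 'I_d) : open U -> ck n U (fun x => x ord0 j).
Proof.
move=> oU; case: n => [|n]; first by split => // x _; exact: coord_continuous.
apply: (@ck_step _ _ _ (fun i _ => (i == j)%:R)) => //.
- by move=> x _; exact: coord_continuous.
- move=> i x _; apply/is_derive_line.
  have -> : (fun t : R => (t *: e i + x) ord0 j) = (fun t : R => (i == j)%:R * t + x ord0 j).
    by apply/funext => t; rewrite !mxE eqxx/= mulrC eq_sym.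
  have h := is_deriveD (is_derive_mull (i == j)%:R 0)
    (is_derive_cst (x ord0 j) (0 : R) (1 : R)).
  by apply: (is_derive_eq h); exact: addr0.
- by move=> i; exact: ck_cst.
Qed.

Lemma ck_sum n U (I : Type) (s : seq I) (F : I -> V -> R) : open U ->
  (forall i, ck n U (F i)) -> ck n U (fun x => \sum_(i <- s) F i x).
Proof.
move=> oU cF; elim: s => [|a s IH].
  by under eq_fun do rewrite big_nil; exact: ck_cst.
by under eq_fun do rewrite big_cons; exact: ckD.
Qed.

End ck.

(** * Smooth cutoff functions *)

Section flat.
Context {R : realType}.
Implicit Types (Q : {poly R}) (t : R).

(* Q(1/t) e^(-1/t) extended by 0: a family stable under differentiation. *)
Definition flat Q t : R := if 0 < t then Q.[t^-1] * expR (- t^-1) else 0.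

Lemma expn_expRN_bounded n : exists C : R, forall y : R, 0 < y ->
  y ^+ n * expR (- y) <= C.
Proof.
case: n => [|n].
  exists 1 => y y0; rewrite expr0 mul1r -expR0 ler_expR oppr_le0; exact: ltW.
exists n.+1`!%:R => y y0; rewrite expRN ler_pdivrMr ?expR_gt0//.
have F0 : 0 < (n.+1`!%:R : R) by rewrite ltr0n fact_gt0.
have := expR_ge1Dxn n (ltW y0).
move: (n.+1`!%:R : R) F0 => F F0 h.
by rewrite mulrC -ler_pdivrMr//; apply: le_trans h; rewrite lerDr.
Qed.

(** The factor [y ^+ n] carries the induction on [Q]: multiplying [Q] by the indeterminate raises
    [n] by one. *)
Lemma poly_expRN_bounded Q n : exists C : R, forall y : R, 0 < y ->
  y ^+ n * `|Q.[y]| * expR (- y) <= C.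
Proof.
elim/poly_ind: Q n => [|Q c IH] n.
  by exists 0 => y _; rewrite horner0 normr0 mulr0 mul0r.
have [C1 hC1] := IH n.+1.
have [C2 hC2] := expn_expRN_bounded n.
exists (C1 + `|c| * C2) => y y0.
have yn0 : 0 <= y ^+ n by rewrite exprn_ge0// ltW.
have ey0 := expR_ge0 (- y).
have := hC1 y y0; have := hC2 y y0; rewrite hornerMXaddC exprSr.
move: (expR (- y)) (y ^+ n) (Q.[y]) ey0 yn0 => E Y q E0 Y0 h2 h1.
apply: (@le_trans _ _ (Y * (`|q| * y + `|c|) * E)).
  rewrite ler_wpM2r// ler_wpM2l//.
  by apply: le_trans (ler_normD _ _) _; rewrite normrM (gtr0_norm y0).
have -> : Y * (`|q| * y + `|c|) * E = Y * y * `|q| * E + `|c| * (Y * E) by ring.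
by apply: lerD => //; rewrite ler_wpM2l.
Qed.

(** The exponent 2 makes the difference quotient at 0 tend to 0, which settles the only delicate
    point of [is_derive_flat]. *)
Lemma flat_le_sqr Q : exists2 C : R, 0 <= C & forall t, `|flat Q t| <= C * t ^+ 2.
Proof.
have [C hC] := poly_expRN_bounded Q 2.
exists `|C| => // t; rewrite /flat; case: ifPn => t0; last first.
  by rewrite normr0 mulr_ge0// sqr_ge0.
have tV0 : 0 < t^-1 by rewrite invr_gt0.
rewrite normrM (ger0_norm (expR_ge0 _)).
have := hC _ tV0; rewrite exprVn -mulrA ler_pdivrMl ?exprn_gt0// mulrC => h.
by apply: le_trans h _; rewrite mulrC ler_wpM2r ?sqr_ge0// ler_norm.
Qed.

(** With y = 1/t one has dy/dt = -y^2, so Q(y) e^(-y) has derivative y^2 (Q(y) - Q'(y)) e^(-y). *)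
Lemma is_derive_flat Q t :
  is_derive t (1 : R) (flat Q) (flat ('X^2 * (Q - Q^`())) t).
Proof.
have [t0|t0|->] := ltgtP t 0.
- rewrite [X in is_derive _ _ _ X](_ : _ = 0); last by rewrite /flat lt_gtF.
  apply: near_eq_is_derive (is_derive_cst 0 t 1).
  near=> s; rewrite /flat ifF//; apply/negbTE; rewrite -leNgt.
  by apply: ltW; near: s; exact: lt_nbhsl.
- have dV : is_derive t (1 : R) (fun s : R => s^-1) (- t ^- 2).
    split; first by apply: derivableV => //; rewrite gt_eqF.
    rewrite deriveV ?gt_eqF//.
    by rewrite derive_id [_ *: (1 : R)]mulr1.
  have dQ := is_derive1_comp (is_derive_poly Q t^-1) dV.
  have dN : is_derive t (1 : R) (fun s : R => - s^-1) (t ^- 2).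
    have h := is_deriveN dV; apply: (is_derive_eq h); exact: opprK.
  have dE := @is_derive1_comp R expR (fun s => - s^-1) t _ _ (is_derive_expR (- t^-1)) dN.
  apply: (near_eq_is_derive _ (is_derive_eq (is_deriveM dQ dE) _)).
    near=> s; rewrite /flat ifT//; near: s; exact: lt_nbhsr.
  rewrite /flat t0 !hornerE /GRing.scale/= exprVn.
  by move: (t ^- 2) => r; ring.
- have -> : flat ('X^2 * (Q - Q^`())) 0 = 0 by rewrite /flat ltxx.
  have [C C0 hC] := flat_le_sqr Q.
  have f0 : flat Q 0 = 0 by rewrite /flat ltxx.
  have cv : (fun h : R => h^-1 *: ((flat Q \o shift 0) (h *: (1 : R)) - flat Q 0)) @ 0^' --> (0 : R).
    apply/cvgrPdist_le => /= eps eps0.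
    have Cp : 0 < C + 1 by rewrite ltr_wpDl.
    near=> h; rewrite sub0r normrN f0 subr0 addr0 [h *: (1 : R)]mulr1.
    have h0 : h != 0 by near: h; exact: nbhs_dnbhs_neq.
    rewrite normrM normfV ler_pdivrMl ?normr_gt0//.
    apply: le_trans (hC h) _; rewrite -[h ^+ 2]real_normK ?num_real// expr2 mulrCA ler_wpM2l//.
    have hs : `|h| <= eps / (C + 1).
      near: h; apply: dnbhs0_le; exact: divr_gt0.
    apply: le_trans (_ : (C + 1) * (eps / (C + 1)) <= _); last by rewrite mulrC divfK// gt_eqF.
    by apply: ler_pM => //; rewrite lerDl.
  by split; [apply/cvg_ex; exists 0|exact: cvg_lim cv].
Unshelve. all: by end_near. Qed.

Lemma flat1_gt0 t : 0 < t -> 0 < flat 1 t.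
Proof. by move=> t0; rewrite /flat t0 hornerC mul1r expR_gt0. Qed.

Lemma flat1_ge0 t : 0 <= flat 1 t.
Proof. by have [/flat1_gt0/ltW//|t0] := ltP 0 t; rewrite /flat ltNge t0. Qed.

Lemma flat1_eq0 t : t <= 0 -> flat 1 t = 0.
Proof. by move=> t0; rewrite /flat ltNge t0. Qed.

End flat.

Section smooth_on.
Context {R : realType} {d : nat}.
Local Notation V := 'rV[R]_d.
Implicit Types (U : set V) (f g q : V -> R).

Lemma smooth_onD U f g : open U -> smooth_on U f -> smooth_on U g ->
  smooth_on U (fun x => f x + g x).
Proof.
by move=> oU /smooth_on_ckP sf /smooth_on_ckP sg; apply/smooth_on_ckP => n; exact: ckD.
Qed.

Lemma smooth_onM U f g : open U -> smooth_on U f -> smooth_on U g ->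
  smooth_on U (fun x => f x * g x).
Proof.
by move=> oU /smooth_on_ckP sf /smooth_on_ckP sg; apply/smooth_on_ckP => n; exact: ckM.
Qed.

Lemma smooth_onV U f : open U -> (forall x, U x -> f x != 0) -> smooth_on U f ->
  smooth_on U (fun x => (f x)^-1).
Proof.
by move=> oU f0 /smooth_on_ckP sf; apply/smooth_on_ckP => n; exact: ckV.
Qed.

Lemma smooth_on_cst U (c : R) : open U -> smooth_on U (fun=> c).
Proof. by move=> oU; apply/smooth_on_ckP => n; exact: ck_cst. Qed.

Lemma smooth_on_coord U i : open U -> smooth_on U (fun x => x ord0 i).
Proof. by move=> oU; apply/smooth_on_ckP => n; exact: ck_coord. Qed.

Lemma smooth_on_sum U (I : Type) (s : seq I) (F : I -> V -> R) : open U ->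
  (forall i, smooth_on U (F i)) -> smooth_on U (fun x => \sum_(i <- s) F i x).
Proof.
move=> oU sF; apply/smooth_on_ckP => n; apply: ck_sum => // i.
exact: (smooth_on_ckP _ _).1.
Qed.

Lemma smooth_on_affine U f (s : R) (b : V) : open U -> smooth_on U f ->
  smooth_on [set x | U (s *: x + b)] (fun x => f (s *: x + b)).
Proof.
by move=> oU /smooth_on_ckP sf; apply/smooth_on_ckP => n; exact: ck_affine.
Qed.

Lemma smooth_on_comp (I : Type) (phi : I -> R -> R) (D : I -> I) U q : open U ->
  (forall k t, is_derive (t : R) (1 : R) (phi k) (phi (D k) t)) ->
  smooth_on U q -> forall k, smooth_on U (fun x => phi k (q x)).
Proof.
move=> oU dphi /smooth_on_ckP sq k; apply/smooth_on_ckP => n.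
exact: ck_comp oU dphi (sq n) k.
Qed.

Lemma smooth_on_setU U U' f :
  smooth_on U f -> smooth_on U' f -> smooth_on (U `|` U') f.
Proof. by move=> s1 s2 s x [] ?; [exact: s1|exact: s2]. Qed.

Lemma smooth_on_subset U U' f : U' `<=` U -> smooth_on U f -> smooth_on U' f.
Proof. by move=> UU sf s x /UU; exact: sf. Qed.

Lemma eq_smooth_on U f g : open U -> (forall x, U x -> f x = g x) ->
  smooth_on U f -> smooth_on U g.
Proof.
move=> oU fg /smooth_on_ckP sf; apply/smooth_on_ckP => n.
exact: eq_ck (sf n).
Qed.

Lemma smooth_on_derive U f i :
  smooth_on U f -> smooth_on U (fun x => 'D_(delta_mx ord0 i) f x).
Proof.
move=> /smooth_on_ckP sf; apply/smooth_on_ckP => n; exact: (ckS (sf n.+1)).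
Qed.

Lemma smooth_on_continuous U f x : smooth_on U f -> U x -> {for x, continuous f}.
Proof. by move=> sf Ux; have [] := sf [::] x Ux. Qed.

Lemma smooth_on_is_derive U f i x : smooth_on U f -> U x ->
  is_derive x (delta_mx ord0 i) f ('D_(delta_mx ord0 i) f x).
Proof. by move=> sf Ux; apply: derivableP; have [_] := sf [::] x Ux; apply. Qed.

Lemma smooth_on_dot U (w : V) : open U -> smooth_on U (fun x => dot w x).
Proof.
move=> oU; apply: smooth_on_sum => // i.
by apply: smooth_onM => //; [exact: smooth_on_cst|exact: smooth_on_coord].
Qed.

(** The combinations of cosine and sine, indexed by their two coefficients, are a family stable
    under differentiation, as [smooth_on_comp] demands. *)
Lemma is_derive_cos_sin (k : R * R) (t : R) :
  is_derive t (1 : R) (fun t => k.1 * cos t + k.2 * sin t)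
    (k.2 * cos t + - k.1 * sin t).
Proof.
have h := is_deriveD (is_deriveZ k.1 (is_derive_cos t)) (is_deriveZ k.2 (is_derive_sin t)).
by apply: (is_derive_eq h); rewrite /GRing.scale/=; ring.
Qed.

Lemma smooth_on_cos U q : open U -> smooth_on U q -> smooth_on U (fun x => cos (q x)).
Proof.
move=> oU sq.
have := smooth_on_comp (D := fun k : R * R => (k.2, - k.1)) oU is_derive_cos_sin sq (1, 0).
by apply: eq_smooth_on => // x _; rewrite mul1r mul0r addr0.
Qed.

Lemma smooth_on_sin U q : open U -> smooth_on U q -> smooth_on U (fun x => sin (q x)).
Proof.
move=> oU sq.
have := smooth_on_comp (D := fun k : R * R => (k.2, - k.1)) oU is_derive_cos_sin sq (0, 1).
by apply: eq_smooth_on => // x _; rewrite mul1r mul0r add0r.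
Qed.

End smooth_on.

Section plateau.
Context {R : realType} {d : nat}.
Local Notation V := 'rV[R]_d.

(** Equal to 1 on the Euclidean unit ball and to 0 outside the Euclidean ball of radius 2. The
    function [dot x x] is used because it is smooth, whereas the norm of [V] is the sup norm. The
    denominator is positive because [dot x x] is below 4 or above 1. *)
Definition plateau (x : V) : R :=
  flat 1 (4 - dot x x) / (flat 1 (4 - dot x x) + flat 1 (dot x x - 1)).

Let plateau_den (x : V) : 0 < flat 1 (4 - dot x x) + flat 1 (dot x x - 1).
Proof.
have [h|h] := ltP (dot x x) 4.
  by apply: ltr_pwDl; [apply: flat1_gt0; rewrite subr_gt0|exact: flat1_ge0].
apply: ltr_wpDl; [exact: flat1_ge0|apply: flat1_gt0]; rewrite subr_gt0.
by apply: lt_le_trans h; rewrite ltr1n.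
Qed.

Lemma smooth_plateau : smooth_on [set: V] plateau.
Proof.
have sdot : smooth_on [set: V] (fun x => dot x x).
  apply: smooth_on_sum => [|i]; first exact: openT.
  by apply: smooth_onM; [exact: openT|exact: smooth_on_coord openT..].
have sflat q : smooth_on [set: V] q -> smooth_on [set: V] (fun x => flat 1 (q x)).
  move=> sq; apply: (smooth_on_comp (phi := flat) (D := fun Q => 'X^2 * (Q - Q^`()))) => //.
  - exact: openT.
  - exact: is_derive_flat.
have s1 : smooth_on [set: V] (fun x => flat 1 (4 - dot x x)).
  apply: sflat; apply: smooth_onD; [exact: openT|exact: smooth_on_cst openT|].
  have := smooth_onM openT (smooth_on_cst (-1) openT) sdot.
  by apply: eq_smooth_on; [exact: openT|move=> x _; rewrite mulN1r].
have s2 : smooth_on [set: V] (fun x => flat 1 (dot x x - 1)).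
  by apply: sflat; apply: smooth_onD; [exact: openT|exact: sdot|exact: smooth_on_cst openT].
apply: smooth_onM; [exact: openT|exact: s1|].
apply: smooth_onV; [exact: openT|by move=> x _; rewrite gt_eqF|].
by apply: smooth_onD => //; exact: openT.
Qed.

Lemma plateau_ge0 x : 0 <= plateau x.
Proof. by rewrite divr_ge0 ?flat1_ge0// ltW. Qed.

Lemma dot_self_ge (x : V) i : x ord0 i ^+ 2 <= dot x x.
Proof.
rewrite /dot (bigD1 i)//= expr2 lerDl sumr_ge0// => j _.
by rewrite -expr2 sqr_ge0.
Qed.

Lemma norm_sqr_le_dot (x : V) : `|x| ^+ 2 <= dot x x.
Proof.
have [->|x0] := eqVneq x 0.
  by rewrite normr0 expr0n sumr_ge0// => i _; rewrite mxE mulr0.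
have [i ->] : exists i, `|x| = `|x ord0 i|.
  have /mx_norm_neq0[[a i] /= E] : mx_norm x != 0 by rewrite -[mx_norm x]/(`|x|) normr_eq0.
  by exists i; rewrite -[LHS]/(mx_norm x) E (ord1 a).
by rewrite real_normK ?num_real// dot_self_ge.
Qed.

Lemma dot_le_norm (x y : V) : `|dot x y| <= d%:R * (`|x| * `|y|).
Proof.
apply: le_trans (ler_norm_sum _ _ _) _.
rewrite -[d in d%:R]card_ord mulr_natl -sumr_const; apply: ler_sum => i _.
by rewrite normrM; apply: ler_pM => //; exact: rV_coord_le_norm.
Qed.

Lemma plateau_eq0 (x : V) : 2 <= `|x| -> plateau x = 0.
Proof.
move=> x2; rewrite /plateau flat1_eq0 ?mul0r// subr_le0.
apply: le_trans (norm_sqr_le_dot x).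
by rewrite (_ : 4 = 2 ^+ 2 :> R) ?lerXn2r ?nnegrE//; ring.
Qed.

Lemma plateau_eq1 (x : V) : dot x x <= 1 -> plateau x = 1.
Proof.
move=> x1; rewrite /plateau (@flat1_eq0 _ (dot x x - 1)) ?subr_le0// addr0 divff//.
by rewrite gt_eqF// flat1_gt0// subr_gt0 (le_lt_trans x1)// ltr1n.
Qed.

End plateau.

(** * Fourier transforms of test functions *)

Section rtest.
Context {R : realType} {d : nat}.
Local Notation V := 'rV[R]_d.
Local Notation mu := (lebesgue_rV R d).
Local Notation e := (fun i : 'I_d => delta_mx ord0 i : V).
Implicit Types (f g : V -> R).

Definition rtest g := smooth_on [set: V] g /\
  exists M : R, forall x, M <= `|x| -> g x = 0.

Lemma rtest_continuous g : rtest g -> continuous g.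
Proof. by move=> [sg _] x; exact: (smooth_on_continuous sg). Qed.

Lemma rtest_measurable g : rtest g -> measurable_fun [set: V] g.
Proof. by move=> tg; apply: continuous_measurable_rV; exact: rtest_continuous. Qed.

Lemma compact_norm_ball (M : R) : compact [set x : V | `|x| <= M].
Proof.
apply: bounded_closed_compact.
  exists M; split; first exact: num_real.
  by move=> N MN x /= xM; exact: le_trans xM (ltW MN).
rewrite (_ : [set x : V | _] = (fun x : V => `|x|) @^-1` `]-oo, M]%classic).
  apply: closed_comp => // x _; exact: norm_continuous.
by apply/seteqP; split => x; rewrite /= in_itv.
Qed.

Lemma continuous_bounded_ball g (M : R) : continuous g ->
  exists2 B : R, 0 <= B & forall x, `|x| <= M -> `|g x| <= B.
Proof.
move=> cg; have [[x0 Mx0]|nM] := pselect ([set x : V | `|x| <= M] !=set0); last first.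
  by exists 0 => // x xM; exfalso; apply: nM; exists x.
have cn : {within [set x : V | `|x| <= M], continuous (fun x => `|g x|)}.
  apply: continuous_subspaceT => x.
  by apply: (continuous_comp (f := g)); [exact: cg|exact: norm_continuous].
have [c _ hc] := compact_EVT_max (ex_intro _ x0 Mx0) (@compact_norm_ball M) cn.
by exists `|g c| => // x xM; apply: hc; rewrite inE.
Qed.

Lemma weight_ge_ball (M : R) (x : V) : `|x| <= M ->
  (oneDsqr M)^-1 ^+ d <= weight x.
Proof.
move=> xM; rewrite -[X in _ ^+ X]card_ord -prodr_const; apply: ler_prod => i _.
rewrite invr_ge0 lef_pV2 ?posrE ?(lt_le_trans ltr01 (oneDsqr_ge1 _))//.
rewrite (le_trans ler01 (oneDsqr_ge1 _))/= lerD2l -(real_normK (num_real (x ord0 i))).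
by rewrite lerXn2r ?nnegrE// ?(le_trans (normr_ge0 x))// (le_trans (rV_coord_le_norm x i)).
Qed.

Lemma rtest_le_weight g : rtest g -> exists2 C : R, 0 <= C & forall x, `|g x| <= C * weight x.
Proof.
move=> tg; have [M gM] := tg.2.
have [B B0 gB] := continuous_bounded_ball M (rtest_continuous tg).
have w0 : 0 < (oneDsqr M)^-1 ^+ d.
  by rewrite exprn_gt0// invr_gt0 (lt_le_trans ltr01 (oneDsqr_ge1 _)).
exists (B / ((oneDsqr M)^-1 ^+ d)); first by rewrite divr_ge0// ltW.
move=> x; have [xM|Mx] := leP `|x| M; last first.
  rewrite (gM x (ltW Mx)) normr0; apply: mulr_ge0; last exact: weight_ge0.
  by rewrite divr_ge0// ltW.
apply: le_trans (gB x xM) _; rewrite -mulrA ler_peMr//.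
by rewrite ler_pdivlMl// mulr1 weight_ge_ball.
Qed.

Lemma rtest_bounded g : rtest g -> exists2 C : R, 0 <= C & forall x, `|g x| <= C.
Proof.
move=> /rtest_le_weight[C C0 hC]; exists C => // x; apply: le_trans (hC x) _.
by rewrite ler_piMr// weight_le1.
Qed.

Lemma le_weight_integrable g (C : R) : measurable_fun [set: V] g ->
  (forall x, `|g x| <= C * weight x) -> mu.-integrable setT (EFin \o g).
Proof.
move=> mg gC; apply: (le_integrable _ _ _ (integrableZl measurableT C (integrable_weight d))) => //.
  by apply/measurable_EFinP.
move=> x _ /=; rewrite lee_fin; apply: le_trans (gC x) _; exact: ler_norm.
Qed.

Lemma rtest_integrable g : rtest g -> mu.-integrable setT (EFin \o g).
Proof.
move=> tg; have [C _ hC] := rtest_le_weight tg.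
by apply: le_weight_integrable hC; exact: rtest_measurable.
Qed.

Lemma rtestM f g : smooth_on [set: V] f -> rtest g -> rtest (fun x => f x * g x).
Proof.
move=> sf [sg [M gM]]; split; first by apply: smooth_onM => //; exact: openT.
by exists M => x /gM ->; rewrite mulr0.
Qed.

Lemma rtestD f g : rtest f -> rtest g -> rtest (fun x => f x + g x).
Proof.
move=> [sf [M fM]] [sg [N gN]]; split; first by apply: smooth_onD => //; exact: openT.
by exists (Num.max M N) => x; rewrite ge_max => /andP[/fM -> /gN ->]; rewrite addr0.
Qed.

Lemma rtest_affine g (s : R) (b : V) : s != 0 -> rtest g -> rtest (fun x => g (s *: x + b)).
Proof.
move=> s0 [sg [M gM]]; split.
  by have := @smooth_on_affine R d _ _ s b openT sg.
exists ((M + `|b|) / `|s|) => x; rewrite ler_pdivrMr ?normr_gt0// => h; apply: gM.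
rewrite -lerBrDr in h *; apply: le_trans (_ : `|s *: x| - `|b| <= _).
  by rewrite normrZ mulrC.
by rewrite lerBlDr -{1}(addrK b (s *: x)) (le_trans (ler_normB _ _)).
Qed.

Lemma rtest_derive g i : rtest g -> rtest (fun x => 'D_(e i) g x).
Proof.
move=> [sg [M gM]]; split; first exact: smooth_on_derive.
exists (M + 1) => x xM; have Mx : M < `|x| by apply: lt_le_trans xM; rewrite ltrDl.
have : {near x, (fun=> 0 : R) =1 g}.
  have : \forall y \near x, M < `|y|.
    have /(_ x)/cvgr_gt := @norm_continuous _ V; exact.
  by apply: filterS => y /ltW/gM ->.
move=> /near_eq_derive <-; exact: derive_cst.
Qed.

Lemma rtest_lipschitz g i : rtest g -> exists2 C : R, 0 <= C &
  forall x (t : R), 0 < t -> `|g (t *: e i + x) - g x| <= C * t.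
Proof.
move=> tg; have [C C0 hC] := rtest_bounded (rtest_derive i tg).
exists C => // x t t0.
have dg (s : R) : is_derive s (1 : R) (fun s : R => g (s *: e i + x)) ('D_(e i) g (s *: e i + x)).
  have h := smooth_on_is_derive i tg.1 (I : [set: V] (s *: e i + x)).
  move/is_derive_line in h.
  have := @is_derive1_comp R (fun t : R => g (t *: e i + (s *: e i + x))) (fun t => t - s) s
    ('D_(e i) g (s *: e i + x)) 1.
  rewrite subrr mulr1 => /(_ h (is_derive_shift _ _ _)).
  set F := (F in is_derive _ _ F _) => hF.
  have -> : (fun s : R => g (s *: e i + x)) = F.
    by apply/funext => u; rewrite /F/= addrA -scalerDl subrK.
  exact: hF.
have [|c _ E] := @MVT R _ _ 0 t t0 (fun s _ => dg s).
  apply: continuous_subspaceT => s.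
  by apply/differentiable_continuous/derivable1_diffP; case: (dg s).
move: E; rewrite scale0r add0r subr0 => ->; rewrite normrM (gtr0_norm t0).
by rewrite ler_wpM2r// ltW.
Qed.

End rtest.

Section dominated_real.
Context {R : realType} {d1 : measure_display} {T : measurableType d1}.
Variable m : {measure set T -> \bar R}.

Lemma Rintegral_dominated_cvg (F : nat -> T -> R) (G H : T -> R) :
  (forall n, measurable_fun setT (F n)) ->
  (forall x, F ^~ x @ \oo --> G x) -> m.-integrable setT (EFin \o H) ->
  (forall n x, `|F n x| <= H x) ->
  m.-integrable setT (EFin \o G) /\
  (fun n => \int[m]_x F n x) @ \oo --> \int[m]_x G x.
Proof.
move=> mF FG iH FH.
have mG : measurable_fun setT G by apply: measurable_fun_cvg mF _ => x _; exact: FG.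
have iF n : m.-integrable setT (EFin \o F n).
  apply: (le_integrable _ _ _ iH) => //; first exact/measurable_EFinP.
  by move=> x _ /=; rewrite lee_fin; apply: le_trans (FH n x) _; exact: ler_norm.
have GH x : `|G x| <= H x.
  have -> : `|G x| = limn (fun n => `|F n x|).
    by apply/esym/cvg_lim => //; exact: cvg_norm (FG x).
  apply: limr_le; first by apply: cvgP; exact: cvg_norm (FG x).
  by near=> n; exact: FH.
have iG : m.-integrable setT (EFin \o G).
  apply: (le_integrable _ _ _ iH) => //; first exact/measurable_EFinP.
  by move=> x _ /=; rewrite lee_fin; apply: le_trans (GH x) _; exact: ler_norm.
split => //.
apply: fine_cvg; rewrite fineK; last exact: integrable_fin_num.
apply: (@dominated_cvg _ _ _ m _ _ (fun n x => (F n x)%:E) _ (EFin \o H)) => //.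
- by move=> n; exact/measurable_EFinP.
- by move=> x _; apply: cvg_EFin; [exact: nearW|exact: FG].
- by move=> n x _; rewrite /= lee_fin; exact: FH.
Unshelve. all: by end_near. Qed.

End dominated_real.

Section trig_integrals.
Context {R : realType} {d : nat}.
Local Notation V := 'rV[R]_d.
Local Notation mu := (lebesgue_rV R d).
Local Notation e := (fun i : 'I_d => delta_mx ord0 i : V).
Implicit Types (f g : V -> R).

Lemma norm_delta_mx_le1 (i : 'I_d) : `|e i| <= 1.
Proof.
rewrite [leLHS]mx_normrE; apply: bigmax_le => // -[a b] _ /=.
by rewrite mxE; case: (_ && _); rewrite ?normr1 ?normr0 ?ler01.
Qed.

(** Difference quotients of [g] have integral 0 by translation invariance and converge dominatedly
    to the derivative. This replaces integration along one variable by Fubini and the fundamental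
    theorem. *)
Lemma Rintegral_derive0 g i : rtest g -> \int[mu]_x 'D_(e i) g x = 0.
Proof.
move=> tg; have [C C0 gL] := rtest_lipschitz i tg.
have [M gM] := tg.2.
pose h n : R := n.+1%:R^-1.
have h0 n : 0 < h n by rewrite invr_gt0.
have h1 n : h n <= 1 by rewrite invf_le1// ler1n.
have cvh : h @ \oo --> (0 : R) by exact: cvg_harmonic.
pose F n (x : V) := (h n)^-1 * (g (1 *: x + h n *: e i) - g x).
have intg n : mu.-integrable setT (EFin \o (fun x : V => g (1 *: x + h n *: e i))).
  exact: (integrable_affine (h n *: e i) (oner_neq0 _) (rtest_integrable tg)).
have iF n : \int[mu]_x F n x = 0.
  rewrite /F RintegralZl//; last first.
    by apply: eq_integrable (integrableB measurableT (intg n) (rtest_integrable tg)).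
  rewrite RintegralB//; last exact: rtest_integrable.
  rewrite (Rintegral_affine _ (oner_neq0 _) (rtest_integrable tg)).
  by rewrite normr1 invr1 expr1n mul1r subrr mulr0.
(* All quotients are bounded by the Lipschitz constant [C] and, as the steps are at most 1, vanish
   outside the ball of radius [M + 1]. *)
have [B B0 FB] : exists2 B, 0 <= B & forall n x, `|F n x| <= B * weight x.
  have w0 : 0 < (oneDsqr (M + 1))^-1 ^+ d.
    by rewrite exprn_gt0// invr_gt0 (lt_le_trans ltr01 (oneDsqr_ge1 _)).
  exists (C / ((oneDsqr (M + 1))^-1 ^+ d)); first by rewrite divr_ge0// ltW.
  move=> n x; rewrite /F scale1r (addrC x).
  have [xM|Mx] := leP `|x| (M + 1); last first.
    rewrite gM; last first.
      have e1 : `|h n *: e i| <= 1.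
        rewrite normrZ (gtr0_norm (h0 n)).
        by apply: mulr_ile1; rewrite ?norm_delta_mx_le1// ltW.
      have := ler_normB (h n *: e i + x) (h n *: e i).
      rewrite addrAC subrr add0r => h2.
      by have := lt_le_trans Mx h2; move: e1; move: (`|_|) (`|_|) => *; lra.
    rewrite gM; last by apply: ltW; apply: lt_trans Mx; rewrite ltrDl.
    rewrite subrr mulr0 normr0 mulr_ge0 ?weight_ge0// divr_ge0// ltW.
  have hn0 : 0 < (h n)^-1 by rewrite invr_gt0.
  rewrite normrM (gtr0_norm hn0) ler_pdivrMl//.
  apply: le_trans (gL x _ (h0 n)) _.
  rewrite mulrC ler_wpM2l ?(ltW (h0 n))// -mulrA ler_peMr//.
  by rewrite ler_pdivlMl// mulr1 weight_ge_ball.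
have FD x : F ^~ x @ \oo --> 'D_(e i) g x.
  have [dg _] := smooth_on_is_derive i tg.1 (I : [set: V] x).
  have ch : h @ \oo --> 0^'.
    move=> A Ad; have /cvh : nbhs (0 : R) (fun x : R => x != 0 -> A x) := Ad.
    move=> hA; change (\forall n \near \oo, A (h n)).
    have {}hA : \forall n \near \oo, h n != 0 -> A (h n) := hA.
    by apply: filterS hA => n; apply; rewrite gt_eqF.
  have -> : F ^~ x = (fun n => (h n)^-1 *: ((g \o shift x) (h n *: e i) - g x)).
    by apply/funext => n; rewrite /F scale1r (addrC x).
  exact: (cvg_comp _ _ ch dg).
have mF n : measurable_fun setT (F n).
  apply: measurable_funM => //; apply: measurable_funB; last exact: rtest_measurable.
  by have /measurable_int/measurable_EFinP := intg n.
have [_ cv] := Rintegral_dominated_cvg mF FD (integrableZl measurableT B (integrable_weight d)) FB.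
have cv0 : (fun n => \int[mu]_x F n x) @ \oo --> (0 : R).
  by rewrite (_ : (fun n => _) = fun=> 0); [exact: cvg_cst|exact/funext].
exact: (cvg_unique _ cv cv0).
Qed.

Definition cos_int g (w : V) : R := \int[mu]_x (g x * cos (2 * pi * dot w x)).
Definition sin_int g (w : V) : R := \int[mu]_x (g x * sin (2 * pi * dot w x)).

Lemma smooth_phase (w : V) : smooth_on [set: V] (fun x => 2 * pi * dot w x).
Proof.
by apply: smooth_onM; [exact: openT|exact: smooth_on_cst openT|exact: smooth_on_dot openT].
Qed.

Lemma rtest_cos g w : rtest g -> rtest (fun x => g x * cos (2 * pi * dot w x)).
Proof.
move=> tg; have := rtestM (smooth_on_cos openT (smooth_phase w)) tg.
by congr rtest; apply/funext => x; rewrite mulrC.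
Qed.

Lemma rtest_sin g w : rtest g -> rtest (fun x => g x * sin (2 * pi * dot w x)).
Proof.
move=> tg; have := rtestM (smooth_on_sin openT (smooth_phase w)) tg.
by congr rtest; apply/funext => x; rewrite mulrC.
Qed.

Lemma is_derive_phase (w x : V) i :
  is_derive x (e i) (fun x => 2 * pi * dot w x) (2 * pi * w ord0 i).
Proof.
apply/is_derive_line.
have -> : (fun t : R => 2 * pi * dot w (t *: e i + x)) =
    (fun t : R => (2 * pi * w ord0 i) * t) + cst (2 * pi * dot w x).
  apply/funext => t; rewrite [RHS]/= -[RHS]/(_ * _ + _).
  rewrite -!mulrA -mulrDr -mulrDr; congr (_ * (_ * _)).
  rewrite /dot; under eq_bigr do rewrite !mxE mulrDr.
  rewrite big_split/=; congr (_ + _); rewrite (bigD1 i)//= big1 ?addr0.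
    by rewrite !eqxx/= mulr1.
  by move=> j ji; rewrite (negbTE ji) !mulr0.
have h := is_deriveD (is_derive_mull (2 * pi * w ord0 i) 0)
    (is_derive_cst (2 * pi * dot w x) (0 : R) (1 : R)).
by apply: (is_derive_eq h); exact: addr0.
Qed.

Lemma cos_int_derive g w i : rtest g ->
  cos_int (fun x => 'D_(e i) g x) w = 2 * pi * w ord0 i * sin_int g w.
Proof.
move=> tg; have := Rintegral_derive0 i (rtest_cos w tg).
have dE x : 'D_(e i) (fun x => g x * cos (2 * pi * dot w x)) x =
    'D_(e i) g x * cos (2 * pi * dot w x) -
    (2 * pi * w ord0 i) * (g x * sin (2 * pi * dot w x)).
  have dg := smooth_on_is_derive i tg.1 (I : [set: V] x).
  have dc := is_derive_comp1 (is_derive_cos _) (is_derive_phase w x i).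
  have := is_deriveM dg dc => -[_ ->].
  by rewrite /GRing.scale/=; ring.
under eq_Rintegral do rewrite dE.
rewrite RintegralB//; last 2 first.
- exact: rtest_integrable (rtest_cos w (rtest_derive i tg)).
- have := integrableZl measurableT (2 * pi * w ord0 i) (rtest_integrable (rtest_sin w tg)).
  by apply: eq_integrable.
rewrite RintegralZl//; last exact: rtest_integrable (rtest_sin w tg).
by move/eqP; rewrite subr_eq0 => /eqP.
Qed.

Lemma sin_int_derive g w i : rtest g ->
  sin_int (fun x => 'D_(e i) g x) w = - (2 * pi * w ord0 i * cos_int g w).
Proof.
move=> tg; have := Rintegral_derive0 i (rtest_sin w tg).
have dE x : 'D_(e i) (fun x => g x * sin (2 * pi * dot w x)) x =
    'D_(e i) g x * sin (2 * pi * dot w x) +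
    (2 * pi * w ord0 i) * (g x * cos (2 * pi * dot w x)).
  have dg := smooth_on_is_derive i tg.1 (I : [set: V] x).
  have dc := is_derive_comp1 (is_derive_sin _) (is_derive_phase w x i).
  have := is_deriveM dg dc => -[_ ->].
  by rewrite /GRing.scale/=; ring.
under eq_Rintegral do rewrite dE.
rewrite RintegralD//; last 2 first.
- exact: rtest_integrable (rtest_sin w (rtest_derive i tg)).
- have := integrableZl measurableT (2 * pi * w ord0 i) (rtest_integrable (rtest_cos w tg)).
  by apply: eq_integrable.
rewrite RintegralZl//; last exact: rtest_integrable (rtest_cos w tg).
by move/eqP; rewrite addr_eq0 => /eqP.
Qed.

(** The operator 1 - (2 pi)^(-2) d_i^2. On the Fourier side it multiplies by 1 + w_i^2, since each
    derivative yields a factor 2 pi w_i up to a unit. *)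
Definition bessel_op (i : 'I_d) g : V -> R :=
  fun x => g x + (- ((2 * pi) ^- 2)) * 'D_(e i) (fun y => 'D_(e i) g y) x.

Lemma rtest_bessel_op i g : rtest g -> rtest (bessel_op i g).
Proof.
move=> tg; apply: rtestD => //; apply: rtestM; first exact: smooth_on_cst openT.
by do 2 apply: rtest_derive.
Qed.

Lemma cos_int_lin g h (c : R) w : rtest g -> rtest h ->
  cos_int (fun x => g x + c * h x) w = cos_int g w + c * cos_int h w.
Proof.
move=> tg th; have ig := rtest_integrable (rtest_cos w tg).
have ih := rtest_integrable (rtest_cos w th).
rewrite /cos_int -RintegralZl// -RintegralD//; last first.
  by apply: eq_integrable (integrableZl measurableT c ih).
by apply: eq_Rintegral => x _; rewrite mulrDl mulrA.
Qed.

Lemma sin_int_lin g h (c : R) w : rtest g -> rtest h ->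
  sin_int (fun x => g x + c * h x) w = sin_int g w + c * sin_int h w.
Proof.
move=> tg th; have ig := rtest_integrable (rtest_sin w tg).
have ih := rtest_integrable (rtest_sin w th).
rewrite /sin_int -RintegralZl// -RintegralD//; last first.
  by apply: eq_integrable (integrableZl measurableT c ih).
by apply: eq_Rintegral => x _; rewrite mulrDl mulrA.
Qed.

Lemma cos_sin_int_bessel_op i g w : rtest g ->
  cos_int (bessel_op i g) w = oneDsqr (w ord0 i) * cos_int g w /\
  sin_int (bessel_op i g) w = oneDsqr (w ord0 i) * sin_int g w.
Proof.
move=> tg; have tDg := rtest_derive i tg; have tDDg := rtest_derive i tDg.
rewrite /bessel_op cos_int_lin// sin_int_lin//.
rewrite cos_int_derive// sin_int_derive// cos_int_derive// sin_int_derive//.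
have pi0 : 2 * pi != 0 :> R by rewrite mulf_neq0// gt_eqF// pi_gt0.
by move: (2 * pi) pi0 => P P0; rewrite /oneDsqr; split; field.
Qed.

(** [G] is [g] after one application of [bessel_op i] for every [i]; the product of the factors 1 +
    w_i^2 is the inverse of the weight. *)
Lemma cos_sin_int_weight g : rtest g -> exists2 G, rtest G & forall w,
  cos_int g w = weight w * cos_int G w /\ sin_int g w = weight w * sin_int G w.
Proof.
move=> tg; pose G (s : seq 'I_d) := foldr bessel_op g s.
have tG s : rtest (G s) by elim: s => [//|i s IH]; exact: rtest_bessel_op.
exists (G (enum 'I_d)) => // w.
have GE s : cos_int (G s) w = \prod_(i <- s) oneDsqr (w ord0 i) * cos_int g w /\
    sin_int (G s) w = \prod_(i <- s) oneDsqr (w ord0 i) * sin_int g w.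
  elim: s => [|i s [IH1 IH2]]; first by rewrite big_nil !mul1r.
  have [-> ->] := cos_sin_int_bessel_op i w (tG s).
  by rewrite IH1 IH2 big_cons !mulrA.
have [-> ->] := GE (enum 'I_d).
have -> : \prod_(i <- enum 'I_d) oneDsqr (w ord0 i) = (weight w)^-1.
  by rewrite big_enum/= /weight prodfV invrK.
by rewrite !mulrA mulfV ?mul1r// gt_eqF// weight_gt0.
Qed.

Lemma cos_sin_int_bounded g : rtest g -> exists2 B : R, 0 <= B & forall w,
  `|cos_int g w| <= B /\ `|sin_int g w| <= B.
Proof.
move=> tg; have ig := rtest_integrable tg.
exists (\int[mu]_x `|g x|); first exact: Rintegral_ge0.
move=> w; split.
  apply: le_trans (le_normr_Rintegral _ (rtest_integrable (rtest_cos w tg))) _ => //.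
  apply: le_Rintegral => //.
  - exact: integrable_abse (rtest_integrable (rtest_cos w tg)).
  - exact: integrable_abse ig.
  - by move=> x _; rewrite normrM ler_piMr// ler_norml cos_geN1 cos_le1.
apply: le_trans (le_normr_Rintegral _ (rtest_integrable (rtest_sin w tg))) _ => //.
apply: le_Rintegral => //.
- exact: integrable_abse (rtest_integrable (rtest_sin w tg)).
- exact: integrable_abse ig.
- by move=> x _; rewrite normrM ler_piMr// ler_norml sin_geN1 sin_le1.
Qed.

(** Two rounds of [cos_sin_int_weight]: one factor of the weight for integrability, the other to
    absorb a factor |w| through [norm_weight_le1]. *)
Lemma cos_sin_int_decay g : rtest g -> exists2 B : R, 0 <= B & forall w,
  `|cos_int g w| <= B * weight w ^+ 2 /\ `|sin_int g w| <= B * weight w ^+ 2.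
Proof.
move=> /cos_sin_int_weight[G tG gG]; have [H tH GH] := cos_sin_int_weight tG.
have [B B0 hB] := cos_sin_int_bounded tH.
exists B => // w; have [-> ->] := gG w; have [-> ->] := GH w; have [h1 h2] := hB w.
have w0 := weight_ge0 w.
rewrite (mulrC B) !mulrA -expr2 (normrM (weight w ^+ 2)) (normrM (weight w ^+ 2)).
by rewrite ger0_norm ?sqr_ge0//; split; apply: ler_wpM2l => //; exact: sqr_ge0.
Qed.

End trig_integrals.

(** * Uniqueness of the Fourier transform in L^1 *)

Section power_cutoff.
Context {R : realType}.
Implicit Types t u : R.

Lemma expr1D_ge u n : 0 <= u -> 1 + n%:R * u <= (1 + u) ^+ n.
Proof.
move=> u0; elim: n => [|n IH]; first by rewrite mul0r addr0 expr0.
rewrite exprS; apply: le_trans (_ : (1 + u) * (1 + n%:R * u) <= _); last first.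
  by rewrite ler_wpM2l// addr_ge0.
have := mulr_ge0 (ler0n R n) (mulr_ge0 u0 u0).
by rewrite -natr1; move: (n%:R : R) => m h; nra.
Qed.

Lemma expr1B_ge u n : 0 <= u <= 1 -> 1 - n%:R * u <= (1 - u) ^+ n.
Proof.
move=> /andP[u0 u1]; elim: n => [|n IH]; first by rewrite mul0r subr0 expr0.
rewrite exprS; apply: le_trans (_ : (1 - u) * (1 - n%:R * u) <= _); last first.
  by rewrite ler_wpM2l// subr_ge0.
have := mulr_ge0 (ler0n R n) (mulr_ge0 u0 u0).
by rewrite -natr1; move: (n%:R : R) => m h; nra.
Qed.

Lemma cvg_natM_expr u : 0 <= u < 1 -> (fun n => n%:R * u ^+ n) @ \oo --> (0 : R).
Proof.
move=> /andP[u0 u1]; have [->|un0] := eqVneq u 0.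
  rewrite (_ : (fun n => _) = fun=> 0); first exact: cvg_cst.
  by apply/funext => -[|n]; rewrite ?mul0r// expr0n mulr0.
(* n u^n = (n s^n) s^n, a bounded sequence times a null sequence. *)
pose s := Num.sqrt u.
have up : 0 < u by rewrite lt_def un0.
have s0 : 0 < s by rewrite sqrtr_gt0.
have s1 : s < 1 by rewrite -sqrtr1 ltr_sqrt.
have sV1 : 0 < s^-1 - 1 by rewrite subr_gt0 invf_gt1.
have hb n : n%:R * s ^+ n <= (s^-1 - 1)^-1.
  have := @expr1D_ge (s^-1 - 1) n (ltW sV1).
  rewrite subrKC exprVn => h.
  have h2 : n%:R * (s^-1 - 1) <= (s ^+ n)^-1 by apply: le_trans h; rewrite lerDr.
  by rewrite -[leRHS]mul1r ler_pdivlMr// mulrAC -ler_pdivlMr ?exprn_gt0// mul1r.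
have E n : n%:R * u ^+ n = (n%:R * s ^+ n) * s ^+ n.
  by rewrite -mulrA -exprD addnn -mul2n exprM sqr_sqrtr// ltW.
under eq_fun do rewrite E.
apply: (@squeeze_cvgr _ _ _ _ (fun=> 0) (fun n => (s^-1 - 1)^-1 * s ^+ n)).
- near=> n; rewrite mulr_ge0 ?mulr_ge0 ?exprn_ge0 ?(ltW s0)//=.
  by rewrite ler_wpM2r// exprn_ge0// ltW.
- exact: cvg_cst.
- rewrite -[X in _ --> X](mulr0 (s^-1 - 1)^-1); apply: cvgMl_tmp.
  by apply: cvg_expr; rewrite gtr0_norm.
Unshelve. all: by end_near. Qed.

(** For k = n 2^n one has k t^n = n (2t)^n. If t < 1/2, Bernoulli gives (1 - t^n)^k >= 1 - n (2t)^n,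
    which tends to 1. If t >= 1/2, then (1 - t^n)^k <= (1 + t^n)^(-k) <= 1/(n+1), by (1 - r)(1 + r)
    <= 1 and Bernoulli. The factor n in k decides the case t = 1/2. *)
Lemma cvg_power_cutoff t : 0 <= t <= 1 ->
  (fun n => (1 - t ^+ n) ^+ (n * 2 ^ n)%N) @ \oo --> ((t < 2^-1)%R%:R : R).
Proof.
move=> /andP[t0 t1].
have tn n : 0 <= t ^+ n <= 1 by rewrite exprn_ge0//= exprn_ile1.
have kE n : (n * 2 ^ n)%N%:R * t ^+ n = n%:R * (2 * t) ^+ n.
  by rewrite natrM natrX exprMn mulrA.
have [tlt|tge] := ltP t 2^-1.
- have h2 : 0 <= 2 * t < 1 by rewrite mulr_ge0//= mulrC -ltr_pdivlMr// mul1r.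
  apply: (@squeeze_cvgr _ _ _ _ (fun n => 1 - n%:R * (2 * t) ^+ n) (fun=> 1)).
  + near=> n; rewrite -kE expr1B_ge//= exprn_ile1//.
      by have /andP[_] := tn n; rewrite subr_ge0.
    by have /andP[] := tn n; rewrite gerBl.
  + rewrite -[X in _ --> X]subr0; apply: cvgB; first exact: cvg_cst.
    exact: cvg_natM_expr.
  + exact: cvg_cst.
- apply: (@squeeze_cvgr _ _ _ _ (fun=> 0) (fun n => n.+1%:R^-1)).
  + near=> n; have /andP[tn0 tn1] := tn n.
    rewrite exprn_ge0 ?subr_ge0//=.
    have den : 0 < (1 + t ^+ n) ^+ (n * 2 ^ n)%N by rewrite exprn_gt0// ltr_wpDr.
    have h1 : (1 - t ^+ n) ^+ (n * 2 ^ n)%N * (1 + t ^+ n) ^+ (n * 2 ^ n)%N <= 1.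
      rewrite -exprMn exprn_ile1// ?mulr_ge0 ?subr_ge0 ?addr_ge0//.
      by move: (t ^+ n) tn0 => r r0; nra.
    have h2 : n.+1%:R <= (1 + t ^+ n) ^+ (n * 2 ^ n)%N.
      apply: le_trans (expr1D_ge _ tn0); rewrite kE -natr1 addrC lerD2l.
      rewrite ler_peMr// -[leLHS](expr1n _ n) lerXn2r ?nnegrE ?mulr_ge0//.
      by rewrite mulrC -ler_pdivrMr// mul1r.
    rewrite -[leRHS]mul1r ler_pdivlMr//; apply: le_trans h1.
    by rewrite ler_wpM2l// exprn_ge0// subr_ge0.
  + exact: cvg_cst.
  + exact: cvg_harmonic.
Unshelve. all: by end_near. Qed.

End power_cutoff.

Lemma dotDl (R : realType) d (u v x : 'rV[R]_d) : dot (u + v) x = dot u x + dot v x.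
Proof. by rewrite /dot -big_split/=; apply: eq_bigr => i _; rewrite mxE mulrDl. Qed.

Lemma dotZl (R : realType) d (c : R) (u x : 'rV[R]_d) : dot (c *: u) x = c * dot u x.
Proof. by rewrite /dot mulr_sumr; apply: eq_bigr => i _; rewrite mxE mulrA. Qed.

Lemma dotNl (R : realType) d (u x : 'rV[R]_d) : dot (- u) x = - dot u x.
Proof. by rewrite -scaleN1r dotZl mulN1r. Qed.

Lemma dotC (R : realType) d (u x : 'rV[R]_d) : dot u x = dot x u.
Proof. by apply: eq_bigr => i _; rewrite mulrC. Qed.

Lemma dot_delta (R : realType) d (i : 'I_d) (x : 'rV[R]_d) :
  dot (delta_mx ord0 i) x = x ord0 i.
Proof.
rewrite /dot (bigD1 i)//= big1 ?addr0 => [|j ji].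
  by rewrite mxE !eqxx mul1r.
by rewrite mxE (negbTE ji) mul0r.
Qed.

Section phase.
Context {R : realType} {d : nat}.
Local Notation V := 'rV[R]_d.

Lemma measurable_dot (w : V) : measurable_fun [set: V] (dot w).
Proof.
apply: measurable_sum => i; apply: measurable_funM => //; exact: measurable_coord.
Qed.

Definition phase (w x : V) : R := 2 * pi * dot w x.

Lemma phaseDl (u v x : V) : phase (u + v) x = phase u x + phase v x.
Proof. by rewrite /phase dotDl mulrDr. Qed.

Lemma phaseNl (u x : V) : phase (- u) x = - phase u x.
Proof. by rewrite /phase dotNl mulrN. Qed.

Lemma phaseC (u x : V) : phase u x = phase x u.
Proof. by rewrite /phase dotC. Qed.

Lemma measurable_phase (w : V) : measurable_fun [set: V] (phase w).
Proof. by apply: measurable_funM => //; exact: measurable_dot. Qed.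

Lemma fourierE (f : V -> R[i]) w :
  fourier f w = cintegral (fun x => f x * cis (- phase w x)).
Proof. by apply: eq_cintegral => x; rewrite cisE. Qed.

End phase.

Lemma cintegral_dominated_cst (R : realType) d (f : nat -> 'rV[R]_d -> R[i])
    (g : 'rV[R]_d -> R[i]) (H : 'rV[R]_d -> R) (c : R[i]) :
  (forall n, cmeasurable (f n)) ->
  (forall x, (fun n => complex.Re (f n x)) @ \oo --> complex.Re (g x)) ->
  (forall x, (fun n => complex.Im (f n x)) @ \oo --> complex.Im (g x)) ->
  (lebesgue_rV R d).-integrable setT (EFin \o H) ->
  (forall n x, Normc.normc (f n x) <= H x) ->
  (forall n, cintegral (f n) = c) -> cintegral g = c.
Proof.
move=> mf cR cI iH fH fc.
have [_ hR] := Rintegral_dominated_cvg (fun n => (mf n).1) cR iH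
  (fun n x => le_trans (Re_le_normc _) (fH n x)).
have [_ hI] := Rintegral_dominated_cvg (fun n => (mf n).2) cI iH
  (fun n x => le_trans (Im_le_normc _) (fH n x)).
have eR : (fun n => \int[lebesgue_rV R d]_x complex.Re (f n x)) = fun=> complex.Re c.
  by apply/funext => n; rewrite -(fc n).
have eI : (fun n => \int[lebesgue_rV R d]_x complex.Im (f n x)) = fun=> complex.Im c.
  by apply/funext => n; rewrite -(fc n).
rewrite eR in hR; rewrite eI in hI.
apply: complex_eqP => /=.
  exact: (cvg_unique _ hR (cvg_cst _)).
exact: (cvg_unique _ hI (cvg_cst _)).
Qed.

Section fourier_uniqueness.
Context {R : realType} {d : nat}.
Local Notation V := 'rV[R]_d.
Local Notation mu := (lebesgue_rV R d).
Variable F : V -> R[i].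
Hypothesis iF : cintegrable mu F.

Definition bmeas (m : V -> R) := measurable_fun [set: V] m /\
  exists M : R, forall x, `|m x| <= M.

Definition annihilated (m : V -> R) := forall w : V,
  cintegral (fun x => F x * (m x)%:C * cis (- phase w x)) = 0.

(** Preserving every annihilated [g] is stronger than making [F m] have zero transform; this is what
    makes multipliers closed under products. *)
Definition multiplier (m : V -> R) := bmeas m /\
  forall g, bmeas g -> annihilated g -> annihilated (fun x => m x * g x).

Lemma bmeas_cst c : bmeas (fun=> c).
Proof. by split => //; exists `|c|. Qed.

Lemma bmeasM f g : bmeas f -> bmeas g -> bmeas (fun x => f x * g x).
Proof.
move=> [mf [M fM]] [mg [N gN]]; split; first exact: measurable_funM.
by exists (M * N) => x; rewrite normrM ler_pM.
Qed.

Lemma bmeasD f g : bmeas f -> bmeas g -> bmeas (fun x => f x + g x).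
Proof.
move=> [mf [M fM]] [mg [N gN]]; split; first exact: measurable_funD.
by exists (M + N) => x; rewrite (le_trans (ler_normD _ _))// lerD.
Qed.

Lemma annihilated_integrable g w : bmeas g ->
  cintegrable mu (fun x => F x * (g x)%:C * cis (- phase w x)).
Proof.
move=> [mg [M gM]]; have mc : cmeasurable (fun x : V => cis (- phase w x)).
  by apply: cmeasurable_cis; apply: measurableT_comp => //; exact: measurable_phase.
apply: (@cintegrableM _ _ _ _ _ _ 1) => //; last by move=> x; rewrite normc_cis.
apply: (@cintegrableM _ _ _ _ _ _ M); [exact: iF|exact: cmeasurable_RtoC|].
by move=> x; rewrite normc_RtoC.
Qed.

Lemma annihilatedD f g : bmeas f -> bmeas g -> annihilated f -> annihilated g ->
  annihilated (fun x => f x + g x).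
Proof.
move=> bf bg af ag w.
rewrite -[RHS]addr0 -{1}(af w) -(ag w) -cintegralD; try exact: annihilated_integrable.
by apply: eq_cintegral => x; rewrite rmorphD mulrDr mulrDl.
Qed.

Lemma annihilatedZ c g : bmeas g -> annihilated g -> annihilated (fun x => c * g x).
Proof.
move=> bg ag w; rewrite -[RHS](mulr0 c%:C) -(ag w) -cintegralZ; last exact: annihilated_integrable.
by apply: eq_cintegral => x; rewrite rmorphM; ring.
Qed.

Lemma annihilated_lim (f : nat -> V -> R) (g : V -> R) (M : R) : (forall n, bmeas (f n)) ->
  (forall n x, `|f n x| <= M) -> (forall x, f ^~ x @ \oo --> g x) ->
  (forall n, annihilated (f n)) -> annihilated g.
Proof.
move=> bf fM fg af w.
have dom : mu.-integrable setT (EFin \o (fun x => M * Normc.normc (F x))).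
  by apply: eq_integrable (integrableZl measurableT M (cintegrable_normc iF)).
have nle n x : Normc.normc (F x * (f n x)%:C * cis (- phase w x)) <= M * Normc.normc (F x).
  rewrite !Normc.normcM normc_cis mulr1 normc_RtoC mulrC.
  by rewrite ler_wpM2r ?normc_ge0.
have ii n := annihilated_integrable w (bf n).
have E (x : V) (u : R) : F x * u%:C * cis (- phase w x) = u%:C * (F x * cis (- phase w x)).
  by ring.
apply: (cintegral_dominated_cst (fun n => (ii n).1) _ _ dom nle (fun n => af n w)) => x.
  under eq_fun do rewrite E Re_mul/= mul0r subr0.
  by rewrite E Re_mul/= mul0r subr0; apply: cvgM => //; exact: cvg_cst.
under eq_fun do rewrite E Im_mul/= mul0r addr0.
by rewrite E Im_mul/= mul0r addr0; apply: cvgM => //; exact: cvg_cst.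
Qed.

Lemma multiplier_cst c : multiplier (fun=> c).
Proof. by split; [exact: bmeas_cst|move=> g bg ag; exact: annihilatedZ]. Qed.

Lemma multiplierD f g : multiplier f -> multiplier g -> multiplier (fun x => f x + g x).
Proof.
move=> [bf mf] [bg mg]; split; first exact: bmeasD.
move=> h bh ah.
have := annihilatedD (bmeasM bf bh) (bmeasM bg bh) (mf h bh ah) (mg h bh ah).
by congr annihilated; apply/funext => x; rewrite mulrDl.
Qed.

Lemma multiplierM f g : multiplier f -> multiplier g -> multiplier (fun x => f x * g x).
Proof.
move=> [bf mf] [bg mg]; split; first exact: bmeasM.
move=> h bh ah.
have := mf _ (bmeasM bg bh) (mg h bh ah).
by congr annihilated; apply/funext => x; rewrite mulrA.
Qed.

Lemma multiplierX f n : multiplier f -> multiplier (fun x => f x ^+ n).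
Proof.
move=> mf; elim: n => [|n IH]; first exact: multiplier_cst.
by under eq_fun do rewrite exprS; exact: multiplierM.
Qed.

Lemma multiplier_1B f : multiplier f -> multiplier (fun x => 1 - f x).
Proof.
move=> mf; have := multiplierD (multiplier_cst 1) (multiplierM (multiplier_cst (-1)) mf).
by congr multiplier; apply/funext => x; rewrite mulN1r.
Qed.

Lemma multiplier_lim (f : nat -> V -> R) (g : V -> R) (M : R) : (forall n, multiplier (f n)) ->
  (forall n x, `|f n x| <= M) -> (forall x, f ^~ x @ \oo --> g x) -> multiplier g.
Proof.
move=> mf fM fg; split.
  split; first by apply: measurable_fun_cvg (fun n => (mf n).1.1) _ => x _; exact: fg.
  exists M => x; have -> : `|g x| = limn (fun n => `|f n x|).
    by apply/esym/cvg_lim => //; exact: cvg_norm (fg x).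
  apply: limr_le; first by apply: cvgP; exact: cvg_norm (fg x).
  by near=> n; exact: fM.
move=> h bh ah; have [_ [N hN]] := bh.
apply: (@annihilated_lim (fun n x => f n x * h x) _ (M * N)).
- by move=> n; apply: bmeasM => //; exact: (mf n).1.
- by move=> n x; rewrite normrM ler_pM.
- by move=> x; apply: cvgM; [exact: fg|exact: cvg_cst].
- by move=> n; exact: (mf n).2.
Unshelve. all: by end_near. Qed.

(** A sine is a combination of two characters, and multiplying by a character translates the Fourier
    transform, here by [v] and by [- v]. *)
Lemma multiplier_sin (v : V) (b : R) : multiplier (fun x => sin (phase v x + b)).
Proof.
split.
  split; last by exists 1 => x; rewrite ler_norml sin_geN1 sin_le1.
  apply: (measurableT_comp (f := @sin R)).
    by apply: continuous_measurable_fun; exact: continuous_sin.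
  by apply: measurable_funD => //; exact: measurable_phase.
move=> g bg ag w.
have E (x : V) : F x * (sin (phase v x + b) * g x)%:C * cis (- phase w x) =
    ((0 -i* 2^-1) * cis b) * (F x * (g x)%:C * cis (- phase (w - v) x)) +
    ((0 +i* 2^-1) * cis (- b)) * (F x * (g x)%:C * cis (- phase (w + v) x)).
  rewrite !phaseDl phaseNl !opprD opprK !cisD rmorphM/=.
  have -> : (sin (phase v x + b))%:C = (0 -i* 2^-1) * (cis b * cis (phase v x)) +
      (0 +i* 2^-1) * (cis (- b) * cis (- phase v x)).
    rewrite -!cisD -opprD (addrC b); move: (phase v x + b) => t.
    by apply: complex_eqP; rewrite ?(Re_add, Im_add, Re_mul, Im_mul)/= ?cosN ?sinN; field.
  by ring.
under eq_cintegral do rewrite E.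
have iZ c u : cintegrable mu (fun x => c * (F x * (g x)%:C * cis (- phase u x))).
  have := cintegrableM (annihilated_integrable u bg) (cmeasurable_cst c) (fun=> lexx (Normc.normc c)).
  by congr (cintegrable _ _); apply/funext => x; rewrite mulrC.
rewrite cintegralD ?cintegralZ ?ag ?mulr0 ?addr0//; exact: annihilated_integrable.
Qed.

Lemma multiplier_sin_gt0 (v : V) (b : R) :
  multiplier (fun x => (0 < sin (phase v x + b))%R%:R).
Proof.
(* This maps the range of the sine to [0, 1], with t < 1/2 exactly where the sine is positive. *)
pose t x := 2^-1 * (1 - sin (phase v x + b)).
have mt : multiplier t.
  by apply: multiplierM; [exact: multiplier_cst|apply: multiplier_1B; exact: multiplier_sin].
have t01 x : 0 <= t x <= 1.
  have := sin_le1 (phase v x + b); have := sin_geN1 (phase v x + b).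
  by rewrite /t; move: (sin _) => s *; apply/andP; split; lra.
apply: (@multiplier_lim (fun n x => (1 - t x ^+ n) ^+ (n * 2 ^ n)%N) _ 1).
- by move=> n; apply: multiplierX; apply: multiplier_1B; exact: multiplierX.
- move=> n x; have /andP[t0 t1] := t01 x.
  have h0 : 0 <= 1 - t x ^+ n by rewrite subr_ge0 exprn_ile1.
  by rewrite ger0_norm ?exprn_ge0// exprn_ile1// gerBl exprn_ge0.
- move=> x; have := cvg_power_cutoff (t01 x).
  suff -> : (t x < 2^-1) = (0 < sin (phase v x + b)) by [].
  by rewrite /t; move: (sin _) => s; apply/idP/idP => ?; lra.
Qed.

Lemma multiplier_ray (j : 'I_d) (a : R) :
  multiplier (fun x => (a < x ord0 j)%R%:R).
Proof.
(* The frequency is chosen to make the argument of the sine (x_j - a)/(n+1). For large [n] it lies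
   between -pi and pi, where the sine has the sign of its argument. *)
pose h n : R := (2 * pi * n.+1%:R)^-1.
have pi2 : 0 < 2 * pi :> R by rewrite mulr_gt0// pi_gt0.
apply: (@multiplier_lim (fun n x =>
  (0 < sin (phase (h n *: delta_mx ord0 j) x + - (2 * pi * h n * a)))%R%:R) _ 1).
- by move=> n; exact: multiplier_sin_gt0.
- by move=> n x; case: (_ < _); rewrite ?normr1 ?normr0.
- move=> x; have E n : phase (h n *: delta_mx ord0 j) x + - (2 * pi * h n * a) =
      (x ord0 j - a) / n.+1%:R.
    rewrite /phase dotZl dot_delta /h invfM.
    by move: (2 * pi) pi2 (n.+1%:R^-1) => P /gt_eqF/negbT P0 r; field.
  under eq_fun do rewrite E.
  have [ax|xa|->] := ltgtP a (x ord0 j); last 1 first.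
  + under eq_fun do rewrite subrr mul0r sin0 ltxx; exact: cvg_cst.
  + have d0 : 0 < x ord0 j - a by rewrite subr_gt0.
    apply: cvg_near_cst; near=> n.
    rewrite sin_gt0_pi// divr_gt0//= ltr_pdivrMr// mulrC -ltr_pdivrMr ?pi_gt0//.
    by rewrite -natr1 ltr_wpDr//; near: n; exact: nbhs_infty_gtr.
  + have d0 : 0 < a - x ord0 j by rewrite subr_gt0.
    apply: cvg_near_cst; near=> n; rewrite -opprB mulNr sinN oppr_gt0 lt_gtF//.
    rewrite sin_gt0_pi// divr_gt0//= ltr_pdivrMr// mulrC -ltr_pdivrMr ?pi_gt0//.
    by rewrite -natr1 ltr_wpDr//; near: n; exact: nbhs_infty_gtr.
Unshelve. all: by end_near. Qed.

Definition multiplier_set : set (set V) := [set A | multiplier \1_A].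

Lemma multiplier_set0 : multiplier_set set0.
Proof. by rewrite /multiplier_set/= indic0; exact: multiplier_cst. Qed.

Lemma multiplier_setC A : multiplier_set A -> multiplier_set (~` A).
Proof.
move=> mA; have := multiplier_1B mA; congr multiplier.
by apply/funext => x; rewrite !indicE in_setC; case: (x \in A); rewrite ?subrr ?subr0.
Qed.

(** The indicator of a finite union is 1 - prod_k (1 - 1_(A_k)); the countable union is its
    pointwise limit, and no disjointness is involved. *)
Lemma multiplier_bigcup (A : (set V)^nat) :
  (forall n, multiplier_set (A n)) -> multiplier_set (\bigcup_n A n).
Proof.
move=> mA; apply: (@multiplier_lim
  (fun n x => 1 - \prod_(k < n) (1 - \1_(A k) x)) _ 1).
- move=> n; apply: multiplier_1B; elim: n => [|n IH].
    by under eq_fun do rewrite big_ord0; exact: multiplier_cst.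
  under eq_fun do rewrite big_ord_recr/=.
  by apply: multiplierM => //; apply: multiplier_1B; exact: mA.
- move=> n x.
  have : 0 <= \prod_(k < n) (1 - \1_(A k) x : R) <= 1.
    apply/andP; split; [apply: prodr_ge0|apply: prodr_ile1] => k _;
      by rewrite indicE; case: (_ \in _); rewrite ?subrr ?subr0 ?lexx ?ler01.
  by move: (\prod_(k < n) _) => p /andP[p0 p1]; rewrite ger0_norm ?subr_ge0// gerBl.
- move=> x; apply: cvg_near_cst; have [[k _ Akx]|nA] := pselect ((\bigcup_n A n) x).
    near=> n; have kn : (k < n)%N by near: n; exact: nbhs_infty_gt.
    rewrite (bigD1 (Ordinal kn))//= !indicE !mem_set//; last by exists k.
    by rewrite subrr mul0r subr0.
  near=> n; rewrite big1 => [|k _].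
    by rewrite indicE memNset// subrr.
  by rewrite indicE memNset ?subr0// => Akx; apply: nA; exists k.
Unshelve. all: by end_near. Qed.

Lemma measurable_multiplier_set (A : set V) : measurable A -> multiplier_set A.
Proof.
apply: smallest_sub.
  split; first exact: multiplier_set0.
    by move=> B mB; rewrite setTD; exact: multiplier_setC.
  exact: multiplier_bigcup.
move=> B; rewrite /= -bigcup_seq/= => -[j _ [C mC <-]]; rewrite setTI.
have {}mC : (@RGenOInfty.G R).-sigma.-measurable C by rewrite -RGenOInfty.measurableE.
(* The sets [C] whose preimage under the j-th coordinate is a multiplier set form a sigma-algebra,
   and it contains the rays that generate the Borel sets. *)
apply: (mC [set C | multiplier_set ((fun x : V => x ord0 j) @^-1` C)]); split.
  split.
  - by rewrite /= preimage_set0; exact: multiplier_set0.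
  - by move=> D mD; rewrite /= setTD preimage_setC; exact: multiplier_setC.
  - by move=> D mD; rewrite /= preimage_bigcup; exact: multiplier_bigcup.
move=> _ [a ->] /=; have := multiplier_ray j a; congr multiplier.
apply/funext => x; rewrite indicE; congr ((nat_of_bool _)%:R).
by apply/idP/idP; rewrite inE/= in_itv/= andbT.
Qed.

Lemma fourier_eq0_ae : (forall w, fourier F w = 0) -> {ae mu, forall x, F x = 0}.
Proof.
move=> F0; have a1 : annihilated (fun=> 1).
  by move=> w; rewrite -(F0 w) fourierE; apply: eq_cintegral => x; rewrite mulr1.
(* The frequency 0 suffices: [F] has integral 0 over every measurable set. *)
have ind (A : set V) : measurable A -> cintegral (fun x => F x * (\1_A x)%:C) = 0.
  move=> /measurable_multiplier_set[_ /(_ _ (bmeas_cst 1) a1 0)] <-.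
  apply: eq_cintegral => x.
  by rewrite mulr1 /phase /dot big1 ?mulr0 ?oppr0 ?cis0 ?mulr1// => i _; rewrite mxE mul0r.
have main (f : V -> R) : mu.-integrable setT (EFin \o f) ->
    (forall A, measurable A -> \int[mu]_x (f x * \1_A x) = 0) ->
    {ae mu, forall x, f x = 0}.
  move=> intf f0.
  have : ae_eq mu setT (EFin \o f) (cst 0%E).
    apply: integral_ae_eq => // E _ mE; rewrite integral0 integral_mkcond.
    have E1 : ((EFin \o f) \_ E)%E = (fun x => (f x * \1_E x)%:E).
      apply/funext => x; rewrite patchE indicE; case: ifP => _.
        by rewrite mulr1.
      by rewrite mulr0.
    have := (integrable_mkcond (EFin \o f) mE).1
      (integrableS measurableT mE (@subsetT _ E) intf).
    rewrite E1 => ifE.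
    by rewrite -(fineK (integrable_fin_num measurableT ifE)); congr EFin; exact: f0.
  by apply: filterS => x /(_ I) [].
have hR : {ae mu, forall x, complex.Re (F x) = 0}.
  apply: main (cintegrable_Re iF) _ => A mA; have /(congr1 (@complex.Re R)) := ind A mA.
  by move=> /= <-; apply: eq_Rintegral => x _; rewrite Re_mul/= mulr0 subr0.
have hI : {ae mu, forall x, complex.Im (F x) = 0}.
  apply: main (cintegrable_Im iF) _ => A mA; have /(congr1 (@complex.Im R)) := ind A mA.
  by move=> /= <-; apply: eq_Rintegral => x _; rewrite Im_mul/= mulr0 add0r.
by apply: filterS2 hR hI => x hr hi; apply: complex_eqP.
Qed.

End fourier_uniqueness.

(** * Complex test functions: rules for the Fourier transform, decay and continuity *)

Section lipschitz.
Context {R : realType}.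

Lemma lipschitz_derive1_le1 (f df : R -> R) :
  (forall x, is_derive x (1 : R) f (df x)) -> (forall x, `|df x| <= 1) ->
  forall a b, `|f a - f b| <= `|a - b|.
Proof.
move=> fdf df1 a b; wlog ba : a b / b <= a => [h|].
  have [/h//|/ltW/h] := leP b a.
  by rewrite distrC (distrC b).
have [|c _ ->] := @MVT_segment R f df b a ba (fun x _ => fdf x).
  apply: continuous_subspaceT => x.
  by apply/differentiable_continuous/derivable1_diffP; case: (fdf x).
by rewrite normrM ler_piMl.
Qed.

Lemma cis_lipschitz (a b : R) : Normc.normc (cis a - cis b) <= 2 * `|a - b|.
Proof.
apply: le_trans (normc_le _) _; rewrite mulr2n mulrDl mul1r; apply: lerD.
  rewrite /= (@lipschitz_derive1_le1 cos (fun x => - sin x))// => x.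
  by rewrite normrN ler_norml sin_geN1 sin_le1.
rewrite /= (@lipschitz_derive1_le1 sin cos)// => x.
by rewrite ler_norml cos_geN1 cos_le1.
Qed.

End lipschitz.

Section ctest.
Context {R : realType} {d : nat}.
Local Notation V := 'rV[R]_d.
Local Notation mu := (lebesgue_rV R d).
Implicit Types f g h : V -> R[i].

Definition ctest h := rtest (fun x => complex.Re (h x)) /\ rtest (fun x => complex.Im (h x)).

Lemma rtest_le_weight2 (g : V -> R) : rtest g ->
  exists2 C : R, 0 <= C & forall x, `|g x| <= C * weight x ^+ 2.
Proof.
move=> tg; have [M gM] := tg.2.
have [B B0 gB] := continuous_bounded_ball M (rtest_continuous tg).
pose w := (oneDsqr M)^-1 ^+ d.
have w0 : 0 < w by rewrite exprn_gt0// invr_gt0 (lt_le_trans ltr01 (oneDsqr_ge1 _)).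
exists (B / w ^+ 2); first by rewrite divr_ge0// sqr_ge0.
move=> x; have [xM|Mx] := leP `|x| M; last first.
  by rewrite (gM x (ltW Mx)) normr0 mulr_ge0// ?sqr_ge0// divr_ge0// sqr_ge0.
apply: le_trans (gB x xM) _; rewrite -mulrA ler_peMr//.
rewrite ler_pdivlMl ?exprn_gt0// mulr1 lerXn2r ?nnegrE ?weight_ge0 ?(ltW w0)//.
exact: weight_ge_ball.
Qed.

Lemma ctest_le_weight2 h : ctest h ->
  exists2 C : R, 0 <= C & forall x, Normc.normc (h x) <= C * weight x ^+ 2.
Proof.
move=> [/rtest_le_weight2[C C0 hC] /rtest_le_weight2[D D0 hD]].
exists (C + D); first exact: addr_ge0.
by move=> x; rewrite mulrDl (le_trans (normc_le _))// lerD.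
Qed.

Lemma ctest_cmeasurable h : ctest h -> cmeasurable h.
Proof. by move=> [h1 h2]; split; exact: rtest_measurable. Qed.

Lemma weight2_cintegrable h (C : R) : cmeasurable h ->
  (forall x, Normc.normc (h x) <= C * weight x ^+ 2) -> cintegrable mu h.
Proof.
move=> mh hC; apply: (le_cintegrable mh (g := fun x => `|C| * weight x)).
  move=> x; apply: le_trans (hC x) _.
  apply: le_trans (_ : `|C| * weight x ^+ 2 <= _).
    by rewrite ler_wpM2r ?sqr_ge0// ler_norm.
  by rewrite ler_wpM2l// expr2 ler_piMl ?weight_ge0// weight_le1.
by apply: eq_integrable (integrableZl measurableT `|C| (integrable_weight d)).
Qed.

Lemma ctest_cintegrable h : ctest h -> cintegrable mu h.
Proof.
move=> th; have [C _ hC] := ctest_le_weight2 th.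
by apply: weight2_cintegrable hC; exact: ctest_cmeasurable.
Qed.

Lemma ctestD g h : ctest g -> ctest h -> ctest (fun x => g x + h x).
Proof.
move=> [g1 g2] [h1 h2]; split; first by under eq_fun do rewrite Re_add; exact: rtestD.
by under eq_fun do rewrite Im_add; exact: rtestD.
Qed.

Lemma rtestN (g : V -> R) : rtest g -> rtest (fun x => - g x).
Proof.
move=> tg; have := rtestM (smooth_on_cst (-1) openT) tg.
by congr rtest; apply/funext => x; rewrite mulN1r.
Qed.

Lemma ctestM g h : csmooth_on [set: V] g -> ctest h -> ctest (fun x => g x * h x).
Proof.
move=> [g1 g2] [h1 h2]; split.
  under eq_fun do rewrite Re_mul.
  by apply: rtestD; [exact: rtestM|apply: rtestN; exact: rtestM].
under eq_fun do rewrite Im_mul.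
by apply: rtestD; exact: rtestM.
Qed.

Lemma ctest_conj h : ctest h -> ctest (fun x => Num.conj (h x)).
Proof.
move=> [h1 h2]; split; first by under eq_fun do rewrite Re_conj.
by under eq_fun do rewrite Im_conj; exact: rtestN.
Qed.

Lemma ctest_affine h (s : R) (b : V) : s != 0 -> ctest h -> ctest (fun x => h (s *: x + b)).
Proof. by move=> s0 [h1 h2]; split; [exact: (rtest_affine b s0 h1)|exact: (rtest_affine b s0 h2)]. Qed.

Lemma csmooth_on_cst U (c : R[i]) : open U -> csmooth_on U (fun _ : V => c).
Proof. by move=> oU; split; exact: smooth_on_cst. Qed.

Lemma csmooth_cis_phase (w : V) : csmooth_on [set: V] (fun x => cis (phase w x)).
Proof.
by split => /=; [apply: smooth_on_cos|apply: smooth_on_sin]; by [exact: openT|exact: smooth_phase].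
Qed.

Lemma ctest_RtoC (g : V -> R) : rtest g -> ctest (fun x => (g x)%:C).
Proof.
move=> tg; split => //=; split; first exact: smooth_on_cst openT.
by exists 0.
Qed.

Lemma ctestZ (c : R[i]) h : ctest h -> ctest (fun x => c * h x).
Proof. by move=> th; apply: ctestM => //; exact: csmooth_on_cst openT. Qed.

Lemma ctest_cis (w : V) h : ctest h -> ctest (fun x => cis (phase w x) * h x).
Proof. by move=> th; apply: ctestM => //; exact: csmooth_cis_phase. Qed.

Lemma cmeasurable_cis_phase (w : V) : cmeasurable (fun x : V => cis (phase w x)).
Proof. by apply: cmeasurable_cis; exact: measurable_phase. Qed.

Lemma cintegrable_cis f (w : V) : cintegrable mu f ->
  cintegrable mu (fun x => f x * cis (phase w x)).
Proof.
move=> fi; apply: (cintegrableM fi (cmeasurable_cis_phase w) (M := 1)).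
by move=> x; rewrite normc_cis.
Qed.

Lemma cintegrable_cisN f (w : V) : cintegrable mu f ->
  cintegrable mu (fun x => f x * cis (- phase w x)).
Proof.
by move=> fi; under eq_fun do rewrite -phaseNl; exact: cintegrable_cis.
Qed.

Lemma fourierD f g w : cintegrable mu f -> cintegrable mu g ->
  fourier (fun x => f x + g x) w = fourier f w + fourier g w.
Proof.
move=> fi gi; rewrite !fourierE -cintegralD; try exact: cintegrable_cisN.
by apply: eq_cintegral => x; rewrite mulrDl.
Qed.

Lemma fourierZ (c : R[i]) f w : cintegrable mu f ->
  fourier (fun x => c * f x) w = c * fourier f w.
Proof.
move=> fi; rewrite !fourierE -cintegralZ; last exact: cintegrable_cisN.
by apply: eq_cintegral => x; rewrite mulrA.
Qed.

Lemma fourier_cis f (u w : V) :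
  fourier (fun x => cis (phase u x) * f x) w = fourier f (w - u).
Proof.
rewrite !fourierE; apply: eq_cintegral => x.
by rewrite phaseDl phaseNl opprD opprK cisD; ring.
Qed.

Lemma fourier_scale f (s : R) (w : V) : s != 0 -> cintegrable mu f ->
  fourier (fun x => f (s *: x)) w = (`|s|^-1 ^+ d)%:C * fourier f (s^-1 *: w).
Proof.
move=> s0 fi; rewrite !fourierE.
rewrite -(cintegral_affine 0 s0); last first.
  exact: cintegrable_cisN.
apply: eq_cintegral => x; rewrite addr0; congr (_ * cis (- _)).
by rewrite /phase dotZl (dotC w (s *: x)) dotZl mulKf// dotC.
Qed.

Lemma fourier_trans f (b w : V) : cintegrable mu f ->
  fourier (fun x => f (x + b)) w = cis (phase w b) * fourier f w.
Proof.
move=> fi; rewrite !fourierE.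
have ig : cintegrable mu (fun x => f x * cis (- phase w x)).
  by under eq_fun do rewrite -phaseNl; exact: cintegrable_cis.
have := cintegral_affine b (oner_neq0 R) ig.
rewrite normr1 invr1 expr1n mul1r => <-.
rewrite -cintegralZ; last exact: (cintegrable_affine b (oner_neq0 R) ig).
apply: eq_cintegral => x; rewrite scale1r (phaseC w (x + b)) phaseDl !(phaseC _ w) opprD cisD.
have : cis (phase w b) * cis (- phase w b) = 1 by rewrite -cisD subrr cis0.
by move: (cis (phase w b)) => c /(congr1 (fun z => f (x + b) * cis (- phase w x) * z));
  rewrite mulr1 => <-; ring.
Qed.

Lemma fourier_decay h : ctest h -> exists2 B : R, 0 <= B &
  forall w, Normc.normc (fourier h w) <= B * weight w ^+ 2.
Proof.
move=> [h1 h2]; have [B B0 hB] := cos_sin_int_decay h1.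
have [D D0 hD] := cos_sin_int_decay h2.
exists ((B + D) * 2) => [|w]; first by rewrite mulr_ge0 ?addr_ge0.
have [b1 b2] := hB w; have [d1 d2] := hD w.
have ic (g : V -> R) : rtest g -> mu.-integrable setT (EFin \o (fun x : V => g x * cos (2 * pi * dot w x))).
  by move=> tg; exact: rtest_integrable (rtest_cos w tg).
have is_ (g : V -> R) : rtest g -> mu.-integrable setT (EFin \o (fun x : V => g x * sin (2 * pi * dot w x))).
  by move=> tg; exact: rtest_integrable (rtest_sin w tg).
have eR : complex.Re (fourier h w) = cos_int (fun x => complex.Re (h x)) w +
    sin_int (fun x => complex.Im (h x)) w.
  rewrite /= -RintegralD//; [|exact: ic|exact: is_].
  by apply: eq_Rintegral => x _; rewrite Re_mul/= mulrN opprK.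
have eI : complex.Im (fourier h w) = cos_int (fun x => complex.Im (h x)) w -
    sin_int (fun x => complex.Re (h x)) w.
  rewrite /= -RintegralB//; [|exact: ic|exact: is_].
  by apply: eq_Rintegral => x _; rewrite Im_mul/= mulrN addrC.
apply: le_trans (normc_le _) _; rewrite eR eI.
apply: le_trans (lerD (ler_normD _ _) (ler_normB _ _)) _.
have -> : (B + D) * 2 * weight w ^+ 2 = 2 * (B * weight w ^+ 2) + 2 * (D * weight w ^+ 2) by ring.
move: (B * _) (D * _) b1 b2 d1 d2 => x y *; lra.
Qed.

Lemma norm_weight_le1 (x : V) : `|x| * weight x <= 1.
Proof.
have [->|x0] := eqVneq x 0; first by rewrite normr0 mul0r.
have [i ->] : exists i, `|x| = `|x ord0 i|.
  have /mx_norm_neq0[[a i] /= E] : mx_norm x != 0 by rewrite -[mx_norm x]/(`|x|) normr_eq0.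
  by exists i; rewrite -[LHS]/(mx_norm x) E (ord1 a).
apply: le_trans (_ : `|x ord0 i| * (oneDsqr (x ord0 i))^-1 <= _).
  rewrite ler_wpM2l// /weight (bigD1 i)//= ler_piMr ?invr_ge0 ?(le_trans ler01 (oneDsqr_ge1 _))//.
  by apply: prodr_ile1 => j _; rewrite invr_ge0 (le_trans ler01 (oneDsqr_ge1 _))//= oneDsqrV_le1.
rewrite ler_pdivrMr ?(lt_le_trans ltr01 (oneDsqr_ge1 _))// mul1r /oneDsqr.
rewrite -(real_normK (num_real (x ord0 i))).
by move: (`|x ord0 i|) => t; have := sqr_ge0 (t - 1); rewrite !expr2 => h; nra.
Qed.

(** A character varies in [w] at a rate proportional to |x|, and |x| times the squared weight is at
    most the weight, which is integrable. Only decay of [h] is assumed, so the lemma also applies to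
    transforms of test functions. *)
Lemma fourier_lipschitz h (C : R) : cmeasurable h ->
  (forall x, Normc.normc (h x) <= C * weight x ^+ 2) ->
  exists2 L : R, 0 <= L & forall w w', Normc.normc (fourier h w - fourier h w') <= L * `|w - w'|.
Proof.
move=> mh hC; have ih := weight2_cintegrable mh hC.
(* The inner 2 comes from [cis_lipschitz], the factor 2 pi from the phase and [d] from
   [dot_le_norm]; the further 2 in the witness below comes from [normc_cintegral]. *)
pose K := `|C| * (2 * (2 * pi * d%:R)).
have K0 : 0 <= K by rewrite !mulr_ge0// pi_ge0.
exists (2 * (K * \int[mu]_x weight x)).
  rewrite mulr_ge0// mulr_ge0//; apply: Rintegral_ge0 => x _; exact: weight_ge0.
move=> w w'; rewrite !fourierE.
have ii u : cintegrable mu (fun x => h x * cis (- phase u x)).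
  by under eq_fun do rewrite -phaseNl; exact: cintegrable_cis.
have iZ : cintegrable mu (fun x => (-1) * (h x * cis (- phase w' x))).
  have := cintegrableM (ii w') (cmeasurable_cst (-1)) (fun=> lexx (Normc.normc (-1))).
  by congr (cintegrable _ _); apply/funext => x; rewrite mulrC.
rewrite -mulN1r -cintegralZ// -cintegralD//.
have iD := cintegrableD (ii w) iZ.
apply: le_trans (normc_cintegral iD) _.
have -> : 2 * (K * \int[mu]_x weight x) * `|w - w'| = 2 * (K * `|w - w'| * \int[mu]_x weight x).
  by move: (\int[mu]_x weight x); clear; move=> I; ring.
rewrite ler_wpM2l// -RintegralZl//; last exact: integrable_weight.
apply: le_Rintegral => //; first exact: cintegrable_normc.
  by apply: eq_integrable (integrableZl measurableT (K * `|w - w'|) (integrable_weight d)).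
move=> x _; rewrite mulN1r -mulrBr Normc.normcM.
apply: le_trans (_ : (`|C| * weight x ^+ 2) * (2 * (2 * pi * (d%:R * (`|w - w'| * `|x|)))) <= _).
  apply: ler_pM; rewrite ?normc_ge0//.
    by apply: le_trans (hC x) _; rewrite ler_wpM2r ?sqr_ge0// ler_norm.
  apply: le_trans (cis_lipschitz _ _) _; rewrite ler_wpM2l// opprK addrC.
  rewrite -phaseNl -phaseDl (distrC w) /phase normrM ger0_norm ?mulr_ge0 ?pi_ge0//.
  by rewrite ler_wpM2l ?mulr_ge0 ?pi_ge0// dot_le_norm.
have := ler_wpM2l (mulr_ge0 (mulr_ge0 K0 (normr_ge0 (w - w'))) (weight_ge0 x)) (norm_weight_le1 x).
rewrite mulr1; apply: le_trans; rewrite le_eqVlt; apply/orP; left; apply/eqP.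
by rewrite /K; ring.
Qed.

End ctest.

(** * Fourier inversion *)

Section kernel.
Context {R : realType} {d : nat}.
Local Notation V := 'rV[R]_d.
Local Notation mu := (lebesgue_rV R d).
Implicit Types f g h : V -> R[i].

(** Fubini for an [f] that need not be integrable, such as an L^p function. A bound on the integral
    of |f(x) K(x,y)| over x, uniform in y, makes g(y) f(x) K(x,y) integrable on the product. *)
Lemma cintegral_kernel_swap f g (K : V -> V -> R[i]) (C : R) :
  cmeasurable f -> cintegrable mu g ->
  cmeasurable (fun z : V * V => K z.1 z.2) ->
  (forall x, cintegrable mu (fun y => g y * K x y)) ->
  (forall y, \int[mu]_x (Normc.normc (f x) * Normc.normc (K x y))%:E <= C%:E)%E ->
  cintegral (fun x => f x * cintegral (fun y => g y * K x y)) =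
  cintegral (fun y => g y * cintegral (fun x => f x * K x y)).
Proof.
move=> mf ig mK iK KC.
have mKy y : cmeasurable (fun x => K x y).
  apply: (cmeasurable_comp mK (phi := fun x : V => (x, y))).
  exact: measurable_fun_pair.
have ifK y : cintegrable mu (fun x => f x * K x y).
  split; first by apply: cmeasurableM.
  under eq_integral do rewrite Normc.normcM.
  exact: le_lt_trans (KC y) (ltry _).
(* [y] comes first, so that the inner integral in [Hoo] is the one bounded by [C]. *)
pose H (y x : V) := f x * (g y * K x y).
have mH : cmeasurable (fun z : V * V => H z.1 z.2).
  apply: cmeasurableM; first exact: (cmeasurable_comp mf measurable_snd).
  apply: cmeasurableM; first exact: (cmeasurable_comp ig.1 measurable_fst).
  by apply: (cmeasurable_comp mK (phi := fun z : V * V => (z.2, z.1)));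
    exact: measurable_fun_pair.
have C0 : 0 <= C.
  by rewrite -lee_fin; apply: le_trans (KC 0); apply: integral_ge0 => x _;
    rewrite lee_fin mulr_ge0// normc_ge0.
have Hoo : (\int[mu]_y \int[mu]_x (Normc.normc (H y x))%:E < +oo)%E.
  apply: (@le_lt_trans _ _ (\int[mu]_y ((Normc.normc (g y))%:E * C%:E))%E); last first.
    rewrite ge0_integralZr//.
    - by rewrite lte_mul_pinfty ?ltry// ?ge0_fin_numE ?ig.2//;
        apply: integral_ge0 => y _; rewrite lee_fin normc_ge0.
    - by apply/measurable_EFinP; exact: cmeasurable_normc ig.1.
    - by move=> y _; rewrite lee_fin normc_ge0.
  apply: ge0_le_integral => //.
  - by move=> y _; apply: integral_ge0 => x _; rewrite lee_fin normc_ge0.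
  - apply: (@measurable_fun_fubini_tonelli_F _ _ _ _ _ mu (fun z : V * V => (Normc.normc (H z.1 z.2))%:E)).
      by apply/measurable_EFinP; exact: (cmeasurable_normc mH).
    by move=> z; rewrite lee_fin normc_ge0.
  - by apply: emeasurable_funM => //; apply/measurable_EFinP; exact: cmeasurable_normc ig.1.
  - move=> y _; apply: le_trans (_ : (\int[mu]_x ((Normc.normc (g y))%:E *
        (Normc.normc (f x) * Normc.normc (K x y))%:E) <= _))%E.
      apply: ge0_le_integral => //.
      + by move=> x _; rewrite lee_fin normc_ge0.
      + by apply/measurable_EFinP; apply: cmeasurable_normc; apply: cmeasurableM => //;
          apply: cmeasurableM => //; exact: cmeasurable_cst.
      + apply/measurable_EFinP; apply: measurable_funM => //.
        by apply: measurable_funM; exact: cmeasurable_normc.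
      + by move=> x _; rewrite -EFinM lee_fin /H !Normc.normcM mulrCA.
    rewrite ge0_integralZl//.
    + by rewrite lee_wpmul2l// lee_fin normc_ge0.
    + by apply/measurable_EFinP; apply: measurable_funM; exact: cmeasurable_normc.
    + by move=> x _; rewrite lee_fin mulr_ge0// normc_ge0.
    + by rewrite lee_fin normc_ge0.
rewrite (eq_cintegral (g := fun x => cintegral (fun y => H y x))); last first.
  by move=> x; rewrite -cintegralZ.
rewrite -(cintegral_Fubini mH Hoo); apply: eq_cintegral => y.
by rewrite -cintegralZ//; apply: eq_cintegral => x; rewrite /H mulrCA.
Qed.

Lemma measurable_phase2 : measurable_fun [set: V * V] (fun z => phase z.1 z.2).
Proof.
apply: measurable_funM => //; apply: measurable_sum => i.
apply: measurable_funM.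
  exact: (measurableT_comp (@measurable_coord R d i) measurable_fst).
exact: (measurableT_comp (@measurable_coord R d i) measurable_snd).
Qed.

Lemma fourier_swap f g : cintegrable mu f -> cintegrable mu g ->
  cintegral (fun x => f x * fourier g x) = cintegral (fun y => g y * fourier f y).
Proof.
move=> fi gi.
under eq_cintegral do rewrite fourierE.
under [RHS]eq_cintegral do rewrite fourierE.
rewrite (@cintegral_kernel_swap f g (fun x y => cis (- phase x y))
  (fine (\int[mu]_x (Normc.normc (f x))%:E)) fi.1 gi).
- by apply: eq_cintegral => y; congr (_ * _); apply: eq_cintegral => x; rewrite phaseC.
- apply: cmeasurable_cis; apply: measurableT_comp => //; exact: measurable_phase2.
- by move=> x; exact: cintegrable_cisN.
- move=> y; under eq_integral do rewrite normc_cis mulr1.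
  rewrite fineK// ge0_fin_numE; first exact: fi.2.
  by apply: integral_ge0 => x _; rewrite lee_fin normc_ge0.
Qed.

End kernel.

Section ae_continuous.
Context {R : realType} {d : nat}.
Local Notation V := 'rV[R]_d.
Local Notation mu := (lebesgue_rV R d).
Implicit Types f g h : V -> R[i].

Lemma ae_eq0_continuous (h : V -> R) : continuous h ->
  {ae mu, forall x, h x = 0} -> forall x, h x = 0.
Proof.
move=> ch [N [mN N0 hN]] x; apply/eqP/negPn/negP => hx0.
have : nbhs x [set y | h y != 0].
  by have /cvgr_neq0 := ch x; apply.
rewrite -nbhs_ballE => -[e /= e0 eh].
have sub : [set y : V | forall i, ball (x ord0 i) (e / 2) (y ord0 i)] `<=` N.
  move=> y yb; apply: hN => /= hy; have /eh /= : ball x e y.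
    rewrite -ball_normE/= rV_norm_lt// => i; rewrite !mxE.
    apply: lt_trans (yb i) _; rewrite ltr_pdivrMr// ltr_pMr// ltr1n//.
  by rewrite hy eqxx.
have mb (i : 'I_d) : measurable (ball (x ord0 i) (e / 2)).
  exact: measurable_ball.
have : (mu [set y : V | forall i, ball (x ord0 i) (e / 2)%R (y ord0 i)] <= 0)%E.
  by rewrite -N0 le_measure// inE//; exact: (measurable_box mb).
rewrite (lebesgue_rV_box mb).
have -> : (\prod_(i < d) lebesgue_measure (ball (x ord0 i) (e / 2)%R) =
    (\prod_(i < d) (e / 2 *+ 2))%:E)%E.
  by rewrite -prodEFin; apply: eq_bigr => i _; rewrite lebesgue_measure_ball// divr_ge0// ltW.
rewrite lee_fin leNgt => /negP; apply; apply: prodr_gt0 => i _.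
by rewrite mulrn_wgt0// divr_gt0.
Qed.

Definition ccontinuous h :=
  continuous (fun x => complex.Re (h x)) /\ continuous (fun x => complex.Im (h x)).

Lemma ccontinuousM g h : ccontinuous g -> ccontinuous h -> ccontinuous (fun x => g x * h x).
Proof.
move=> [g1 g2] [h1 h2]; split => x.
  under eq_fun do rewrite Re_mul.
  exact: (cvgB (cvgM (g1 x) (h1 x)) (cvgM (g2 x) (h2 x))).
under eq_fun do rewrite Im_mul.
exact: (cvgD (cvgM (g1 x) (h2 x)) (cvgM (g2 x) (h1 x))).
Qed.

Lemma ccontinuous_cmeasurable h : ccontinuous h -> cmeasurable h.
Proof. by move=> [h1 h2]; split; exact: continuous_measurable_rV. Qed.

Lemma ctest_ccontinuous h : ctest h -> ccontinuous h.
Proof. by move=> [h1 h2]; split; exact: rtest_continuous. Qed.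

Lemma lipschitz_ccontinuous h (L : R) :
  (forall x y, Normc.normc (h x - h y) <= L * `|x - y|) -> ccontinuous h.
Proof.
move=> hL.
have main (k : V -> R) : (forall x y, `|k x - k y| <= L * `|x - y|) -> continuous k.
  move=> kL x; apply/(@cvgrPdist_le _ _ _ (nbhs x) (nbhs_filter x)) => e e0; apply/nbhs_ballP.
  have L1 : 0 < `|L| + 1 by rewrite ltr_wpDl.
  exists ((`|L| + 1)^-1 * e) => [|y]; first by rewrite /= mulr_gt0// invr_gt0.
  rewrite -ball_normE/= ltr_pdivlMl// => /ltW; apply: le_trans.
  apply: le_trans (kL x y) _.
  by rewrite ler_wpM2r// (le_trans (ler_norm _))// lerDl.
split; apply: main => x y; apply: le_trans (hL x y).
  by have := Re_le_normc (h x - h y); rewrite Re_add; case: (h y).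
by have := Im_le_normc (h x - h y); rewrite Im_add; case: (h y).
Qed.

Lemma ae_eq_ccontinuous g h : ccontinuous g -> ccontinuous h ->
  {ae mu, forall x, g x = h x} -> forall x, g x = h x.
Proof.
move=> [g1 g2] [h1 h2] gh x; apply: complex_eqP; apply/eqP; rewrite -subr_eq0; apply/eqP.
  apply: (ae_eq0_continuous (h := fun x => complex.Re (g x) - complex.Re (h x))).
    by move=> y; exact: (cvgB (g1 y) (h1 y)).
  by apply: filterS gh => y ->; rewrite subrr.
apply: (ae_eq0_continuous (h := fun x => complex.Im (g x) - complex.Im (h x))).
  by move=> y; exact: (cvgB (g2 y) (h2 y)).
by apply: filterS gh => y ->; rewrite subrr.
Qed.

End ae_continuous.

Section fourier_inversion.
Context {R : realType} {d : nat}.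
Local Notation V := 'rV[R]_d.
Local Notation mu := (lebesgue_rV R d).
Implicit Types f g h v : V -> R[i].

Lemma fourier_ccontinuous h : ctest h -> ccontinuous (fourier h).
Proof.
move=> th; have [C _ hC] := ctest_le_weight2 th.
have [L _ hL] := fourier_lipschitz (ctest_cmeasurable th) hC.
exact: lipschitz_ccontinuous hL.
Qed.

Lemma fourier_cintegrable h : ctest h -> cintegrable mu (fourier h).
Proof.
move=> th; have [B _ hB] := fourier_decay th.
by apply: weight2_cintegrable hB; apply: ccontinuous_cmeasurable; exact: fourier_ccontinuous.
Qed.

(** The sign turns the second transform into an inverse transform; [fourier_inversion] identifies
    the result as a nonzero multiple of [g]. *)
Definition fourier2 g (w : V) : R[i] := fourier (fourier g) (- w).

Lemma normc_fourier h (w : V) : cintegrable mu h ->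
  Normc.normc (fourier h w) <= 2 * \int[mu]_x Normc.normc (h x).
Proof.
move=> ih; rewrite fourierE; apply: le_trans (normc_cintegral (cintegrable_cisN w ih)) _.
by rewrite ler_wpM2l//; under eq_Rintegral do rewrite Normc.normcM normc_cis mulr1.
Qed.

Lemma fourier2_ccontinuous g : ctest g -> ccontinuous (fourier2 g).
Proof.
move=> tg; have [B _ hB] := fourier_decay tg.
have [L _ hL] := fourier_lipschitz (fourier_cintegrable tg).1 hB.
apply: (lipschitz_ccontinuous (L := L)) => x y.
by apply: le_trans (hL _ _) _; rewrite -opprD normrN.
Qed.

Lemma fourier2M_cintegrable g v : ctest g -> ctest v ->
  cintegrable mu (fun x => fourier2 g x * v x).
Proof.
move=> tg tv.
have := cintegrableM (M := 2 * \int[mu]_x Normc.normc (fourier g x)) (ctest_cintegrable tv)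
  (ccontinuous_cmeasurable (fourier2_ccontinuous tg)).
rewrite (_ : (fun x => v x * _) = (fun x => fourier2 g x * v x)).
  by apply => x; apply: normc_fourier; exact: fourier_cintegrable.
by apply/funext => x; rewrite mulrC.
Qed.

Lemma cintegral_reflect (b : V) f : cintegrable mu f ->
  cintegral (fun x => f (b - x)) = cintegral f.
Proof.
move=> fi; have n0 : -1 != 0 :> R by rewrite oppr_eq0 oner_neq0.
have := cintegral_affine b n0 fi; rewrite normrN normr1 invr1 expr1n mul1r => <-.
by apply: eq_cintegral => x; rewrite scaleN1r addrC.
Qed.

Lemma ctest_reflect (b : V) v : ctest v -> ctest (fun x => v (b - x)).
Proof.
move=> tv; have n0 : -1 != 0 :> R by rewrite oppr_eq0 oner_neq0.
have := ctest_affine b n0 tv; congr ctest; apply/funext => x.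
by rewrite scaleN1r addrC.
Qed.

Lemma fourier_reflect f (b w : V) : cintegrable mu f ->
  fourier (fun x => f (b - x)) w = cis (- phase w b) * fourier f (- w).
Proof.
move=> fi; rewrite !fourierE.
have ig := cintegrable_cisN (- w) fi.
rewrite -(cintegral_reflect b ig) -cintegralZ; last first.
  have n0 : -1 != 0 :> R by rewrite oppr_eq0 oner_neq0.
  have := cintegrable_affine b n0 ig; congr (cintegrable _ _).
  by apply/funext => x; rewrite scaleN1r addrC.
apply: eq_cintegral => x.
rewrite phaseNl opprK mulrCA -cisD (phaseC w (b - x)) phaseDl phaseNl !(phaseC _ w).
by rewrite addKr.
Qed.

Lemma dot0r (w : V) : dot w 0 = 0.
Proof. by rewrite /dot big1// => i _; rewrite mxE mulr0. Qed.

Lemma phase0r (w : V) : phase w 0 = 0.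
Proof. by rewrite /phase dot0r mulr0. Qed.

Lemma phase0l (x : V) : phase 0 x = 0.
Proof. by rewrite phaseC phase0r. Qed.

(** A product becomes a convolution. As inversion is not yet known, [fourier2 g] stands in the
    product where [g] would be expected. *)
Lemma fourier_fourier2M g v (x : V) : ctest g -> ctest v ->
  fourier (fun w => fourier2 g w * v w) x = cintegral (fun y => fourier g y * fourier v (x - y)).
Proof.
move=> tg tv; rewrite fourierE.
(* Reflecting the variable replaces [fourier2 g] by [fourier (fourier g)]. All other factors are
   collected in [u], and [fourier_swap] moves one transform onto it. *)
pose u (w : V) := cis (phase x w) * v (0 - w).
have tu : ctest u by apply: ctest_cis; exact: ctest_reflect.
have iu := ctest_cintegrable tu.
have iF : cintegrable mu (fun w => u w * fourier (fourier g) w).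
  have [B _ hB] := fourier_decay tg; have ig := fourier_cintegrable tg.
  have [L _ hL] := fourier_lipschitz ig.1 hB.
  have mfg := ccontinuous_cmeasurable (lipschitz_ccontinuous hL).
  by apply: (cintegrableM iu mfg) => w; exact: normc_fourier.
rewrite (eq_cintegral (g := fun w => u (0 - w) * fourier (fourier g) (0 - w))); last first.
  by move=> w; rewrite /u /fourier2 subKr sub0r (phaseC x (- w)) phaseNl (phaseC w); ring.
rewrite (cintegral_reflect 0 iF) (fourier_swap iu (fourier_cintegrable tg)).
apply: eq_cintegral => y; congr (_ * _).
rewrite fourier_cis (fourier_reflect _ _ (ctest_cintegrable tv)) opprB.
by rewrite phase0r oppr0 cis0 mul1r.
Qed.

(** Both products have the convolution of [fourier g] and [fourier v] as Fourier transform. L^1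
    uniqueness gives equality almost everywhere, and continuity gives it everywhere. *)
Lemma fourier2_swap g v : ctest g -> ctest v ->
  forall w, fourier2 g w * v w = g w * fourier2 v w.
Proof.
move=> tg tv; apply: ae_eq_ccontinuous.
- by apply: ccontinuousM; [exact: fourier2_ccontinuous|exact: ctest_ccontinuous].
- by apply: ccontinuousM; [exact: ctest_ccontinuous|exact: fourier2_ccontinuous].
have i1 := fourier2M_cintegrable tg tv; have i2 := fourier2M_cintegrable tv tg.
have i2' : cintegrable mu (fun x => -1 * (fourier2 v x * g x)).
  have := cintegrableM i2 (cmeasurable_cst (-1)) (fun=> lexx (Normc.normc (-1))).
  by congr (cintegrable _ _); apply/funext => x; rewrite mulrC.
have /fourier_eq0_ae : forall w, fourier (fun x => fourier2 g x * v x + -1 * (fourier2 v x * g x)) w = 0.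
  move=> w; rewrite fourierD// fourierZ// !fourier_fourier2M// mulN1r.
  apply/eqP; rewrite subr_eq0; apply/eqP.
  have iv : cintegrable mu (fun y => fourier v (w - y)).
    have n0 : -1 != 0 :> R by rewrite oppr_eq0 oner_neq0.
    have := cintegrable_affine w n0 (fourier_cintegrable tv); congr (cintegrable _ _).
    by apply/funext => x; rewrite scaleN1r addrC.
  have ip : cintegrable mu (fun y => fourier g y * fourier v (w - y)).
    apply: (cintegrableM (fourier_cintegrable tg) iv.1) => y.
    by apply: normc_fourier; exact: ctest_cintegrable.
  rewrite -(cintegral_reflect w ip); apply: eq_cintegral => y.
  by rewrite subKr mulrC.
move=> /(_ (cintegrableD i1 i2')); apply: filterS => x /eqP.
by rewrite mulN1r subr_eq0 => /eqP ->; rewrite mulrC.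
Qed.

Lemma fourier2_reflect v (b w : V) : ctest v ->
  fourier2 (fun x => v (b - x)) w = fourier2 v (b - w).
Proof.
move=> tv; rewrite /fourier2.
have -> : fourier (fun x => v (b - x)) = fun y => cis (phase (- b) y) * fourier v (0 - y).
  apply/funext => y; rewrite fourier_reflect; last exact: ctest_cintegrable.
  by rewrite phaseNl phaseC sub0r.
rewrite fourier_cis (fourier_reflect _ _ (fourier_cintegrable tv)) opprB opprK opprD opprK.
by rewrite phase0r oppr0 cis0 mul1r addrC.
Qed.

Definition cplateau (x : V) : R[i] := (plateau x)%:C.

Lemma ctest_cplateau : ctest cplateau.
Proof.
by apply: ctest_RtoC; split; [exact: smooth_plateau|exists 2; exact: plateau_eq0].
Qed.

Lemma fourier_cplateau0_neq0 : fourier cplateau 0 != 0.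
Proof.
apply/negP => /eqP/(congr1 (@complex.Re R)); rewrite fourierE /= => I0.
have tp := ctest_cplateau; have ip := cintegrable_Re (ctest_cintegrable tp).
have E : \int[mu]_x plateau x = 0.
  rewrite -I0; apply: eq_Rintegral => x _.
  by rewrite mul0r subr0 phase0l oppr0 cos0 mulr1.
have E1 : (\int[mu]_x (plateau x)%:E = 0)%E.
  by rewrite -(fineK (integrable_fin_num measurableT ip)); congr EFin.
have /ae_eq0_continuous/(_ 0)/eqP : {ae mu, forall x : V, plateau x = 0}.
  have /(ae_eq_integral_abs mu measurableT (measurable_int _ ip)) :
      (\int[mu]_x `|(plateau x)%:E| = 0)%E.
    by rewrite -E1; apply: eq_integral => x _; rewrite /= ger0_norm// plateau_ge0.
  by apply: filterS => x /(_ I) [].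
rewrite plateau_eq1 ?oner_eq0; last by rewrite dot0r ler01.
by move=> h; have := h (rtest_continuous tp.1).
Qed.

(* [c] is 1 by Fourier inversion, but [c != 0] is enough for our purposes. *)
Lemma fourier_inversion : exists2 c : R[i], c != 0 &
  forall g, ctest g -> forall w, fourier2 g w = c * g w.
Proof.
have tp := ctest_cplateau; exists (fourier2 cplateau 0) => [|g tg w]; last first.
  (* The plateau is reflected about [w]: at [w] it takes the value 1, and its [fourier2] takes the
     value of [fourier2 cplateau] at 0, whatever [w] is. *)
  have := fourier2_swap tg (ctest_reflect w tp) w.
  rewrite (fourier2_reflect w w tp) subrr /cplateau plateau_eq1; last by rewrite dot0r ler01.
  by rewrite rmorph1 mulr1 mulrC.
apply/negP => /eqP c0.
(* If c = 0, the same identity kills [fourier2 cplateau]. By uniqueness [fourier cplateau] then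
   vanishes, but at 0 it is the integral of a nonzero nonnegative function. *)
have z w : fourier2 cplateau w = 0.
  have := fourier2_swap tp (ctest_reflect w tp) w.
  rewrite (fourier2_reflect w w tp) subrr /cplateau plateau_eq1; last by rewrite dot0r ler01.
  by rewrite rmorph1 mulr1 -/cplateau c0 mulr0.
have /(fourier_eq0_ae (fourier_cintegrable tp)) : forall w, fourier (fourier cplateau) w = 0.
  by move=> w; rewrite -(opprK w) -[LHS]/(fourier2 cplateau (- w)).
move=> p0; have := fourier_cplateau0_neq0; rewrite (@ae_eq_ccontinuous _ _ _ (fun=> 0) _ _ p0) ?eqxx//.
  exact: fourier_ccontinuous.
by split => x; exact: cst_continuous.
Qed.

End fourier_inversion.

(** * Vanishing wavelet coefficients *)

Section annular.
Context {R : realType} {d : nat}.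
Local Notation V := 'rV[R]_d.
Local Notation mu := (lebesgue_rV R d).
Implicit Types f g h k : V -> R[i].

(** Interpolation between L^1 and L^oo: |f|^p <= B^(p-1) |f|. *)
Lemma bounded_Lp_fun (p B : R) f : 1 <= p -> cintegrable mu f ->
  (forall x, Normc.normc (f x) <= B) -> Lp_fun p%:E f.
Proof.
move=> p1 [mf fi] fB; have [m1 m2] := mf; split => //.
have p0 : 0 < p by exact: lt_le_trans p1.
rewrite unlock; apply: poweR_lty.
have B0 : 0 <= B by exact: le_trans (normc_ge0 _) (fB 0).
apply: (@le_lt_trans _ _ (\int[mu]_x ((B `^ (p - 1))%:E * (Normc.normc (f x))%:E))%E); last first.
  rewrite ge0_integralZl//.
  - by rewrite lte_mul_pinfty// lee_fin powR_ge0.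
  - by apply/measurable_EFinP; exact: cmeasurable_normc.
  - by move=> x _; rewrite lee_fin normc_ge0.
  - by rewrite lee_fin powR_ge0.
under eq_integral do rewrite /= ger0_norm ?normc_ge0//.
apply: ge0_le_integral => //.
- by move=> x _; rewrite lee_fin powR_ge0.
- by apply/measurable_EFinP; exact: measurable_normc_powR.
- by apply/measurable_EFinP; apply: measurable_funM => //; exact: cmeasurable_normc.
- move=> x _; rewrite -EFinM lee_fin -(mulr_powRB1 (normc_ge0 _) p0) mulrC.
  rewrite ler_wpM2r ?normc_ge0//; apply: ge0_ler_powR; rewrite ?nnegrE ?subr_ge0//.
  exact: normc_ge0.
Qed.

Lemma fourier_Lp_fun (p : R) h : 1 <= p -> ctest h -> Lp_fun p%:E (fourier h).
Proof.
move=> p1 th; apply: (bounded_Lp_fun p1 (fourier_cintegrable th)) => w.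
by apply: normc_fourier; exact: ctest_cintegrable.
Qed.

Definition annular h := ctest h /\ exists2 r : R, 0 < r & forall x, `|x| < r -> h x = 0.

Lemma ctest_eq0_far h : ctest h -> exists M : R, forall x, M <= `|x| -> h x = 0.
Proof.
move=> [[_ [M hM]] [_ [N hN]]]; exists (Num.max M N) => x.
by rewrite ge_max => /andP[/hM h1 /hN h2]; apply: complex_eqP.
Qed.

Lemma open_neq0 : open (~` [set (0 : V)]).
Proof.
apply: closed_openC; apply: accessible_closed_set1.
by apply: hausdorff_accessible; exact: norm_hausdorff.
Qed.

Lemma closed_annulus (r M : R) : closed [set x : V | r <= `|x| /\ `|x| <= M].
Proof.
rewrite (_ : [set x : V | _] = (fun x : V => `|x|) @^-1` `[r, M]%classic).
  apply: closed_comp => [x _|]; [exact: norm_continuous|exact: interval_closed].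
apply/seteqP; split => x; rewrite /= in_itv/=; first by move=> [-> ->].
by move=> /andP.
Qed.

Lemma compact_annulus (r M : R) : compact [set x : V | r <= `|x| /\ `|x| <= M].
Proof.
apply: (subclosed_compact _ (@compact_norm_ball R d M)); first exact: closed_annulus.
by move=> x [].
Qed.

Lemma annular_test_function h : annular h -> test_function (~` [set 0]) h.
Proof.
move=> [th [r r0 hr]]; have [M hM] := ctest_eq0_far th.
have sub : supp h `<=` [set x | r <= `|x| /\ `|x| <= M].
  rewrite [X in _ `<=` X](closure_id _).1; last exact: closed_annulus.
  apply: closureS => x /= hx; split.
    by rewrite leNgt; apply: contra hx => /hr ->.
  by rewrite leNgt; apply: contra hx => /ltW/hM ->.
split.
- by have [[s1 _] [s2 _]] := th.
- by apply: (subclosed_compact _ (@compact_annulus r M)); first exact: closed_closure.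
- by move=> x /sub[rx _] x0; move: rx; rewrite x0 normr0 leNgt r0.
Qed.

Lemma smooth_on_annular (h : V -> R) (r : R) : 0 < r ->
  (forall x, `|x| < r -> h x = 0) -> smooth_on (~` [set 0]) h -> smooth_on [set: V] h.
Proof.
move=> r0 hr sh.
have oB : open [set x : V | `|x| < r].
  rewrite (_ : [set x : V | _] = (fun x : V => `|x|) @^-1` `]-oo, r[%classic).
    apply: open_comp => [x _|]; [exact: norm_continuous|exact: interval_open].
  by apply/seteqP; split => x; rewrite /= in_itv.
have s2 : smooth_on [set x : V | `|x| < r] h.
  by apply: (eq_smooth_on oB _ (smooth_on_cst 0 oB)) => x /hr ->.
apply: smooth_on_subset (smooth_on_setU sh s2) => x _.
by have [->|x0] := eqVneq x 0; [right; rewrite /= normr0|left; exact/eqP].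
Qed.

(** The singularity of [k] at 0 is harmless, since the product is identically 0 near the origin.
    This lets [nu] act on test functions. *)
Lemma annularM k h : csmooth_on (~` [set 0]) k -> annular h -> annular (fun x => k x * h x).
Proof.
move=> [k1 k2] [[[h1 [M1 hM1]] [h2 [M2 hM2]]] [r r0 hr]].
have z x : `|x| < r -> k x * h x = 0 by move=> /hr ->; rewrite mulr0.
have o := open_neq0.
have H1 : smooth_on (~` [set (0 : V)]) (fun x => complex.Re (h x)).
  by apply: smooth_on_subset h1.
have H2 : smooth_on (~` [set (0 : V)]) (fun x => complex.Im (h x)).
  by apply: smooth_on_subset h2.
have far x : Num.max M1 M2 <= `|x| -> k x * h x = 0.
  rewrite ge_max => /andP[/hM1 e1 /hM2 e2].
  by rewrite (_ : h x = 0) ?mulr0//; apply: complex_eqP.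
split; last by exists r.
split; (split; last by exists (Num.max M1 M2) => x /far ->).
  apply: (smooth_on_annular r0) => [x /z ->//|].
  under eq_fun do rewrite Re_mul -mulN1r.
  exact: (smooth_onD o (smooth_onM o k1 H1) (smooth_onM o (smooth_on_cst (-1) o) (smooth_onM o k2 H2))).
apply: (smooth_on_annular r0) => [x /z ->//|].
under eq_fun do rewrite Im_mul.
exact: (smooth_onD o (smooth_onM o k1 H2) (smooth_onM o k2 H1)).
Qed.

Lemma csmooth_conj U k : open U -> csmooth_on U k -> csmooth_on U (fun x => Num.conj (k x)).
Proof.
move=> oU [k1 k2]; split.
  rewrite (_ : (fun x => _) = (fun x => complex.Re (k x))); first exact: k1.
  by apply/funext => x; rewrite Re_conj.
rewrite (_ : (fun x => _) = (fun x => -1 * complex.Im (k x))).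
  exact: (smooth_onM oU (smooth_on_cst (-1) oU) k2).
by apply/funext => x; rewrite Im_conj mulN1r.
Qed.

Lemma csmooth_scale k (s : R) : s != 0 -> csmooth_on (~` [set 0]) k ->
  csmooth_on (~` [set (0 : V)]) (fun x => k (s *: x)).
Proof.
move=> s0 [k1 k2].
have sub : ~` [set (0 : V)] `<=` [set x | (~` [set (0 : V)]) (s *: x + 0)].
  by move=> x /eqP x0 /=; rewrite addr0 => /eqP; rewrite scaler_eq0 (negPf s0) (negPf x0).
have main (q : V -> R) : smooth_on (~` [set 0]) q ->
    smooth_on (~` [set (0 : V)]) (fun x => q (s *: x)).
  move=> sq; have := @smooth_on_affine R d _ _ s 0 open_neq0 sq.
  by move=> /(smooth_on_subset sub); congr smooth_on; apply/funext => x; rewrite addr0.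
by split; [exact: (main _ k1)|exact: (main _ k2)].
Qed.

Lemma annular_scale h (s : R) : s != 0 -> annular h -> annular (fun x => h (s *: x)).
Proof.
move=> s0 [th [r r0 hr]]; split.
  by have := ctest_affine 0 s0 th; congr ctest; apply/funext => x; rewrite addr0.
exists (r / `|s|) => [|x]; first by rewrite divr_gt0// normr_gt0.
by rewrite ltr_pdivlMr ?normr_gt0// mulrC -normrZ => /hr.
Qed.

Lemma annular_conj h : annular h -> annular (fun x => Num.conj (h x)).
Proof.
move=> [th [r r0 hr]]; split; first exact: ctest_conj.
by exists r => // x /hr ->; rewrite rmorph0.
Qed.

End annular.

Lemma conj_mul (R : realType) (x y : R[i]) : Num.conj (x * y) = Num.conj x * Num.conj y.
Proof. exact: rmorphM. Qed.

Section wavelet_orthogonality.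
Context {R : realType} {d : nat}.
Local Notation V := 'rV[R]_d.
Local Notation mu := (lebesgue_rV R d).
Variables (p : R) (p' : \bar R) (f psi nu : V -> R[i]).
Hypotheses (p1 : 1 <= p) (pp' : (p%:E^-1 + p'^-1 = 1)%E).
Hypotheses (fp : Lp_fun p%:E f) (psip : Lp_fun p' psi).
Hypothesis nu_smooth : csmooth_on (~` [set 0]) nu.
Hypothesis nu_psi : represents_on (~` [set 0])
  (fourier_distribution (distribution_of psi)) nu.
Hypothesis f_psi : forall (s : R) (t : V), 0 < s ->
  pairing f (dilate_translate psi s t) = 0.

Lemma conj_RtoC (r : R) : Num.conj r%:C = r%:C.
Proof. by apply: complex_eqP; rewrite ?Re_conj ?Im_conj//= oppr0. Qed.

Lemma fourier_conj h (w : V) : cintegrable mu h ->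
  Num.conj (fourier (fun x => Num.conj (h x)) w) = fourier h (- w).
Proof.
move=> ih; rewrite !fourierE -cintegral_conj; last by apply: cintegrable_cisN; exact: cintegrable_conj.
apply: eq_cintegral => x.
by rewrite conj_mul conjCK conj_cis phaseNl.
Qed.

Lemma Lp_fun_conj (q : \bar R) (g : V -> R[i]) : Lp_fun q g -> Lp_fun q (fun x => Num.conj (g x)).
Proof.
move=> [g1 g2 gq]; have [h1 h2] := cmeasurable_conj (conj g1 g2).
split => //; rewrite (_ : (_ \o _) \o _ = (EFin \o @Normc.normc R) \o g)//.
by apply/funext => x /=; rewrite normc_conj.
Qed.

Lemma measurable_scale_sub (a : R) :
  measurable_fun [set: V * V] (fun z => a *: (z.1 - z.2)).
Proof.
apply: measurable_fun_rV => i; under eq_fun do rewrite !mxE.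
apply: measurable_funM => //; apply: measurable_funB.
  exact: (measurableT_comp (@measurable_coord R d i) measurable_fst).
exact: (measurableT_comp (@measurable_coord R d i) measurable_snd).
Qed.

(** [fourier h] is itself in L^p, so the estimate of [Lp_pairing_affine] applies with it in place of
    [f]. *)
Lemma wavelet_kernel_integrable h (s : R) (x : V) : 0 < s -> ctest h ->
  cintegrable mu (fun t => fourier h t * Num.conj (psi (s^-1 *: (x - t)))).
Proof.
move=> s0 th; have mfh := (fourier_cintegrable th).1.
have ns0 : - s^-1 != 0 by rewrite oppr_eq0 invr_eq0 gt_eqF.
have [C hC] := Lp_pairing_affine p1 pp' (fourier_Lp_fun p1 th) (Lp_fun_conj psip) ns0.
have E t : s^-1 *: (x - t) = - s^-1 *: t + s^-1 *: x.
  by rewrite scalerBr scaleNr addrC.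
under eq_fun do rewrite E.
split.
  apply: cmeasurableM => //; apply: cmeasurable_conj.
  apply: (cmeasurable_comp (Lp_fun_cmeasurable psip)); exact: measurable_affine.
under eq_integral do rewrite Normc.normcM.
exact: le_lt_trans (hC _) (ltry _).
Qed.

(** The hypothesis on [nu] pairs without conjugation, so it is applied to a conjugated test function
    and the resulting identity is conjugated. Two changes of variables follow: u = s w on the side
    of [nu], t = x - s y on the side of [psi]. *)
Lemma fourier_wavelet h (s : R) (x : V) : 0 < s -> annular h ->
  fourier (fun w => h w * Num.conj (nu (s *: w))) x =
  (`|s|^-1 ^+ d)%:C *
    cintegral (fun t => fourier h t * Num.conj (psi (s^-1 *: (x - t)))).
Proof.
move=> s0 ah; have th := ah.1; have ih := ctest_cintegrable th.
have sn0 : s != 0 by rewrite gt_eqF.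
have sV0 : s^-1 != 0 by rewrite invr_eq0.
pose k (u : V) := cis (phase x u) * Num.conj (h u).
have ak : annular k.
  apply: annularM; last exact: annular_conj.
  have [c1 c2] := csmooth_cis_phase x.
  by split; [apply: smooth_on_subset c1|apply: smooth_on_subset c2].
(* Chosen so that, after conjugation and u = s w, the integral of [nu * eta] becomes the transform
   at [x] of h conj (nu (s .)), up to |s|^d. *)
pose eta (u : V) := k (s^-1 *: u).
have aeta : annular eta by exact: annular_scale.
have := nu_psi (annular_test_function aeta).
rewrite /fourier_distribution /distribution_of => /(congr1 Num.conj).
have inu : cintegrable mu (fun u => nu u * eta u).
  by apply: ctest_cintegrable; exact: (annularM nu_smooth aeta).1.
rewrite -[in RHS]cintegral_conj//.
rewrite (eq_cintegral (f := fun u => Num.conj (nu u * eta u))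
  (g := fun u => Num.conj (nu u) * h (s^-1 *: u) * cis (- phase x (s^-1 *: u)))); last first.
  by move=> u; rewrite /eta /k !conj_mul conjCK conj_cis; ring.
pose G (w : V) := h w * Num.conj (nu (s *: w)) * cis (- phase x w).
have iG : cintegrable mu G.
  apply: cintegrable_cisN; apply: ctest_cintegrable.
  have := (annularM (csmooth_conj open_neq0 (csmooth_scale sn0 nu_smooth)) ah).1.
  by congr ctest; apply/funext => w; rewrite mulrC.
rewrite (eq_cintegral (f := fun u => Num.conj (nu u) * h (s^-1 *: u) * cis (- phase x (s^-1 *: u)))
  (g := fun u => G (s^-1 *: u + 0))); last first.
  by move=> u; rewrite /G addr0 scalerA mulfV// scale1r; ring.
rewrite cintegral_affine// -[X in _ = _ * X -> _](fourierE (fun w => h w * Num.conj (nu (s *: w))) x).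
rewrite normfV invrK.
have sd0 : (`|s| ^+ d)%:C != 0.
  rewrite eq_complex/= eqxx andbT expf_eq0 normr_eq0 (negPf sn0) andbF//.
pose W (t : V) := fourier h t * Num.conj (psi (s^-1 *: (x - t))).
have iW : cintegrable mu W by exact: wavelet_kernel_integrable.
have ns0 : - s != 0 by rewrite oppr_eq0.
have feta y : Num.conj (fourier eta y) = (`|s| ^+ d)%:C * fourier h (- s *: y + x).
  rewrite /eta fourier_scale//; last exact: ctest_cintegrable ak.1.
  rewrite invrK normfV invrK conj_mul conj_RtoC /k fourier_cis fourier_conj//.
  by rewrite opprB scaleNr addrC.
have EW y : Num.conj (psi y * fourier eta y) = (`|s| ^+ d)%:C * W (- s *: y + x).
  rewrite conj_mul feta /W opprD scaleNr opprK addrCA subrr addr0.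
  by rewrite scalerA mulVf// scale1r; ring.
have iWa := cintegrable_affine x ns0 iW.
have ie : cintegrable mu (fun y => psi y * fourier eta y).
  have := cintegrableM iWa (cmeasurable_cst (`|s| ^+ d)%:C) (fun=> lexx (Normc.normc _)).
  move=> /cintegrable_conj; congr (cintegrable _ _); apply/funext => y.
  by rewrite mulrC -EW conjCK.
rewrite -cintegral_conj// (eq_cintegral EW) cintegralZ// cintegral_affine// normrN.
by move=> /(mulfI sd0) <-.
Qed.

(** By [fourier_wavelet], integrating in x first leaves a wavelet coefficient of [f] for each t. The
    exchange is legitimate because [fourier h] is integrable and [Lp_pairing_affine] bounds [f]
    against the translates of [psi] uniformly in t. *)
Lemma wavelet_orthogonality h (s : R) : 0 < s -> annular h ->
  cintegral (fun x => f x * fourier (fun w => h w * Num.conj (nu (s *: w))) x) = 0.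
Proof.
move=> s0 ah; have th := ah.1.
have sV0 : s^-1 != 0 by rewrite invr_eq0 gt_eqF.
have [C hC] := Lp_pairing_affine p1 pp' fp (Lp_fun_conj psip) sV0.
pose S := (s `^ (- (d%:R / 2)))%:C.
have S0 : S != 0 by rewrite eq_complex/= eqxx andbT gt_eqF// powR_gt0.
have fK t : cintegral (fun x => f x * Num.conj (psi (s^-1 *: (x - t)))) = 0.
  have ifK : cintegrable mu (fun x => f x * Num.conj (psi (s^-1 *: (x - t)))).
    have E x : s^-1 *: (x - t) = s^-1 *: x + - (s^-1 *: t) by rewrite scalerBr.
    under eq_fun do rewrite E.
    split.
      apply: cmeasurableM; first exact: Lp_fun_cmeasurable fp.
      apply: cmeasurable_conj; apply: (cmeasurable_comp (Lp_fun_cmeasurable psip)).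
      exact: measurable_affine.
    under eq_integral do rewrite Normc.normcM.
    exact: le_lt_trans (hC _) (ltry _).
  apply: (mulfI S0); rewrite mulr0 -cintegralZ// -[RHS](f_psi t s0).
  apply: eq_cintegral => x; rewrite /dilate_translate conj_mul conj_RtoC.
  by rewrite -/S mulrCA.
pose c : R[i] := (`|s|^-1 ^+ d)%:C.
have iW x := wavelet_kernel_integrable x s0 th.
rewrite (eq_cintegral (g := fun x =>
    f x * cintegral (fun t => (c * fourier h t) * Num.conj (psi (s^-1 *: (x - t)))))); last first.
  move=> x; rewrite fourier_wavelet// -cintegralZ//.
  by congr (_ * _); apply: eq_cintegral => t; rewrite mulrA.
have iZ g : cintegrable mu g -> cintegrable mu (fun t => c * g t).
  move=> ig; have := cintegrableM ig (cmeasurable_cst c) (fun=> lexx (Normc.normc c)).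
  by congr (cintegrable _ _); apply/funext => t; rewrite mulrC.
rewrite (@cintegral_kernel_swap _ _ f (fun t => c * fourier h t)
  (fun x t => Num.conj (psi (s^-1 *: (x - t)))) C).
- rewrite -[RHS](@cintegral0 R d); apply: eq_cintegral => t.
  by rewrite fK mulr0.
- exact: Lp_fun_cmeasurable fp.
- by apply: iZ; exact: fourier_cintegrable.
- apply: cmeasurable_conj; apply: (cmeasurable_comp (Lp_fun_cmeasurable psip)).
  exact: measurable_scale_sub.
- move=> x; under eq_fun do rewrite -mulrA.
  exact: iZ.
- move=> t; have := hC (- (s^-1 *: t)); under eq_integral do rewrite -scalerBr.
  by [].
Qed.

End wavelet_orthogonality.

Section fourier_pairing.
Context {R : realType} {d : nat}.
Local Notation V := 'rV[R]_d.
Local Notation mu := (lebesgue_rV R d).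
Variables (p : R) (f : V -> R[i]).
Hypotheses (p1 : 1 <= p) (fp : Lp_fun p%:E f).
Implicit Types g h : V -> R[i].

(* The tempered distribution "Fourier transform of f". *)
Definition fourier_pairing g : R[i] := cintegral (fun x => f x * fourier g x).

Lemma Lp_fourier_cintegrable g : ctest g -> cintegrable mu (fun x => f x * fourier g x).
Proof.
move=> tg; apply: (Lp_pairing_lty p1 fp (fourier_cintegrable tg)) => x.
by apply: normc_fourier; exact: ctest_cintegrable.
Qed.

Lemma fourier_pairingD g h : ctest g -> ctest h ->
  fourier_pairing (fun x => g x + h x) = fourier_pairing g + fourier_pairing h.
Proof.
move=> tg th; rewrite /fourier_pairing -cintegralD; try exact: Lp_fourier_cintegrable.
by apply: eq_cintegral => x; rewrite fourierD ?mulrDr//; exact: ctest_cintegrable.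
Qed.

Lemma fourier_pairing_sum_eq0 (I : Type) (s : seq I) (F : I -> V -> R[i]) :
  (forall i, ctest (F i)) -> (forall i, fourier_pairing (F i) = 0) ->
  ctest (fun x => \sum_(i <- s) F i x) /\ fourier_pairing (fun x => \sum_(i <- s) F i x) = 0.
Proof.
move=> tF F0; elim: s => [|i s [IH1 IH2]].
  under eq_fun do rewrite big_nil; split.
    by apply: (ctest_RtoC (g := fun=> 0)); split; [exact: smooth_on_cst openT|exists 0].
  rewrite /fourier_pairing -[RHS](@cintegral0 R d); apply: eq_cintegral => x.
  rewrite fourierE (eq_cintegral (g := fun=> 0)) ?cintegral0 ?mulr0// => y.
  by rewrite mul0r.
under eq_fun do rewrite big_cons; split; first exact: ctestD.
by rewrite fourier_pairingD// F0 IH2 addr0.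
Qed.

End fourier_pairing.

(** * Decomposition of test functions supported in an annulus *)

Section annular_decomposition.
Context {R : realType} {d : nat}.
Local Notation V := 'rV[R]_d.
Variable nu : V -> R[i].
Hypothesis nu_smooth : csmooth_on (~` [set 0]) nu.
Hypothesis nu_nontriv : forall xi : V, unit_vector xi -> nontrivial_in_direction nu xi.

(** A set of positive measure is nonempty. Writing dilations as [expR a] lets all real numbers index
    them, with positivity built in. *)
Lemma nontrivial_dilate (x : V) : x != 0 -> exists a : R, nu (expR a *: x) != 0.
Proof.
(* Unit vectors are Euclidean, so [x] is normalized by its Euclidean length rather than by the sup
   norm. *)
move=> x0; pose N := Num.sqrt (dot x x).
have N0 : 0 < N.
  rewrite sqrtr_gt0 (lt_le_trans _ (norm_sqr_le_dot x))//.
  by rewrite exprn_gt0// normr_gt0.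
have /nu_nontriv : unit_vector (N^-1 *: x).
  rewrite /unit_vector dotZl dotC dotZl mulrA -expr2 exprVn sqr_sqrtr ?mulVf//.
    by apply: lt0r_neq0; rewrite -sqrtr_gt0.
  by apply/ltW; rewrite -sqrtr_gt0.
rewrite /nontrivial_in_direction => h.
have [r [r0]] : [set r : R | 0 < r /\ nu (r *: (N^-1 *: x)) != 0] !=set0.
  by apply/set0P/eqP => E; move: h; rewrite E measure0 ltxx.
rewrite scalerA => nr; exists (ln (r / N)).
by rewrite lnK// posrE divr_gt0.
Qed.

(** The squared modulus of [nu] at the dilated point; unlike the modulus, it is smooth also where
    [nu] vanishes. *)
Let q (a : R) (x : V) : R :=
  complex.Re (nu (expR a *: x)) ^+ 2 + complex.Im (nu (expR a *: x)) ^+ 2.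

Let q_ge0 a x : 0 <= q a x.
Proof. by rewrite addr_ge0 ?sqr_ge0. Qed.

Let smooth_q a : smooth_on (~` [set (0 : V)]) (q a).
Proof.
have [s1 s2] := csmooth_scale (lt0r_neq0 (expR_gt0 a)) nu_smooth.
have o := @open_neq0 R d.
exact: (smooth_onD o (smooth_onM o s1 s1) (smooth_onM o s2 s2)).
Qed.

Let nuM a x : nu (expR a *: x) * Num.conj (nu (expR a *: x)) = (q a x)%:C.
Proof.
rewrite /q; move: (nu _) => z; apply: complex_eqP.
  by rewrite Re_mul Re_conj Im_conj /= mulrN opprK !expr2.
by rewrite Im_mul Re_conj Im_conj /= mulrN mulrC addNr.
Qed.

Lemma open_smooth_neq0 (k : V -> R) : smooth_on (~` [set (0 : V)]) k ->
  open [set x | x != 0 /\ k x != 0].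
Proof.
move=> sk; rewrite openE => x [x0 kx]; rewrite /interior.
have O : nbhs x (~` [set (0 : V)]).
  by apply: open_nbhs_nbhs; split; [exact: open_neq0|exact/eqP].
have ck := smooth_on_continuous sk (nbhs_singleton O).
have K : nbhs x [set y | k y != 0] by have /cvgr_neq0 := ck; apply.
by apply: filterS2 O K => y /eqP.
Qed.

Lemma annular_decomposition g : annular g -> exists (s : seq R) (h : R -> V -> R[i]),
  (forall a, annular (h a)) /\
  forall x, g x = \sum_(a <- s) h a x * Num.conj (nu (expR a *: x)).
Proof.
move=> [tg [r r0 gr]]; have [M gM] := ctest_eq0_far tg.
pose K := [set x : V | r <= `|x| /\ `|x| <= M].
have gK x : ~ K x -> g x = 0.
  move=> nK; have [/gr//|rx] := ltP `|x| r.
  by apply: gM; rewrite leNgt; apply/negP => /ltW xM; exact: nK.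
have Kx0 x : K x -> x != 0.
  by move=> [rx _]; rewrite -normr_gt0 (lt_le_trans r0).
have := @compact_annulus R d r M; rewrite compact_cover => cK.
have [|x Kx|D _ KD] := cK R setT (fun a => [set x : V | x != 0 /\ q a x != 0]).
- by move=> a _; exact: open_smooth_neq0.
- have [a na] := nontrivial_dilate (Kx0 x Kx); exists a => //; split; first exact: Kx0.
  apply: contra na => /eqP q0; apply/eqP.
  move: q0; rewrite /q; case: (nu _) => u v /= /eqP.
  by rewrite paddr_eq0 ?sqr_ge0// !sqrf_eq0 => /andP[/eqP-> /eqP->].
pose s : seq R := finmap.enum_fset D; pose N (x : V) := \sum_(a <- s) q a x.
have sN : smooth_on (~` [set (0 : V)]) N.
  by apply: smooth_on_sum => //; exact: open_neq0.
have NK x : K x -> N x != 0.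
  move=> /KD[a /= aD [_ qa]]; rewrite /N psumr_neq0//.
  by apply/hasP; exists a => //=; rewrite lt_def qa q_ge0.
pose W := [set x : V | x != 0 /\ N x != 0].
have oW : open W by exact: open_smooth_neq0.
have oK : open (~` K) by apply: closed_openC; exact: closed_annulus.
(* The quotient is glued from [W], where the denominator does not vanish, and the complement of [K],
   where [k] and hence the quotient is identically 0. Both are open and together they cover the
   space. *)
have sNV (k : V -> R) : smooth_on [set: V] k -> (forall x, ~ K x -> k x = 0) ->
    smooth_on [set: V] (fun x => (N x)^-1 * k x).
  move=> sk kK.
  have sW : smooth_on W (fun x => (N x)^-1 * k x).
    apply: (smooth_onM oW); last by apply: smooth_on_subset sk.
    apply: (smooth_onV oW); first by move=> x [].
    by apply: smooth_on_subset sN => x [/eqP].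
  have sC : smooth_on (~` K) (fun x => (N x)^-1 * k x).
    by apply: (eq_smooth_on oK _ (smooth_on_cst 0 oK)) => x nK; rewrite kK// mulr0.
  apply: smooth_on_subset (smooth_on_setU sW sC) => x _.
  have [Kx|nKx] := pselect (K x); [left|by right].
  by split; [exact: Kx0|exact: NK].
pose u (x : V) : R[i] := ((N x)^-1)%:C * g x.
have au : annular u.
  have [[g1 [M1 gM1]] [g2 [M2 gM2]]] := tg.
  split; last by exists r => // x /gr; rewrite /u => ->; rewrite mulr0.
  split; split.
  - under eq_fun do rewrite Re_mul/= mul0r subr0.
    by apply: sNV => // x /gK ->.
  - by exists M1 => x /gM1 /= e; rewrite Re_mul/= e mul0r mulr0 subr0.
  - under eq_fun do rewrite Im_mul/= mul0r addr0.
    by apply: sNV => // x /gK ->.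
  - by exists M2 => x /gM2 /= e; rewrite Im_mul/= e mul0r mulr0 addr0.
(* With u = g/N, the a-th term of the sum is u q_a, and the q_a add up to N. *)
exists s, (fun a x => nu (expR a *: x) * u x); split.
  by move=> a; apply: annularM au; apply: csmooth_scale => //; exact: lt0r_neq0 (expR_gt0 a).
move=> x; rewrite (eq_bigr (fun a => u x * (q a x)%:C)); last first.
  by move=> a _; rewrite -nuM mulrA (mulrC (u x)).
rewrite -mulr_sumr -(rmorph_sum (@real_complex R)) /=.
have [Kx|/gK g0] := pselect (K x); last by rewrite /u g0 mulr0 mul0r.
rewrite /u mulrAC -rmorphM/= mulVf; first by rewrite mul1r.
exact: NK.
Qed.

End annular_decomposition.

(** * Extension across the origin *)

Section dilated_plateau.
Context {R : realType} {d : nat}.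
Local Notation V := 'rV[R]_d.
Local Notation mu := (lebesgue_rV R d).

Lemma cplateau_near0 : exists2 r : R, 0 < r & forall x : V, `|x| < r -> cplateau x = 1.
Proof.
(* Within this radius dot x x <= d |x|^2 <= 1; the summand 1 keeps the inverse at most 1. *)
exists (d%:R + 1)^-1 => [|x xr]; first by rewrite invr_gt0 ltr_wpDl.
rewrite /cplateau plateau_eq1//; apply: le_trans (ler_norm _) _.
apply: le_trans (dot_le_norm _ _) _.
have d1 : 0 < d%:R + 1 :> R by rewrite ltr_wpDl.
have x1 : `|x| <= 1.
  by apply: le_trans (ltW xr) _; rewrite invf_le1// lerDr.
have dx : d%:R * `|x| <= 1.
  apply: le_trans (_ : (d%:R + 1) * (d%:R + 1)^-1 <= _); last by rewrite mulfV// gt_eqF.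
  by apply: ler_pM => //; [rewrite lerDl|exact: ltW].
by rewrite mulrA; apply: mulr_ile1 => //; rewrite mulr_ge0.
Qed.

(** A character cut off at scale 1/a. Its transform is a translated and dilated copy of
    [fourier cplateau], with L^1 norm independent of a and y and supremum of order a^(-d). *)
Definition wave_packet (a : R) (y w : V) : R[i] := cis (phase y w) * cplateau (a *: w).

Lemma ctest_dilated_plateau (a : R) : a != 0 -> ctest (fun w : V => cplateau (a *: w)).
Proof.
move=> a0; have := ctest_affine 0 a0 (@ctest_cplateau R d).
by congr ctest; apply/funext => w; rewrite addr0.
Qed.

Lemma ctest_wave_packet (a : R) y : a != 0 -> ctest (wave_packet a y).
Proof. by move=> a0; apply: ctest_cis; exact: ctest_dilated_plateau. Qed.

Lemma fourier_wave_packet (a : R) (y x : V) : a != 0 ->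
  fourier (wave_packet a y) x = (`|a|^-1 ^+ d)%:C * fourier cplateau (a^-1 *: x + - (a^-1 *: y)).
Proof.
move=> a0.
rewrite fourier_cis (fourier_scale _ a0 (ctest_cintegrable (@ctest_cplateau R d))).
by rewrite scalerBr.
Qed.

End dilated_plateau.

Lemma integral_EFin_Rintegral (R : realType) d1 (T : measurableType d1)
    (m : {measure set T -> \bar R}) (g : T -> R) :
  m.-integrable setT (EFin \o g) -> (\int[m]_x (g x)%:E = (\int[m]_x g x)%:E)%E.
Proof. by move=> ig; rewrite /Rintegral fineK//; exact: integrable_fin_num ig. Qed.

Section fourier_pairing_eq0.
Context {R : realType} {d : nat}.
Local Notation V := 'rV[R]_d.
Local Notation mu := (lebesgue_rV R d).
Variables (p : R) (f : V -> R[i]).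
Hypotheses (d1 : (1 <= d)%N) (p1 : 1 <= p) (fp : Lp_fun p%:E f).
Hypothesis annular_eq0 : forall g, annular g -> fourier_pairing f g = 0.

(** The two packets differ by an annular function, because both plateaus equal 1 near the origin. *)
Lemma fourier_pairing_wave_packet (a : R) y : a != 0 ->
  fourier_pairing f (wave_packet a y) = fourier_pairing f (wave_packet 1 y).
Proof.
move=> a0; pose h (w : V) := cis (phase y w) * (cplateau (a *: w) + -1 * cplateau (1 *: w)).
have n1 : 1 != 0 :> R by exact: oner_neq0.
have th : ctest h.
  apply: ctest_cis; apply: ctestD; first exact: ctest_dilated_plateau.
  by apply: ctestZ; exact: ctest_dilated_plateau.
have ah : annular h.
  split => //; have [r r0 hr] := @cplateau_near0 R d.
  exists (Num.min r (r / `|a|)) => [|w]; first by rewrite lt_min r0 divr_gt0// normr_gt0.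
  rewrite lt_min ltr_pdivlMr ?normr_gt0// mulrC -normrZ => /andP[w1 w2].
  by rewrite /h scale1r !hr// mulr1 subrr mulr0.
have -> : wave_packet a y = fun w => wave_packet 1 y w + h w.
  by apply/funext => w; rewrite /h /wave_packet; ring.
by rewrite (fourier_pairingD p1 fp (ctest_wave_packet y n1) th) (annular_eq0 ah) addr0.
Qed.

(** This is [Lp_pairing_bound] for the transform of a packet. The bound is uniform in [y], and the
    level [l] stays free. *)
Lemma integral_wave_packet_le : exists A B : R, [/\ 0 <= A, 0 <= B &
  forall (a l : R) (y : V), 0 < a -> 0 < l ->
    (\int[mu]_x (Normc.normc (f x) * Normc.normc (fourier (wave_packet a y) x))%:E <=
     (l * A + l `^ (1 - p) * a^-1 ^+ d * B)%:E)%E].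
Proof.
have tc := @ctest_cplateau R d; have ic := fourier_cintegrable tc.
pose A := \int[mu]_x Normc.normc (fourier cplateau x : R[i]).
pose B := 2 * \int[mu]_x Normc.normc (cplateau x : R[i]).
pose F := fine (\int[mu]_x (Normc.normc (f x) `^ p)%:E)%E.
have A0 : 0 <= A by apply: Rintegral_ge0 => x _; exact: normc_ge0.
have B0 : 0 <= B by rewrite mulr_ge0//; apply: Rintegral_ge0 => x _; exact: normc_ge0.
have Fge0 : (0 <= \int[mu]_x (Normc.normc (f x) `^ p)%:E)%E.
  by apply: integral_ge0 => x _; rewrite lee_fin powR_ge0.
have F0 : 0 <= F by exact: fine_ge0.
exists A, (B * F); split; [by []|by rewrite mulr_ge0|].
move=> a l y a0 l0; have an0 : a != 0 by rewrite gt_eqF.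
have av0 : a^-1 != 0 by rewrite invr_eq0.
have tw := ctest_wave_packet y an0; have iw := fourier_cintegrable tw.
have ad0 : 0 <= a^-1 ^+ d by rewrite exprn_ge0// invr_ge0 ltW.
have E x : Normc.normc (fourier (wave_packet a y) x) =
    a^-1 ^+ d * Normc.normc (fourier cplateau (a^-1 *: x + - (a^-1 *: y))).
  by rewrite fourier_wave_packet// Normc.normcM normc_RtoC (gtr0_norm a0) ger0_norm.
have wB x : Normc.normc (fourier (wave_packet a y) x) <= a^-1 ^+ d * B.
  by rewrite E ler_wpM2l//; apply: normc_fourier; exact: ctest_cintegrable.
have wA' : \int[mu]_x Normc.normc (fourier (wave_packet a y) x) = A.
  under eq_Rintegral do rewrite E.
  have inc := cintegrable_normc ic.
  rewrite (RintegralZl _ measurableT (integrable_affine (- (a^-1 *: y)) av0 inc)).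
  rewrite (Rintegral_affine _ av0 inc) mulrA -exprMn normfV invrK (gtr0_norm a0).
  by rewrite mulVf// expr1n mul1r.
have wA : (\int[mu]_x (Normc.normc (fourier (wave_packet a y) x))%:E = A%:E)%E.
  by rewrite (integral_EFin_Rintegral (cintegrable_normc iw)) wA'.
have wF : (\int[mu]_x (Normc.normc (f x) `^ p)%:E = F%:E)%E.
  apply/esym/fineK; rewrite (ge0_fin_numE Fge0); exact: Lp_fun_integral_powR p1 fp.
have := Lp_pairing_bound p1 l0 (mulr_ge0 ad0 B0) (Lp_fun_cmeasurable fp) iw.1 wB.
rewrite wA wF -!EFinM -EFinD.
by rewrite (_ : l `^ (1 - p) * (a^-1 ^+ d * B) * F = l `^ (1 - p) * a^-1 ^+ d * (B * F)); last ring.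
Qed.

Lemma normc_fourier_pairing_wave_packet : exists A B : R, [/\ 0 <= A, 0 <= B &
  forall (a l : R) (y : V), 0 < a -> 0 < l ->
    Normc.normc (fourier_pairing f (wave_packet a y)) <= l * A + l `^ (1 - p) * a^-1 ^+ d * B].
Proof.
have [A [B [A0 B0 AB]]] := integral_wave_packet_le.
exists (2 * A), (2 * B); split; [by rewrite mulr_ge0..|].
move=> a l y a0 l0; have an0 : a != 0 by rewrite gt_eqF.
have ifw := Lp_fourier_cintegrable p1 fp (ctest_wave_packet y an0).
apply: le_trans (normc_cintegral ifw) _.
have -> : l * (2 * A) + l `^ (1 - p) * a^-1 ^+ d * (2 * B) =
    2 * (l * A + l `^ (1 - p) * a^-1 ^+ d * B) by ring.
rewrite ler_wpM2l// -lee_fin -(integral_EFin_Rintegral (cintegrable_normc ifw)).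
by under eq_integral do rewrite /= Normc.normcM; exact: AB.
Qed.

Lemma wave_packet_eq0 (a : R) (y : V) : a != 0 -> fourier_pairing f (wave_packet a y) = 0.
Proof.
move=> a0; rewrite fourier_pairing_wave_packet//.
have [A [B [A0 B0 AB]]] := normc_fourier_pairing_wave_packet.
set z := fourier_pairing _ _.
have zl (l : R) : 0 < l -> Normc.normc z <= l * (A + 1).
  move=> l0; pose c := l `^ (1 - p) * B.
  have c0 : 0 <= c by rewrite mulr_ge0// powR_ge0.
  have c1 : 0 < c + 1 by rewrite ltr_wpDl.
  (* [b] is 1/a for the packet used next. From b <= 1 and d >= 1 one gets b^d <= b, and then c b^d
     <= l. *)
  pose b := Num.min 1 (l / (c + 1)).
  have b0 : 0 < b by rewrite lt_min ltr01 divr_gt0.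
  have bV0 : 0 < b^-1 by rewrite invr_gt0.
  have := AB b^-1 l y bV0 l0; rewrite fourier_pairing_wave_packet ?gt_eqF// -/z => /le_trans; apply.
  rewrite invrK mulrDr mulr1 lerD2l mulrAC -/c.
  apply: le_trans (_ : c * b <= _).
    by rewrite ler_wpM2l//; apply: ler_iXnr => //; [exact: ltW|rewrite ge_min lexx].
  apply: le_trans (_ : c * (l / (c + 1)) <= _).
    by rewrite ler_wpM2l// ge_min lexx orbT.
  by rewrite mulrCA ler_piMr ?ltW// ltr_pdivrMr// mul1r ltrDl.
apply: Normc.eq0_normc; apply/eqP; rewrite eq_le normc_ge0 andbT leNgt; apply/negP => z0.
have A1 : 0 < 2 * (A + 1) by rewrite mulr_gt0// ltr_wpDl.
(* At this level the bound reads |z| <= |z|/2. *)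
have := zl (Normc.normc z / (2 * (A + 1))) (divr_gt0 z0 A1).
apply/negP; rewrite -ltNge mulrAC ltr_pdivrMr// ltr_pM2l//.
by rewrite ltr_pMl ?ltr1n// ltr_wpDl.
Qed.

(** Let v be a dilated plateau equal to 1 on the support of g. Then c g = (fourier2 g) v, whose
    transform is the convolution of [fourier g] and [fourier v]. Each translate of [fourier v] is
    the transform of a wave packet, so Fubini leaves an integral of vanishing pairings. *)
Lemma fourier_pairing_eq0 g : ctest g -> fourier_pairing f g = 0.
Proof.
move=> tg; have [c c0 inv] := @fourier_inversion R d.
have [r r0 hr] := @cplateau_near0 R d; have [M hM] := ctest_eq0_far tg.
(* For |w| < M this gives |a w| < r, hence [v w = 1]; the absolute value covers a nonpositive
   [M]. *)
pose a := r / (`|M| + 1).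
have M1 : 0 < `|M| + 1 by rewrite ltr_wpDl.
have a0 : 0 < a by rewrite divr_gt0.
have an0 : a != 0 by rewrite gt_eqF.
pose v (w : V) := cplateau (a *: w).
have tv : ctest v by exact: ctest_dilated_plateau.
have gv w : fourier2 g w * v w = c * g w.
  rewrite inv//; have [Mw|wM] := leP M `|w|; first by rewrite (hM _ Mw) mulr0 mul0r.
  rewrite /v hr ?mulr1// normrZ gtr0_norm// /a mulrAC ltr_pdivrMr//.
  by rewrite ltr_pM2l// (lt_le_trans wM)// (le_trans (ler_norm _))// lerDl.
have ig := ctest_cintegrable tg; have ifg := Lp_fourier_cintegrable p1 fp tg.
apply: (mulfI c0); rewrite mulr0 -cintegralZ//.
have iv := ctest_cintegrable tv.
have ifgv (x : V) : cintegrable mu (fun y => fourier g y * fourier v (x - y)).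
  have n0 : -1 != 0 :> R by rewrite oppr_eq0 oner_neq0.
  have := cintegrable_affine x n0 (fourier_cintegrable tv).
  rewrite (_ : (fun y => _) = (fun y => fourier v (x - y))) => [ivx|].
    by apply: (cintegrableM (fourier_cintegrable tg) ivx.1) => y; exact: normc_fourier.
  by apply/funext => y; rewrite scaleN1r addrC.
rewrite (eq_cintegral (g := fun x => f x * cintegral (fun y => fourier g y * fourier v (x - y)))); last first.
  move=> x; rewrite -(fourier_fourier2M x tg tv) mulrCA.
  have -> : (fun w => fourier2 g w * v w) = fun w => c * g w by apply/funext => w; exact: gv.
  by rewrite (fourierZ c x ig).
have vE (x y : V) : fourier v (x - y) = fourier (wave_packet a y) x by rewrite fourier_cis.
have [A [B [_ _ AB]]] := integral_wave_packet_le.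
have mK : cmeasurable (fun z : V * V => fourier v (z.1 - z.2)).
  apply: (cmeasurable_comp (ccontinuous_cmeasurable (fourier_ccontinuous tv))).
  by have := @measurable_scale_sub R d 1; under eq_fun do rewrite scale1r.
(* Any level serves here, as only uniformity in [y] matters; l = 1 is taken. *)
have KC (y : V) : (\int[mu]_x (Normc.normc (f x) * Normc.normc (fourier v (x - y)))%:E <=
    (1 * A + 1 `^ (1 - p) * a^-1 ^+ d * B)%:E)%E.
  by under eq_integral do rewrite vE; exact: AB.
rewrite (cintegral_kernel_swap (Lp_fun_cmeasurable fp) (fourier_cintegrable tg) mK ifgv KC).
rewrite -[RHS](@cintegral0 R d); apply: eq_cintegral => y.
rewrite (eq_cintegral (g := fun x => f x * fourier (wave_packet a y) x)).
  by rewrite [X in _ * X](wave_packet_eq0 y an0) mulr0.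
by move=> x; rewrite vE.
Qed.

Lemma fourier_pairing_annular_eq0_ae : {ae mu, forall x, f x = 0}.
Proof.
have n0 (n : nat) : n.+1%:R != 0 :> R by [].
pose v (n : nat) (w : V) := cplateau (n.+1%:R *: w) : R[i].
have tv n : ctest (v n) by exact: ctest_dilated_plateau.
have z n : {ae mu, forall x, f x * fourier (v n) x = 0}.
  apply: (fourier_eq0_ae (Lp_fourier_cintegrable p1 fp (tv n))) => w.
  have n1 : 1 != 0 :> R by exact: oner_neq0.
  (* Translating [v n] multiplies its transform by a character, so pairing [f] with the transform of
     the translate gives the Fourier transform of the product at [w]. *)
  have tvw := ctest_affine (- w) n1 (tv n).
  rewrite -[RHS](fourier_pairing_eq0 tvw) fourierE; apply: eq_cintegral => x.
  rewrite (_ : (fun x => _) = fun x => v n (x + - w)); last first.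
    by apply/funext => y; rewrite scale1r.
  rewrite fourier_trans; last exact: ctest_cintegrable.
  by rewrite (phaseC x) phaseNl; ring.
have tc := @ctest_cplateau R d; have P0 := @fourier_cplateau0_neq0 R d.
have [C _ hC] := ctest_le_weight2 tc.
have [L L0 hL] := fourier_lipschitz (ctest_cmeasurable tc) hC.
pose z0 := Normc.normc (fourier cplateau (0 : V)).
have z00 : 0 < z0.
  by rewrite lt_def normc_ge0 andbT; apply: contra P0 => /eqP/Normc.eq0_normc ->.
(* The Lipschitz bound spreads the nonvanishing at 0 to an explicit ball. Its dilates by n + 1 cover
   the space, so countably many null sets are discarded. *)
have he (x : V) : (L + 1) * `|x| < z0 -> fourier cplateau x != 0.
  move=> xe; apply/eqP => Px; have := hL 0 x; rewrite Px subr0 sub0r normrN => h.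
  have Lx : L * `|x| <= (L + 1) * `|x| by rewrite ler_wpM2r// lerDl.
  by have := le_lt_trans (le_trans h Lx) xe; rewrite ltxx.
have : {ae mu, forall x, forall n, f x * fourier (v n) x = 0} by exact/ae_foralln.
apply: filterS => x hx.
have L1 : 0 < L + 1 by rewrite ltr_wpDl.
(* Chosen so that x/(n+1) lies in the ball of [he]. *)
pose n := Num.truncn ((L + 1) * `|x| / z0).
have xn : (L + 1) * `|n.+1%:R^-1 *: x| < z0.
  have := truncnS_gt ((L + 1) * `|x| / z0).
  rewrite (ltr_pdivrMr _ _ z00) -/n => h.
  by rewrite normrZ normfV (gtr0_norm (ltr0Sn R n)) mulrCA (ltr_pdivrMl _ _ (ltr0Sn R n)).
have := hx n; rewrite /v (fourier_scale _ (n0 n) (ctest_cintegrable tc)) => /eqP.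
rewrite !mulf_eq0 (negPf (he _ xn)) orbF => /orP[/eqP//|].
rewrite eq_complex/= eqxx andbT expf_eq0 invr_eq0 normr_eq0 (negPf (n0 n)) andbF//.
Qed.

End fourier_pairing_eq0.

Theorem theorem2 (R : realType) (d : nat) (hd : (1 <= d)%N)
  (p : R) (hp : 1 <= p)
  (p' : \bar R) (hpp' : (p%:E^-1 + p'^-1 = 1)%E)
  (f psi : 'rV[R]_d -> R[i])
  (hf : Lp_fun p%:E f) (hpsi : Lp_fun p' psi)
  (nu : 'rV[R]_d -> R[i])
  (nu_smooth : csmooth_on (~` [set 0]) nu)
  (nu_psi : represents_on (~` [set 0])
              (fourier_distribution (distribution_of psi)) nu)
  (hzero : forall (s : R) (t : 'rV[R]_d), 0 < s ->
     pairing f (dilate_translate psi s t) = 0)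
  (hnontriv : forall xi : 'rV[R]_d, unit_vector xi ->
     nontrivial_in_direction nu xi) :
  {ae lebesgue_rV R d, forall x, f x = 0}.
Proof.
apply: (fourier_pairing_annular_eq0_ae hd hp hf) => g ag.
have [s [h [ah gh]]] := annular_decomposition nu_smooth hnontriv ag.
pose F a x := h a x * Num.conj (nu (expR a *: x)).
have tF a : ctest (F a).
  have e0 := lt0r_neq0 (expR_gt0 a).
  have [] := annularM (csmooth_conj open_neq0 (csmooth_scale e0 nu_smooth)) (ah a).
  by move=> th _; move: th; congr ctest; apply/funext => x; rewrite mulrC.
have F0 a : fourier_pairing f (F a) = 0.
  exact: (wavelet_orthogonality hp hpp' hf hpsi nu_smooth nu_psi hzero (expR_gt0 a) (ah a)).
have [_ <-] := fourier_pairing_sum_eq0 hp hf s tF F0.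
by congr fourier_pairing; apply/funext => x; exact: gh.
Qed.
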